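(* There exists a non-renormalizable dynamically natural complex box mapping $F\colon \mathcal U\to \mathcal V$ with $\mathrm{meas}(K(F)) > 0$ and a measurable invariant line field supported on $K(F)$. Moreover, there is such an example with the following properties: (1) $\mathrm{Crit}(F) = \{c\}$ and $F^2(c) = F(c)$, i.e. the unique critical point of $F$ is strictly pre-fixed; (2) $\mathcal V$ consists of two components $V$ and $V'$ such that $U:=\mathcal U\cap V=V$ contains $c$ and such that $F(c)$ is contained in a component $U'$ of $\mathcal U\cap V'$; (3) $\mathcal U \cap V'$ contains infinitely many components and they tile $V'$; (4) $F(U') = V'$, and for each component $U''$ of $\mathcal U\cap V'$ distinct from $U'$ one has $F(U'')=V$.
   Context: A topological disk is an open simply connected subset of $\mathbb C$; a Jordan disk is a topological disk whose boundary is a Jordan curve; $A\Subset B$ means $\overline A\subset B$; $\mathrm{meas}$ is Lebesgue measure; $\mathrm{mod}$ is the conformal modulus of an annulus; $\mathrm{Comp}_xB$ is the connected component of $B$ containing $x$. A complex box mapping is a holomorphic map $F\colon\mathcal U\to\mathcal V$ between open sets $\mathcal U\subset\mathcal V\subset\mathbb C$ such that: (i) $F$ has finitely many critical points; (ii) $\mathcal V$ is a union of finitely many Jordan disks with disjoint closures; (iii) every component $V$ of $\mathcal V$ is either a component of $\mathcal U$, or $V\cap\mathcal U$ is a (possibly infinite) union of Jordan disks with pairwise disjoint closures, each compactly contained in $V$; (iv) for every component $U$ of $\mathcal U$, $F(U)$ is a component of $\mathcal V$ and $F\colon U\to F(U)$ is proper. $\mathrm{Crit}(F)$ is the set of critical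 points. The components of $F^{-n}(\mathcal V)$ are the puzzle pieces of depth $n\ge0$; $K(F)=\bigcap_{n\ge0}F^{-n}(\mathcal V)$. A puzzle neighborhood of a finite set $A$ is a finite union $W$ of puzzle pieces with $A\subset W$ and each component of $W$ intersecting $A$. $K_{\text{off-crit}}(F)$ is the set of $x\in K(F)$ whose forward orbit is disjoint from some puzzle neighborhood of $\mathrm{Crit}(F)$ (all of $K(F)$ if $\mathrm{Crit}(F)=\emptyset$). Let $m_F(x)=\mathrm{mod}(\mathrm{Comp}_x\mathcal V\setminus\overline{\mathrm{Comp}_x\mathcal U})$ ($0$ if the two components are equal), $K_\delta(F)=\{y\in K(F):\limsup_{k}m_F(F^k(y))>\delta\}$, $K_{\text{well-inside}}(F)=\bigcup_{\delta>0}K_\delta(F)$. No permutation condition: for each component $U$ of $\mathcal U$ there is $n\ge0$ with $F^n(U)\setminus\mathcal U\ne\emptyset$. $F$ is dynamically natural if it satisfies the no permutation condition, $K_{\text{off-crit}}(F)$ has Lebesgue measure zero and $K(F)=K_{\text{well-inside}}(F)$. $F$ is renormalizable if there are $s\ge1$, $c\in\mathrm{Crit}(F)$ and topological disks $U\Subset V\subset\mathcal U$ with $c\in U$ such that $F^s\colon U\to V$ is a polynomial-like map (holomorphic branched covering of degree at least two) with connected Julia set; otherwise non-renormalizable. A line field on $B$ is an assignment of a real line through each point $z$ of a subset $E\subset B$ of positive measure such that the slope is a measurable function of $z$; it is invariant if $F^{-1}(E)=E$ and $D_zF$ maps the line at $z$ to the line at $F(z)$. ''Tile $V'$'' means that the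 (pairwise disjoint) components cover $V'$ up to a set of Lebesgue measure zero. *)

(* Defs.v *)
From HB Require Import structures.
From mathcomp Require Import all_boot all_order all_algebra.
From mathcomp Require Import all_classical all_reals all_analysis measurable_realfun.
From mathcomp Require Export complex.
Export numFieldNormedType.Exports.
Set Implicit Arguments.
Unset Strict Implicit.
Unset Printing Implicit Defensive.
Import Order.TTheory GRing.Theory Num.Theory.
Local Open Scope classical_set_scope.
Local Open Scope ring_scope.

(* The complex plane is R[i]^o: R[i] with its norm topology, normed over
   itself, so that derivable and derive1 are complex differentiability and the
   complex derivative.  Partial maps F : U -> V are total functions together
   with their domain U; nothing depends on values outside U. *)

Section PlaneTopology.
Variable R : realType.
Local Notation C := (R[i]^o).
Implicit Types A B W J : set C.

Definition is_component B W := exists2 x, B x & W = connected_component B x.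

Definition frontier A := closure A `\` A°.

Definition simply_connected A :=
  [/\ A !=set0, connected A &
   forall g : R -> C, {within `[0, 1], continuous g} ->
     (forall t, t \in `[0, 1] -> A (g t)) -> g 0 = g 1 ->
   exists H : R * R -> C,
     [/\ {within `[0, 1] `*` `[0, 1], continuous H},
         forall s t, s \in `[0, 1] -> t \in `[0, 1] -> A (H (s, t)),
         forall t, t \in `[0, 1] -> H (0, t) = g t,
         forall t, t \in `[0, 1] -> H (1, t) = g 0 &
         forall s, s \in `[0, 1] -> H (s, 0) = g 0 /\ H (s, 1) = g 0]].

Definition topological_disk A := open A /\ simply_connected A.

Definition jordan_curve J :=
  exists g : R -> C, [/\ {within `[0, 1], continuous g},
    {in `[0, 1[ &, injective g}, g 0 = g 1 & J = g @` `[0, 1]].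

Definition jordan_disk A := topological_disk A /\ jordan_curve (frontier A).

Definition holomorphic_on A (f : C -> C) := forall z, A z -> derivable f z 1.

Definition critical_points A (f : C -> C) : set C :=
  [set z | A z /\ derive1 f z = 0].

Definition proper_map A B (f : C -> C) :=
  f @` A `<=` B /\
  forall L, L `<=` B -> compact L -> compact (A `&` f @^-1` L).

End PlaneTopology.

Section PlaneMeasure.
Variable R : realType.
Local Notation C := (R[i]^o).
Local Open Scope ereal_scope.

Local Notation plane := (measurableTypeR R * measurableTypeR R)%type.
Local Notation leb2 := (@lebesgue_measure R \x @lebesgue_measure R).

Definition to_plane (p : plane) : C := (p.1 +i* p.2)%C.

(* The product measure is only meaningful on Borel sets; its outer extension is
   defined on all sets, and the Caratheodory-measurable sets of the latter are
   exactly the Lebesgue measurable sets of the plane. *)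
Definition area (A : set C) : \bar R := (leb2^*)%mu (to_plane @^-1` A).

Definition lebesgue_measurable (A : set C) :=
  (leb2^*)%mu.-caratheodory (to_plane @^-1` A).

Definition re_path (g : R -> C) (t : R) : R := complex.Re (g t).

Definition im_path (g : R -> C) (t : R) : R := complex.Im (g t).

Definition speed (g : R -> C) (t : R) : R :=
  Num.sqrt ((derive1 (re_path g) t) ^+ 2 +
            (derive1 (im_path g) t) ^+ 2)%R.

(* Arcs, C^1 on the open interval, running in A and joining two distinct
   components of its complement.  For a bounded annulus this means joining its
   two boundary components. *)
Definition crosses (A : set C) (g : R -> C) :=
  [/\ {within `[0%R, 1%R], continuous g},
      (forall t, t \in `]0%R, 1%R[ ->
         [/\ A (g t), derivable (re_path g) t 1%R
           & derivable (im_path g) t 1%R]),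
      {within `]0%R, 1%R[, continuous derive1 (re_path g)},
      {within `]0%R, 1%R[, continuous derive1 (im_path g)} &
      [/\ ~ A (g 0%R), ~ A (g 1%R) &
          connected_component (~` A) (g 0%R) <>
          connected_component (~` A) (g 1%R)]].

Definition metric_length (rho : C -> \bar R) (g : R -> C) : \bar R :=
  \int[@lebesgue_measure R]_(t in `]0%R, 1%R[) (rho (g t) * (speed g t)%:E).

(* The modulus of a bounded annulus A is the extremal length of the family of
   arcs in A joining its two boundary components, i.e. the supremum of L^2 over
   conformal metrics rho |dz| of area at most 1, where L is the infimum of the
   rho-lengths of these arcs.  For {r < |z| < s} this is ln (s / r) / (2 pi). *)
Definition modulus (A : set C) : \bar R :=
  ereal_sup [set (ereal_inf (metric_length rho @` crosses A)) ^+ 2 |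
    rho in [set rho : C -> \bar R |
      [/\ forall z, 0 <= rho z,
          measurable_fun [set: plane] (rho \o to_plane) &
          \int[leb2]_(p in to_plane @^-1` A) (rho (to_plane p)) ^+ 2 <= 1]]].

End PlaneMeasure.

Section BoxMappings.
Variable R : realType.
Local Notation C := (R[i]^o).
Variables (F : C -> C) (U V : set C).

Record complex_box_mapping : Prop := {
  box_open_dom : open U;
  box_open_cod : open V;
  box_sub : U `<=` V;
  box_maps : F @` U `<=` V;
  box_holo : holomorphic_on U F;
  box_crit : finite_set (critical_points U F);
  box_cod : exists D : set (set C),
    [/\ finite_set D, D `<=` @jordan_disk R, trivIset D closure &
        V = \bigcup_(W in D) W];
  box_dom : forall W, is_component V W ->
    is_component U W \/
    exists D : set (set C),
      [/\ D `<=` @jordan_disk R, trivIset D closure,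
          forall B, D B -> closure B `<=` W &
          W `&` U = \bigcup_(B in D) B];
  box_proper : forall W, is_component U W ->
    is_component V (F @` W) /\ proper_map W (F @` W) F
}.

(* F^{-n}(V), which for n = 0, 1 is V, U; also the domain of F^n. *)
Fixpoint iter_dom (n : nat) : set C :=
  if n is m.+1 then U `&` F @^-1` (iter_dom m) else V.

Definition puzzle_piece (W : set C) := exists n, is_component (iter_dom n) W.

Definition nonescaping : set C := \bigcap_n iter_dom n.

Definition crit : set C := critical_points U F.

Definition puzzle_neighborhood (A W : set C) :=
  [/\ exists P : set (set C),
        [/\ finite_set P, P `<=` puzzle_piece & W = \bigcup_(B in P) B],
      A `<=` W &
      forall B, is_component W B -> B `&` A !=set0].

(* When crit is empty the only puzzle neighborhood of crit is set0, so this is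
   all of nonescaping. *)
Definition off_crit : set C :=
  [set x | nonescaping x /\
    exists2 W, puzzle_neighborhood crit W & forall n, ~ W (iter n F x)].

Definition box_modulus (x : C) : \bar R :=
  let P := connected_component V x in
  let Q := connected_component U x in
  if pselect (P = Q) then 0%E else modulus (P `\` closure Q).

Definition inside (delta : R) : set C :=
  [set y | nonescaping y /\
    (delta%:E < limn_esup (fun k => box_modulus (iter k F y)))%E].

Definition well_inside : set C :=
  \bigcup_(delta in [set d : R | 0 < d]) inside delta.

(* F^n(W) is the set of all F^n z with z in W and F^n defined at z. *)
Definition no_permutation :=
  forall W, is_component U W ->
    exists n, (iter n F @` (W `&` iter_dom n)) `\` U !=set0.

Definition dynamically_natural :=
  [/\ no_permutation, area off_crit = 0%E & nonescaping = well_inside].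

(* A holomorphic branched covering of finite degree d is a surjective proper
   holomorphic map with exactly d preimages over each non-critical value. *)
Definition branched_covering (d : nat) (g : C -> C) (A B : set C) :=
  [/\ holomorphic_on A g, g @` A = B, proper_map A B g &
      forall w, B w -> ~ (g @` critical_points A g) w ->
        (A `&` g @^-1` [set w] #= `I_d)%card].

Definition polynomial_like (g : C -> C) (A B : set C) :=
  [/\ topological_disk A, topological_disk B, closure A `<=` B &
      exists2 d, (2 <= d)%N & branched_covering d g A B].

Definition filled_julia (g : C -> C) (A : set C) : set C :=
  [set z | forall n, A (iter n g z)].

Definition julia (g : C -> C) (A : set C) : set C :=
  frontier (filled_julia g A).

Definition renormalizable :=
  exists (s : nat) (c : C) (A B : set C),
    [/\ (1 <= s)%N, crit c, A c, B `<=` U &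
    [/\ A `<=` iter_dom s, polynomial_like (iter s F) A B &
        connected (julia (iter s F) A)]].

(* Directions of the real lines of slope a; vertical lines have slope +oo. *)
Definition real_line (a : \bar R) : set C :=
  if a is r%:E then [set v | complex.Im v = r * complex.Re v]
  else [set v | complex.Re v = 0].

(* The line field assigns to z in E the line through z of slope (s z). *)
Definition measurable_line_field (B E : set C) (s : C -> \bar R) :=
  [/\ E `<=` B, lebesgue_measurable E, (0%E < area E)%E,
      forall z, E z -> s z != -oo%E &
      forall Y : set (\bar R), measurable Y ->
        lebesgue_measurable (E `&` s @^-1` Y)].

Definition invariant_line_field (E : set C) (s : C -> \bar R) :=
  U `&` F @^-1` E = E /\
  forall z, E z ->
    [set derive1 F z * v | v in real_line (s z)] = real_line (s (F z)).

Definition line_field_box_mapping :=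
  [/\ complex_box_mapping, ~ renormalizable, dynamically_natural,
      (0%E < area nonescaping)%E &
      exists E s, measurable_line_field nonescaping E s /\
                  invariant_line_field E s].

End BoxMappings.

(* Main.v *)
(* Parametrize the target disk D(3,1) by z = 3 + w^2 with |w| < 1.  The box
   mapping sends w in the unit disk V to the point of parameter w, that is,
   w |-> 3 + w^2; it sends the point of parameter w to the point of parameter 2 w
   when |w| < 1/2, and to (w - b_k) / r_k in V when w is in a disk D(b_k,r_k).
   These disks and their opposites form a Vitali packing of the annulus
   1/2 < |w| < 1.  They stay away from the boundary of the annulus and from the
   imaginary axis by at least eight radii, so the moduli of the annuli around the
   corresponding components are bounded below.  The second iterate is a
   full-branched piecewise affine map of V with real slopes.  So almost every orbit
   is defined forever, and the self-similarity of the set of orbits that avoid a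
   given neighborhood of the critical point 0 forces this set to be null.  The
   horizontal line field on V and its push-forward by w |-> 3 + w^2 form an
   invariant line field.  The map is not renormalizable because the range of a
   renormalization would be connected and contain both 0 and its image, the fixed
   point 3, which lie in different components of the codomain. *)
Require Import Defs.
From mathcomp Require Import all_boot all_order all_algebra.
From mathcomp Require Import all_classical all_reals all_analysis.
From mathcomp Require Import measurable_realfun ring lra.
Set Implicit Arguments.
Unset Strict Implicit.
Unset Printing Implicit Defensive.
Import Order.TTheory GRing.Theory Num.Theory.
Import Normc.
Local Open Scope classical_set_scope.
Local Open Scope ring_scope.

(** * Topology of the plane *)

(** The delicate step is that orbits avoiding a disk about 0 form a null set. In the parameter [w]
    this set is covered by copies of itself under the inverse branches of the second iterate: one
    halved copy and two copies for every packed disk. The squared ratios add up to at most 1/4 + 2 *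
    3/8 = 1, so the copies alone give no contraction. The gain comes from the avoided disk of radius
    [(1 / 2) ^+ m]: the chain of halved copies breaks off after m steps, and the content of the set
    is at most [1 - ((1 / 2) ^+ m) ^+ 2] times itself.

    Sizes of arbitrary sets are measured by covers with disks. Such a size dominates area up to a
    constant; the converse, for bounded open sets, comes from the same Vitali packing that builds
    the map, and shows that circles, segments and the residue of the packing are null.

    The line field has no direction at the fixed point 3, where w = 0, so preimages of 3 are removed
    from its support. Orbits with imaginary [w] would carry a vertical line, but they leave the
    domain, so real slopes suffice. *)

Section PlaneBasics.
Variable R : realType.
Local Notation C := (R[i]^o).
Implicit Types (z w a b : C) (r s e : R).

Lemma norm_normc z : `|z| = (normc z)%:C%C.
Proof. by case: z. Qed.

Lemma nbhs_normc z (A : set C) :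
  nbhs z A <-> exists2 e : R, 0 < e & forall w, normc (w - z) < e -> A w.
Proof.
rewrite -nbhs_ballE; split=> [[e /= e0 eA]|[e e0 eA]].
  have := e0; rewrite ltcE /= => /andP[/eqP ie re].
  exists (complex.Re e) => // w hw; apply: eA.
  rewrite -ball_normE /= distrC norm_normc ltcE /= hw andbT; exact/eqP.
exists (e%:C)%C => /=; first by rewrite ltcR.
move=> w; rewrite -ball_normE /= distrC norm_normc ltcR; exact: eA.
Qed.

Definition disk a r : set C := [set z | normc (z - a) < r].
Definition cdisk a r : set C := [set z | normc (z - a) <= r].

Lemma normc_ge0 z : 0 <= normc z.
Proof. by case: z => x y; rewrite /= sqrtr_ge0. Qed.

Lemma normcB z w : normc (z - w) = normc (w - z).
Proof. by rewrite -normcN opprB. Qed.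

Lemma normc_triangle a z w : normc (z - w) <= normc (z - a) + normc (a - w).
Proof. by have -> : z - w = (z - a) + (a - w); [rewrite addrA subrK | exact: le_normcD]. Qed.

Lemma normc_gt0 z : (0 < normc z) = (z != 0).
Proof.
rewrite lt_def normc_ge0 andbT; congr negb.
by apply/eqP/eqP => [/eq0_normc//|->]; rewrite normc0.
Qed.

Lemma normc_real (x : R) : normc (x%:C)%C = `|x|.
Proof. by rewrite /= expr0n /= addr0 sqrtr_sqr. Qed.

Lemma sqr_normcE z : normc z ^+ 2 = complex.Re z ^+ 2 + complex.Im z ^+ 2.
Proof. by case: z => x y; rewrite /= sqr_sqrtr// addr_ge0 ?sqr_ge0. Qed.

Lemma Re_le_normc z : `|complex.Re z| <= normc z.
Proof.
by rewrite -(ler_pXn2r (n:=2)) ?nnegrE ?normc_ge0// sqr_normcE real_normK ?num_real// lerDl sqr_ge0.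
Qed.

Lemma Im_le_normc z : `|complex.Im z| <= normc z.
Proof.
by rewrite -(ler_pXn2r (n:=2)) ?nnegrE ?normc_ge0// sqr_normcE real_normK ?num_real// lerDr sqr_ge0.
Qed.

Lemma normc_le_ReIm z : normc z <= `|complex.Re z| + `|complex.Im z|.
Proof.
rewrite -(ler_pXn2r (n:=2)) ?nnegrE ?normc_ge0 ?addr_ge0// sqr_normcE sqrrD.
rewrite !real_normK ?num_real// lerD2r lerDl mulrn_wge0// mulr_ge0//.
Qed.

Lemma open_disk a r : open (disk a r).
Proof.
rewrite openE => z /= zr; apply/nbhs_normc; exists (r - normc (z - a)); first by rewrite subr_gt0.
move=> w hw; rewrite /disk /=; have := normc_triangle z w a; rewrite /disk /= in zr *; lra.
Qed.

Lemma cvg_normc (T : Type) (F : set_system T) (f : T -> C) (l : C) : Filter F ->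
  f @ F --> l <-> forall e : R, 0 < e -> \forall x \near F, normc (f x - l) < e.
Proof.
move=> FF; split=> [fl e e0|H A].
  have h : nbhs l [set w | normc (w - l) < e] by apply/nbhs_normc; exists e.
  exact: (fl _ h).
move/(nbhs_normc l A) => [e e0 eA].
apply: filterS (H e e0) => x; exact: eA.
Qed.

Lemma continuous_normcP (T : topologicalType) (f : T -> C) (x : T) :
  {for x, continuous f} <-> forall e : R, 0 < e -> \forall y \near x, normc (f y - f x) < e.
Proof. exact: (@cvg_normc T (nbhs x) f (f x) _). Qed.

Lemma continuous_distP (T : topologicalType) (f : T -> R) (x : T) :
  {for x, continuous f} <-> forall e : R, 0 < e -> \forall y \near x, `|f x - f y| < e.
Proof. by split=> [/cvgrPdist_lt|h]//; apply/cvgrPdist_lt. Qed.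

Lemma Re_continuous : continuous (fun z : C => complex.Re z).
Proof.
move=> z; apply/continuous_distP => e e0; apply/nbhs_normc; exists e => // w hw.
apply: le_lt_trans hw; rewrite distrC; have := Re_le_normc (w - z).
by case: (w) => ? ?; case: (z).
Qed.

Lemma normc_continuous : continuous (fun z : C => normc z).
Proof.
move=> z; apply/continuous_distP => e e0; apply/nbhs_normc; exists e => // w hw.
apply: le_lt_trans hw; rewrite ler_norml.
have := normc_triangle w z 0; have := normc_triangle z w 0; rewrite !subr0 normcB; lra.
Qed.

Lemma real_complex_continuous : continuous (fun x : R => (x%:C)%C : C).
Proof.
move=> x; apply/continuous_normcP => e e0; apply/nbhs_ballP; exists e => //= y.
by rewrite /ball /= distrC subr0 expr0n /= addr0 sqrtr_sqr.
Qed.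

Lemma continuous_ReIm (T : topologicalType) (f : T -> C) :
  continuous (fun x => complex.Re (f x)) -> continuous (fun x => complex.Im (f x)) ->
  continuous f.
Proof.
move=> cr ci x; apply/continuous_normcP => e e0.
have /continuous_distP/(_ (e/2)) h1 := cr x; have /continuous_distP/(_ (e/2)) h2 := ci x.
have e2 : 0 < e / 2 by rewrite divr_gt0.
near=> y.
have k1 : `|complex.Re (f x) - complex.Re (f y)| < e / 2 by near: y; exact: h1.
have k2 : `|complex.Im (f x) - complex.Im (f y)| < e / 2 by near: y; exact: h2.
apply: le_lt_trans (normc_le_ReIm _) _.
move: k1 k2; case: (f x) => ? ?; case: (f y) => ? ? /=; rewrite distrC => k1; rewrite distrC => k2; lra.
Unshelve. all: by end_near. Qed.

(** Caratheodory's form of differentiability. Each branch of the map satisfies such a factorization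
    algebraically, so its derivative is read off without any limit of difference quotients. *)
Lemma derive_from_quotient (f q : C -> C) z :
  (\forall w \near z, f w - f z = q w * (w - z)) -> {for z, continuous q} ->
  derivable f z 1 /\ derive1 f z = q z.
Proof.
move=> hf cq.
have cv : (fun h : C => h^-1 *: (f (h + z) - f z)) @ 0^' --> q z.
  apply/cvg_normc => e e0.
  move/continuous_normcP: cq => /(_ e e0) cq.
  case/nbhs_normc: hf => e1 e10 h1; case/nbhs_normc: cq => e2 e20 h2.
  have : nbhs (0:C) [set h : C | h != 0 -> normc (h^-1 *: (f (h + z) - f z) - q z) < e].
    apply/nbhs_normc; exists (Num.min e1 e2); first by rewrite lt_min e10.
    move=> h; rewrite subr0 lt_min => /andP[a1 a2] /= hn0.
    rewrite h1 ?addrK// /GRing.scale /= mulrC mulfK//; apply: h2; by rewrite addrK.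
  by [].
have E : forall h : C, h *: (1 : C) = h by move=> h; rewrite /GRing.scale /= mulr1.
split; last by rewrite /derive1; apply/cvg_lim.
rewrite /derivable; under eq_fun do rewrite E.
by apply/cvg_ex; exists (q z).
Qed.

Lemma cvgC_D (T : Type) (F : set_system T) (FF : Filter F) (f g : T -> C) (a b : C) :
  f @ F --> a -> g @ F --> b -> (fun x => f x + g x) @ F --> a + b.
Proof. exact: cvgD. Qed.
Lemma cvgC_M (T : Type) (F : set_system T) (FF : Filter F) (f g : T -> C) (a b : C) :
  f @ F --> a -> g @ F --> b -> (fun x => f x * g x) @ F --> a * b.
Proof. exact: cvgM. Qed.
Lemma cvgC_N (T : Type) (F : set_system T) (FF : Filter F) (f : T -> C) (a : C) :
  f @ F --> a -> (fun x => - f x) @ F --> - a.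
Proof. exact: cvgN. Qed.
Lemma cvgC_V (T : Type) (F : set_system T) (FF : Filter F) (f : T -> C) (a : C) :
  a != 0 -> f @ F --> a -> (fun x => (f x)^-1) @ F --> a^-1.
Proof. exact: cvgV. Qed.
Lemma cvgC_R (T : Type) (F : set_system T) (FF : Filter F) (f : T -> R) (a : R) :
  f @ F --> a -> (fun x => ((f x)%:C)%C : C) @ F --> ((a%:C)%C : C).
Proof. move=> h.
by apply: (@continuous_cvg T R C F FF f (fun t : R => (t%:C)%C : C) a) => //; exact: real_complex_continuous.
Qed.

Lemma cvgC_comp (T : Type) (F : set_system T) (FF : Filter F) (f : T -> C) (h : C -> C) (a : C) :
  {for a, continuous h} -> f @ F --> a -> (fun x => h (f x)) @ F --> h a.
Proof. by move=> ch fa A hA; exact: (fa (h @^-1` A) (ch A hA)). Qed.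

End PlaneBasics.

(** * Components of a disjoint union of connected open sets *)

Section Components.
Variable T : topologicalType.

(** Each [P i] is open in the union, and also closed there because its complement is the union of
    the other members; a component is connected and so cannot leave [P i]. *)
Lemma component_bigcup (I : Type) (P : I -> set T) :
  (forall i, open (P i)) -> (forall i, connected (P i)) ->
  (forall i j x, P i x -> P j x -> i = j) ->
  forall i x, P i x -> connected_component (\bigcup_i P i) x = P i.
Proof.
move=> oP cP dP i x Pix; apply/seteqP; split; last first.
  apply: connected_component_max => //; exact: bigcup_sup.
set A := connected_component _ x.
have Ax : A x by apply: connected_component_refl; exists i.
have AU : A `<=` \bigcup_i P i by exact: connected_component_sub.
suff <- : A `&` P i = A by move=> y [].
apply: (@component_connected _ (\bigcup_i P i) x).
- by exists x.
- by exists (P i).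
- exists (~` \bigcup_(j in [set j | j <> i]) P j).
    by apply/open_closedC/bigcup_open.
  apply/seteqP; split=> y [Ay Py]; split=> //.
    by move=> [j ji Pjy]; apply: ji; exact: dP Pjy Py.
  have [j _ Pjy] := AU _ Ay.
  by have [<-//|ji] := pselect (j = i); case: Py; exists j.
Qed.

End Components.

(** * Disks, segments and Jordan disks *)

Section PlaneTop.
Variable R : realType.
Local Notation C := (R[i]^o).
Implicit Types (z w a b : C) (r s e : R).

Lemma closed_cdisk a r : closed (cdisk a r).
Proof.
rewrite -[cdisk a r]/((fun z : C => normc (z - a)) @^-1` [set x | x <= r]).
apply: closed_comp; last exact: closed_le.
move=> z _; apply: (@continuous_comp _ _ _ (fun z : C => z - a) (fun z : C => normc z)).
  by apply: (@cvgB _ _ _ (nbhs z)); [exact: cvg_id|exact: cvg_cst].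
exact: normc_continuous.
Qed.

Lemma hausdorff_plane : hausdorff_space C.
Proof. exact: norm_hausdorff. Qed.

(** Heine-Borel, transported from the square [[-r, r] x [-r, r]] by the continuous map that sends
    (x, y) to x + iy. *)
Lemma bounded_closed_compact_plane (A : set C) r :
  closed A -> (forall z, A z -> normc z <= r) -> compact A.
Proof.
move=> cA bA.
pose f (p : R * R) : C := (p.1 +i* p.2)%C.
have cf : continuous f.
  apply: (@continuous_ReIm R) => p; first exact: cvg_fst.
  exact: cvg_snd.
have K : compact (f @` (`[-r, r] `*` `[-r, r])).
  apply: continuous_compact; first exact: continuous_subspaceT.
  by apply: compact_setX; exact: segment_compact.
apply: (subclosed_compact cA K) => z /bA zr.
exists (complex.Re z, complex.Im z); last by case: (z).
have := Re_le_normc z; have := Im_le_normc z.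
by split=> /=; rewrite in_itv /= -ler_norml; apply: le_trans zr.
Qed.

Lemma disk_sub_cdisk a r : disk a r `<=` cdisk a r.
Proof. by move=> z; rewrite /disk /cdisk /= => /ltW. Qed.

Lemma compact_cdisk a r : compact (cdisk a r).
Proof.
apply: (@bounded_closed_compact_plane _ (r + normc a)); first exact: closed_cdisk.
move=> z; rewrite /cdisk /= => h; have := le_normcD (z - a) a; rewrite subrK; lra.
Qed.

Lemma disk_center a r : 0 < r -> disk a r a.
Proof. by move=> r0; rewrite /disk /= subrr normc0. Qed.

Lemma closure_disk a r : 0 < r -> closure (disk a r) = cdisk a r.
Proof.
move=> r0; apply/seteqP; split.
  rewrite [cdisk a r]((closure_id _).1 (@closed_cdisk a r)).
  exact/closure_subset/disk_sub_cdisk.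
move=> z zr B /nbhs_normc[e e0 eB].
(* Moving [z] towards the centre by the fraction [t] enters the open disk, and displaces it by at
   most [t * r < e]. *)
pose t := Num.min 1 (e / (2 * r)).
have t0 : 0 < t by rewrite lt_min ltr01 divr_gt0// mulr_gt0.
have t1 : t <= 1 by rewrite ge_min lexx.
have te : t * r < e.
  have : t * r <= e / (2 * r) * r by rewrite ler_pM2r// ge_min lexx orbT.
  rewrite invfM mulrA mulfVK ?gt_eqF//; lra.
pose w := z - (t%:C)%C * (z - a).
have E : normc ((t%:C)%C * (z - a)) = t * normc (z - a).
  by rewrite normcM normc_real ger0_norm // ltW.
exists w; split; last first.
  apply: eB; rewrite /w addrAC subrr add0r normcN E.
  by apply: le_lt_trans te; rewrite ler_pM2l.
rewrite /disk /=.
have -> : w - a = ((1 - t)%:C)%C * (z - a).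
  by rewrite /w rmorphB rmorph1 mulrBl mul1r addrAC.
rewrite normcM normc_real ger0_norm ?subr_ge0//.
have : (1 - t) * normc (z - a) <= (1 - t) * r by rewrite ler_wpM2l// subr_ge0.
have : 0 < t * r by rewrite mulr_gt0.
lra.
Qed.

Definition seg z w (t : R) : C := ((1 - t)%:C)%C * z + (t%:C)%C * w.

Lemma seg0 z w : seg z w 0 = z.
Proof. by rewrite /seg subr0 rmorph1 rmorph0 mul1r mul0r addr0. Qed.

Lemma seg1 z w : seg z w 1 = w.
Proof. by rewrite /seg subrr rmorph1 rmorph0 mul1r mul0r add0r. Qed.

Lemma segxx z t : seg z z t = z.
Proof. by rewrite /seg -mulrDl -rmorphD subrK rmorph1 mul1r. Qed.

Lemma cvg_seg (T : Type) (F : set_system T) (f g : T -> C) (h : T -> R) z w t : Filter F ->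
  f @ F --> z -> g @ F --> w -> h @ F --> t ->
  (fun x => seg (f x) (g x) (h x)) @ F --> seg z w t.
Proof.
move=> FF fz gw ht; rewrite /seg.
apply: cvgC_D; first (apply: cvgC_M; last exact: fz); last (apply: cvgC_M; last exact: gw).
  by apply: cvgC_R; apply: cvgB; [exact: cvg_cst|exact: ht].
by apply: cvgC_R; exact: ht.
Qed.

Lemma connected_seg z w : connected (seg z w @` `[0, 1]).
Proof.
apply: connected_continuous_connected; first exact: segment_connected.
apply: continuous_subspaceT => t.
by apply: (@cvg_seg _ (nbhs t)); [exact: cvg_cst|exact: cvg_cst|exact: cvg_id].
Qed.

Lemma component_seg (A : set C) z w :
  (forall t, 0 <= t <= 1 -> A (seg z w t)) -> connected_component A z w.
Proof.
move=> h; apply: (@connected_component_max _ A (seg z w @` `[0, 1]) z) => //.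
- by exists 0; rewrite ?seg0//= in_itv /= lexx ler01.
- by move=> _ [t + <-] => /=; rewrite in_itv; exact: h.
- exact: connected_seg.
- by exists 1; rewrite ?seg1//= in_itv /= lexx ler01.
Qed.

Lemma connected_from_component (A : set C) z :
  (forall w, A w -> connected_component A z w) -> connected A.
Proof.
move=> h; suff <- : connected_component A z = A by exact: component_connected.
by apply/seteqP; split=> //; exact: connected_component_sub.
Qed.

Lemma disk_seg a r z w t : disk a r z -> disk a r w -> 0 <= t <= 1 -> disk a r (seg z w t).
Proof.
rewrite /disk /= => zr wr /andP[t0 t1].
have -> : seg z w t - a = ((1 - t)%:C)%C * (z - a) + (t%:C)%C * (w - a).
  rewrite /seg !mulrBr.
  have : a = ((1 - t)%:C)%C * a + (t%:C)%C * a by rewrite -[LHS](segxx a t).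
  move=> {1}->; rewrite opprD; ring.
apply: le_lt_trans (le_normcD _ _) _; rewrite !normcM !normc_real !ger0_norm ?subr_ge0//.
have [->|tn0] := eqVneq t 0; first by rewrite mul0r addr0 subr0 mul1r.
have : t * normc (w - a) < t * r by rewrite ltr_pM2l// lt_neqAle eq_sym tn0.
have : (1 - t) * normc (z - a) <= (1 - t) * r by rewrite ler_wpM2l ?subr_ge0// ltW.
lra.
Qed.

Lemma connected_disk a r : connected (disk a r).
Proof.
have [r0|r0] := ltP 0 r; last first.
  suff -> : disk a r = set0 by exact: connected0.
  by rewrite -subset0 => z; rewrite /disk /=; have := normc_ge0 (z - a); lra.
apply: (@connected_from_component _ a) => w wr; apply: component_seg => t ht.
by apply: disk_seg => //; exact: disk_center.
Qed.

Lemma open_component (A : set C) z : open A -> open (connected_component A z).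
Proof.
move=> oA; rewrite openE => w zw.
have Aw : A w by apply: connected_component_sub zw.
move: oA; rewrite openE => /(_ _ Aw)/nbhs_normc[e e0 eA].
apply/nbhs_normc; exists e => // v vw.
rewrite (same_connected_component zw).
by apply: (@connected_component_max _ A (disk w e) w) => //; [exact: disk_center|exact: connected_disk].
Qed.

(* [Num.sqrt] vanishes on negative numbers, so that only one of the two square
   roots is nonzero at a time. *)
Definition circle_path (t : R) : C :=
  Complex (`|4 * t - 2| - 1)
          (Num.sqrt (1 - (1 - 4 * t) ^+ 2) - Num.sqrt (1 - (4 * t - 3) ^+ 2)).

Lemma circle_path_left t : 0 <= t <= 1 / 2 ->
  circle_path t = Complex (1 - 4 * t) (Num.sqrt (1 - (1 - 4 * t) ^+ 2)).
Proof.
move=> ht; rewrite /circle_path ler0_norm; last lra.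
rewrite (@ler0_sqrtr _ (1 - (4 * t - 3) ^+ 2)) ?subr0; last nra.
by congr Complex; lra.
Qed.

Lemma circle_path_right t : 1 / 2 <= t <= 1 ->
  circle_path t = Complex (4 * t - 3) (- Num.sqrt (1 - (4 * t - 3) ^+ 2)).
Proof.
move=> ht; rewrite /circle_path ger0_norm; last lra.
rewrite (@ler0_sqrtr _ (1 - (1 - 4 * t) ^+ 2)) ?sub0r; last nra.
by congr Complex; lra.
Qed.

Lemma circle_path_continuous : continuous circle_path.
Proof.
have c1 (a b : R) : continuous (fun t : R => a * t + b).
  move=> t; apply: cvgD; last exact: cvg_cst.
  by apply: cvgM; [exact: cvg_cst|exact: cvg_id].
have c2 (a b : R) : continuous (fun t : R => Num.sqrt (1 - (a * t + b) ^+ 2)).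
  move=> t; apply: (@continuous_comp _ _ _ (fun t : R => 1 - (a * t + b) ^+ 2) Num.sqrt); last exact: sqrt_continuous.
  apply: cvgB; first exact: cvg_cst.
  rewrite expr2; under eq_fun do rewrite expr2.
  by apply: cvgM; exact: c1.
apply: continuous_ReIm => /= t.
  apply: cvgB; last exact: cvg_cst.
  apply: cvg_norm; exact: (c1 4 (-2) t).
apply: cvgB.
  have E : (fun t : R => Num.sqrt (1 - (1 - 4 * t) ^+ 2)) =
           (fun t : R => Num.sqrt (1 - (- 4 * t + 1) ^+ 2)).
    by apply/funext => u; rewrite mulNr [- _ + 1]addrC.
  rewrite [X in X @ _ --> _]E; have /= := c2 (-4) 1 t.
  by rewrite /continuous_at -[X in _ --> X]/((fun t : R => Num.sqrt (1 - (- 4 * t + 1) ^+ 2)) t) -E.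
exact: (c2 4 (-3) t).
Qed.

Lemma circle_path_norm t : 0 <= t <= 1 -> normc (circle_path t) = 1.
Proof.
move=> ht; have [h|h] := lerP t (1/2).
  rewrite circle_path_left; last lra.
  by rewrite /= sqr_sqrtr ?subrKC ?sqrtr1//; nra.
rewrite circle_path_right; last lra.
by rewrite /= sqrrN sqr_sqrtr ?subrKC ?sqrtr1//; nra.
Qed.

Lemma circle_path_surj z : normc z = 1 -> exists2 t, 0 <= t <= 1 & circle_path t = z.
Proof.
move=> z1; have : complex.Re z ^+ 2 + complex.Im z ^+ 2 = 1 by rewrite -sqr_normcE z1 expr1n.
case: z {z1} => x y /= xy.
have [y0|y0] := lerP 0 y.
  exists ((1 - x) / 4); first nra.
  rewrite circle_path_left; last nra.
  have -> : 1 - 4 * ((1 - x) / 4) = x by field.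
  by rewrite -xy addrAC subrr add0r sqrtr_sqr ger0_norm.
exists ((x + 3) / 4); first nra.
rewrite circle_path_right; last nra.
have -> : 4 * ((x + 3) / 4) - 3 = x by field.
by rewrite -xy addrAC subrr add0r sqrtr_sqr ltr0_norm// opprK.
Qed.

Lemma circle_path_inj : {in `[0, 1[ &, injective circle_path}.
Proof.
have L t : 0 <= t <= 1/2 -> 0 <= complex.Im (circle_path t).
  by move=> ht; rewrite circle_path_left//= sqrtr_ge0.
have P t : 1/2 < t < 1 -> complex.Im (circle_path t) < 0.
  by move=> ht; rewrite circle_path_right/= ?oppr_lt0 ?sqrtr_gt0; nra.
move=> s t; rewrite !in_itv /= => hs ht E.
have [s2|s2] := lerP s (1/2); have [t2|t2] := lerP t (1/2).
- by move: E; (rewrite circle_path_left; last lra); (rewrite circle_path_left; last lra); case; lra.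
- have := L s; have := P t; rewrite E; lra.
- have := L t; have := P s; rewrite E; lra.
- by move: E; (rewrite circle_path_right; last lra); (rewrite circle_path_right; last lra); case; lra.
Qed.

Lemma circle_path_loop : circle_path 0 = circle_path 1.
Proof.
rewrite circle_path_left; last lra.
rewrite circle_path_right; last lra.
by rewrite mulr0 subr0 mulr1 expr1n subrr; congr Complex; [lra|rewrite [4 - 3](_ : _ = 1) ?expr1n ?subrr ?sqrtr0 ?oppr0//; lra].
Qed.

(** * Images of round disks under an injective continuous chart *)

Section Chart.
Variables (phi psi : C -> C) (a : C) (r : R).
Hypotheses (r0 : 0 < r) (cphi : continuous phi)
  (phiK : forall w, cdisk a r w -> psi (phi w) = w)
  (cpsi : forall w, disk a r w -> {for phi w, continuous psi})
  (ophi : open (phi @` disk a r)).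

(** The image of the compact closed disk is closed, and continuity of [phi] sends limit points of
    the open disk to limit points of its image. *)
Lemma closure_chart : closure (phi @` disk a r) = phi @` cdisk a r.
Proof.
apply/seteqP; split.
  have cl : closed (phi @` cdisk a r).
    apply: compact_closed; first exact: hausdorff_plane.
    by apply: continuous_compact; [exact: continuous_subspaceT|exact: compact_cdisk].
  rewrite [phi @` cdisk a r]((closure_id _).1 cl).
  exact/closure_subset/image_subset/disk_sub_cdisk.
move=> _ [w wr <-] B nB; move: wr; rewrite -closure_disk// => /(_ (phi @^-1` B)) [|v [vr Bv]].
  exact: cphi.
by exists (phi v); split=> //; exists v.
Qed.

Lemma connected_chart : connected (phi @` disk a r).
Proof.
by apply: connected_continuous_connected; [exact: connected_disk|exact: continuous_subspaceT].
Qed.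

(** A loop is pulled back by [psi], contracted to its base point along segments of the convex disk,
    and pushed forward by [phi]. *)
Lemma simply_connected_chart : simply_connected (phi @` disk a r).
Proof.
split; [by exists (phi a), a => //; exact: disk_center|exact: connected_chart|].
move=> g cg gA g01.
have gD t : t \in `[0, 1] -> disk a r (psi (g t)) /\ phi (psi (g t)) = g t.
  by move=> /gA[w wr <-]; rewrite phiK//; exact: disk_sub_cdisk.
have I0 : 0 \in `[0 : R, 1] by rewrite in_itv /= lexx ler01.
exists (fun p : R * R => phi (seg (psi (g p.2)) (psi (g 0)) p.1)); split => /=.
- apply/subspace_continuousP => -[s t] [/= hs ht].
  set F := within _ _.
  have FF : Filter F by exact: within_filter.
  have c1 : (fun p : R * R => p.1) @ F --> s.
    by apply: cvg_trans (@cvg_fst _ _ (nbhs s) (nbhs t) _); apply: cvg_app; exact: cvg_within.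
  have c2 : (fun p : R * R => psi (g p.2)) @ F --> psi (g t).
    have cp : {for g t, continuous psi}.
      by have [w wr <-] := gA t ht; exact: cpsi.
    apply: cvgC_comp; first exact: cp.
    move/subspace_continuousP : cg => /(_ t ht) cg.
    apply: (@cvg_comp _ _ _ (fun p : R * R => p.2) g F (within `[0, 1] (nbhs t))) cg.
    move=> A hA; exists (setT, [set y : R | y \in `[0, 1] -> A y]) => /=.
      by split; [exact: filterT|exact: hA].
    by move=> [x y] /= [_ Qy] [hx hy]; exact: Qy.
  apply: cvgC_comp; first exact: cphi.
  by apply: cvg_seg; [exact: c2|exact: cvg_cst|exact: c1].
- move=> s t hs ht; exists (seg (psi (g t)) (psi (g 0)) s) => //.
  apply: disk_seg; [exact: (gD t ht).1|exact: (gD 0 I0).1|by move: hs; rewrite in_itv].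
- by move=> t ht; rewrite seg0; exact: (gD t ht).2.
- by move=> t ht; rewrite seg1; exact: (gD 0 I0).2.
- by move=> s hs; rewrite -g01 segxx; split; exact: (gD 0 I0).2.
Qed.

(** Injectivity on the closed disk keeps the image of the boundary circle apart from the image of
    the open disk. *)
Lemma frontier_chart : frontier (phi @` disk a r) = phi @` [set w | normc (w - a) = r].
Proof.
rewrite /frontier closure_chart ((interior_id _).1 ophi); apply/seteqP; split.
  move=> _ [[w wr <-] nw]; exists w => //=; apply/eqP; rewrite eq_le wr/= leNgt.
  by apply/negP => h; apply: nw; exists w.
move=> _ [w /= wr <-]; split; first by exists w => //; rewrite /cdisk /= wr.
move=> [v vr E].
have : w = v.
  rewrite -(phiK (w := v)); last exact: disk_sub_cdisk.
  by rewrite E phiK// /cdisk /= wr.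
by move=> wv; move: vr; rewrite /disk /= -wv wr ltxx.
Qed.

Lemma jordan_disk_chart : jordan_disk (phi @` disk a r).
Proof.
split; first by split => //; exact: simply_connected_chart.
pose g t := a + (r%:C)%C * circle_path t.
have gr t : 0 <= t <= 1 -> normc (g t - a) = r.
  by move=> ht; rewrite /g addrAC subrr add0r normcM normc_real circle_path_norm// mulr1 gtr0_norm.
have rn0 : (r%:C)%C != 0 :> C by rewrite -normc_gt0 normc_real normr_gt0 gt_eqF.
rewrite frontier_chart; exists (phi \o g); split.
- apply: continuous_subspaceT => t; apply: continuous_comp; last exact: cphi.
  apply: cvgC_D; first exact: cvg_cst.
  by apply: cvgC_M; [exact: cvg_cst|exact: circle_path_continuous].
- move=> s t hs ht E; apply: circle_path_inj => //.
  have gs : cdisk a r (g s) by rewrite /cdisk /= gr//; move: hs; rewrite in_itv /=; lra.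
  have gt : cdisk a r (g t) by rewrite /cdisk /= gr//; move: ht; rewrite in_itv /=; lra.
  move: (congr1 psi E); rewrite /= !phiK// /g => /addrI; exact: mulfI.
- by rewrite /g /= circle_path_loop.
- apply/seteqP; split.
    move=> _ [w /= wr <-].
    have [|t ht E] := @circle_path_surj (((r^-1)%:C)%C * (w - a)).
      by rewrite normcM wr normc_real gtr0_norm ?invr_gt0// mulVf// gt_eqF.
    exists t => //=; rewrite /g E mulrA -rmorphM divff ?gt_eqF// rmorph1 mul1r.
    by rewrite addrC subrK.
  by move=> _ [t /= ht <-]; exists (g t) => //=; apply: gr; move: ht; rewrite in_itv.
Qed.

End Chart.

Lemma jordan_disk_disk a r : 0 < r -> jordan_disk (disk a r).
Proof.
move=> r0; rewrite -[disk a r]image_id.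
apply: (@jordan_disk_chart id id a r r0) => //; first by move=> w; exact: cvg_id.
  by move=> w _; exact: cvg_id.
by rewrite image_id; exact: open_disk.
Qed.

End PlaneTop.

(** * Squaring and the principal square root *)

Section SquareRoot.
Variable R : realType.
Local Notation C := (R[i]^o).
Implicit Types (z w a b c : C) (r s e : R).

Definition rt (z : C) : C := sqrtc z.

Lemma sqr_rt z : rt z ^+ 2 = z.
Proof. exact: sqr_sqrtc. Qed.

Lemma Re_rt_ge0 z : 0 <= complex.Re (rt z).
Proof. by case: z => x y; rewrite /rt /= sqrtr_ge0. Qed.

Lemma ReN z : complex.Re (- z) = - complex.Re z.
Proof. by case: z. Qed.

Lemma ReD z w : complex.Re (z + w) = complex.Re z + complex.Re w.
Proof. by case: z; case: w. Qed.

Lemma rt_or w : rt (w ^+ 2) = w \/ rt (w ^+ 2) = - w.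
Proof.
have : (rt (w ^+ 2) == w) || (rt (w ^+ 2) == - w) by rewrite -eqf_sqr sqr_rt.
by case/orP => /eqP; [left|right].
Qed.

Lemma rt_sqr w : 0 < complex.Re w -> rt (w ^+ 2) = w.
Proof.
move=> w0; case: (rt_or w) => // E.
by exfalso; move: (Re_rt_ge0 (w ^+ 2)); rewrite E ReN; lra.
Qed.

Lemma normc_sqr z : normc (z ^+ 2) = normc z ^+ 2.
Proof. by rewrite expr2 normcM expr2. Qed.

Lemma normc_rt z : normc (rt z) ^+ 2 = normc z.
Proof. by rewrite -normc_sqr sqr_rt. Qed.

(** In [w - z = (rt w - rt z) * (rt w + rt z)] the last factor has real part at least
    [complex.Re (rt z)], because [rt w] has nonnegative real part for every [w], across the branch
    cut too. *)
Lemma rt_continuous z : 0 < complex.Re (rt z) -> {for z, continuous rt}.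
Proof.
set d := complex.Re _ => d0; apply/continuous_normcP => e e0; apply/nbhs_normc.
exists (e * d); first by rewrite mulr_gt0.
move=> w hw.
have E : w - z = (rt w - rt z) * (rt w + rt z) by rewrite -subr_sqr !sqr_rt.
have : d <= normc (rt w + rt z).
  apply: le_trans (Re_le_normc _); rewrite ReD ger0_norm ?addr_ge0 ?Re_rt_ge0//.
  by rewrite lerDr Re_rt_ge0.
move: hw; rewrite E normcM => h1 h2.
rewrite -(ltr_pM2r d0); apply: le_lt_trans h1.
by rewrite ler_wpM2l// normc_ge0.
Qed.

Definition sqT (c : C) (w : C) : C := c + w ^+ 2.
Definition rtT (c : C) (z : C) : C := rt (z - c).

Lemma rtTK c w : 0 < complex.Re w -> rtT c (sqT c w) = w.
Proof. by move=> w0; rewrite /rtT /sqT addrAC subrr add0r rt_sqr. Qed.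

Lemma sqT_rtT c z : sqT c (rtT c z) = z.
Proof. by rewrite /sqT /rtT sqr_rt addrC subrK. Qed.

Lemma sqT_continuous c : continuous (sqT c).
Proof.
move=> z; apply: (@cvgC_D R C (nbhs z) _ (fun=> c) (fun w => w ^+ 2)); first exact: cvg_cst.
by apply: (@cvgC_M R C (nbhs z) _ id id); exact: cvg_id.
Qed.

Lemma addC_continuous c : continuous (fun z : C => z + c).
Proof. by move=> z; apply: (@cvgC_D R C (nbhs z) _ id (fun=> c)); [exact: cvg_id|exact: cvg_cst]. Qed.

Lemma rtT_continuous c z : 0 < complex.Re (rtT c z) -> {for z, continuous (rtT c)}.
Proof.
move=> h; apply: (@cvgC_comp R C (nbhs z) _ (fun z => z - c) rt); first exact: rt_continuous.
exact: addC_continuous.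
Qed.

(** Near a point of the image, the continuous right inverse [rtT c] takes values in [A]. *)
Lemma open_sqT c (A : set C) : open A -> (forall w, A w -> 0 < complex.Re w) ->
  open (sqT c @` A).
Proof.
rewrite !openE => oA A0 _ [w Aw <-].
have cw : {for sqT c w, continuous (rtT c)} by apply: rtT_continuous; rewrite rtTK A0.
have nA : nbhs (rtT c (sqT c w)) A by rewrite rtTK; [exact: oA|exact: A0].
apply: (@filterS _ (nbhs (sqT c w)) _ _ _ _ (cw _ nA)) => z Az; by exists (rtT c z); [exact: Az|exact: sqT_rtT].
Qed.

Section SquaredDisk.
Variables (c b : C) (r : R).
Hypotheses (r0 : 0 < r) (hb : forall w, cdisk b r w -> 0 < complex.Re w).

Let K w : cdisk b r w -> rtT c (sqT c w) = w.
Proof. by move=> /hb; exact: rtTK. Qed.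

Let cK w : disk b r w -> {for sqT c w, continuous (rtT c)}.
Proof. by move=> /disk_sub_cdisk h; apply: rtT_continuous; rewrite K//; exact: hb. Qed.

Lemma open_sqT_disk : open (sqT c @` disk b r).
Proof. by apply: open_sqT; [exact: open_disk|move=> w /disk_sub_cdisk/hb]. Qed.

Lemma closure_sqT_disk : closure (sqT c @` disk b r) = sqT c @` cdisk b r.
Proof. by apply: closure_chart; [exact: r0|exact: sqT_continuous]. Qed.

Lemma jordan_disk_sqT : jordan_disk (sqT c @` disk b r).
Proof.
apply: (@jordan_disk_chart R (sqT c) (rtT c) b r r0); [exact: sqT_continuous|exact: K|exact: cK|exact: open_sqT_disk].
Qed.

Lemma connected_sqT_disk : connected (sqT c @` disk b r).
Proof. by apply: connected_chart; exact: sqT_continuous. Qed.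

End SquaredDisk.

Lemma sqT_unit_disk c : sqT c @` disk 0 1 = disk c 1.
Proof.
apply/seteqP; split=> [_ [w w1 <-]|z z1].
  move: w1; rewrite /disk /sqT /= subr0 addrAC subrr add0r normc_sqr => w1.
  by rewrite expr_lt1 ?normc_ge0.
exists (rtT c z); last exact: sqT_rtT.
move: z1; rewrite /disk /= subr0 -normc_rt -/(rtT c z).
by rewrite expr_lt1// normc_ge0.
Qed.

Lemma is_derive_sqT c (f : C -> C) z :
  (\forall w \near z, f w = sqT c w) -> derivable f z 1 /\ derive1 f z = 2 * z.
Proof.
move=> hf; rewrite mulr_natl mulr2n.
apply: (@derive_from_quotient R f (fun w => w + z)); last exact: addC_continuous.
have hz : f z = sqT c z by exact: nbhs_singleton hf.
apply: filterS hf => w ->; rewrite hz /sqT opprD addrACA subrr add0r subr_sqr mulrC //.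
Qed.

Lemma is_derive_affine c a b (f : C -> C) z :
  (\forall w \near z, f w = c + a * (w - b)) -> derivable f z 1 /\ derive1 f z = a.
Proof.
move=> hf.
apply: (@derive_from_quotient R f (fun=> a)); last exact: cst_continuous.
have hz : f z = c + a * (z - b) by exact: nbhs_singleton hf.
apply: filterS hf => w ->; rewrite hz opprD addrACA subrr add0r -mulrBr.
by congr (_ * _); rewrite opprB addrA subrK.
Qed.

Lemma is_derive_rt c a b (f : C -> C) z : 0 < complex.Re (rtT c z) ->
  (\forall w \near z, f w = a * (rtT c w - b)) ->
  derivable f z 1 /\ derive1 f z = a / (2 * rtT c z).
Proof.
move=> h0 hf; rewrite mulr_natl mulr2n.
apply: (@derive_from_quotient R f (fun w => a / (rtT c w + rtT c z))); last first.
  apply: (@cvgC_M R C (nbhs z) _ (fun=> a)); first exact: cvg_cst.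
  apply: (@cvgC_V R C (nbhs z) _ (fun w => rtT c w + rtT c z)).
    apply/eqP => /(congr1 (@complex.Re R)); rewrite ReD/=; lra.
  by apply: (@cvgC_D R C (nbhs z) _ (rtT c) (fun=> rtT c z)); [exact: rtT_continuous|exact: cvg_cst].
have hz : f z = a * (rtT c z - b) by exact: nbhs_singleton hf.
apply: filterS hf => w ->; rewrite hz.
have n0 : rtT c w + rtT c z != 0.
  apply/eqP => /(congr1 (@complex.Re R)); rewrite ReD/=; have := Re_rt_ge0 (w - c).
  by rewrite -/(rtT c w); lra.
have -> : w - z = (rtT c w - rtT c z) * (rtT c w + rtT c z).
  by rewrite -subr_sqr /rtT !sqr_rt opprB addrA subrK.
by field.
Qed.

End SquareRoot.

(** * Area and disk content *)

Lemma scaled_pushforward d d' (T1 : measurableType d) (T2 : measurableType d') (R : realType)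
    (m : {measure set T1 -> \bar R}) (f : T1 -> T2) (r : R) :
  0 <= r -> measurable_fun setT f ->
  exists m' : {measure set T2 -> \bar R}, forall A, m' A = (r%:E * m (f @^-1` A))%E.
Proof.
move=> r0 mf.
by exists (mscale (NngNum r0)
  (measure_function_pushforward__canonical__measure_function_Measure m mf)).
Qed.

Section PlaneArea.
Variable R : realType.
Local Notation C := (R[i]^o).
Local Notation plane := (measurableTypeR R * measurableTypeR R)%type.
Local Notation leb1 := (@lebesgue_measure R).
Local Notation leb2 := (@lebesgue_measure R \x @lebesgue_measure R)%E.
Implicit Types (z w a b c : C) (r s e : R).

Lemma measurable_open_plane (A : set C) : open A ->
  measurable (@to_plane R @^-1` A : set plane).
Proof.
move=> oA.
pose box (i : rat * rat * nat) : set plane :=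
  `](ratr i.1.1 - i.2.+1%:R^-1), (ratr i.1.1 + i.2.+1%:R^-1)[ `*`
  `](ratr i.1.2 - i.2.+1%:R^-1), (ratr i.1.2 + i.2.+1%:R^-1)[.
pose F i := if pselect (box i `<=` @to_plane R @^-1` A) then box i else set0.
have -> : @to_plane R @^-1` A = \bigcup_i F i.
  apply/seteqP; split; last first.
    by move=> p [i _]; rewrite /F; case: pselect => [h|//]; exact: h.
  move=> [x y] /= Axy.
  move: oA; rewrite openE => /(_ _ Axy)/nbhs_normc[e e0 eA].
  (* A box of half-side [d] whose centre is within [d] of the point in each coordinate stays within
     [2 * d] in each coordinate, hence within [4 * d < e] in norm. *)
  have [n ne] : exists n : nat, n.+1%:R^-1 < e / 4.
    have e4 : 0 < e / 4 by rewrite divr_gt0.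
    by have [n] := ltr_add_invr e4; rewrite add0r => h; exists n.
  set d : R := n.+1%:R^-1 in ne.
  have d0 : 0 < d by rewrite invr_gt0.
  have [p hp] : exists p : rat, x - d < ratr p < x + d.
    have /rat_in_itvoo[p] : x - d < x + d :> R by lra.
    by rewrite in_itv /= => h; exists p.
  have [q hq] : exists q : rat, y - d < ratr q < y + d.
    have /rat_in_itvoo[q] : y - d < y + d :> R by lra.
    by rewrite in_itv /= => h; exists q.
  exists (p, q, n) => //; rewrite /F; case: pselect => [h|h]; last first.
    case: h => -[u v] [hu hv]; apply: eA.
    have hu' : x - 2 * d < u < x + 2 * d by move: hu; rewrite /= ?in_itv /= -/d; lra.
    have hv' : y - 2 * d < v < y + 2 * d by move: hv; rewrite /= ?in_itv /= -/d; lra.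
    apply: le_lt_trans (normc_le_ReIm _) _ => /=.
    have : `|u - x| <= 2 * d by rewrite ler_norml; lra.
    have : `|v - y| <= 2 * d by rewrite ler_norml; lra.
    lra.
  by split; rewrite /= ?in_itv /= -/d; lra.
apply: countable_bigcupT_measurable; first exact: countableP.
move=> i; rewrite /F; case: pselect => h; last exact: measurable0.
by apply: measurableX; exact: measurable_itv.
Qed.

Definition aff (b r x : R) : R := b + r * x.

Lemma measurable_aff (b r : R) : measurable_fun [set: measurableTypeR R] (aff b r : measurableTypeR R -> measurableTypeR R).
Proof. by apply: measurable_funD => //; exact: mulrl_measurable. Qed.

Lemma lebesgue_scale (b r : R) (A : set R) : 0 < r -> measurable A ->
  leb1 A = (r%:E * leb1 ((aff b r) @^-1` A))%E.
Proof.
move=> r0 mA.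
have [m mE] := scaled_pushforward leb1 (ltW r0) (measurable_aff b r).
rewrite -mE; apply: lebesgue_measure_unique => // X [[u v] /= uv <-].
rewrite mE.
pose J : interval R := `]((u - b) / r), ((v - b) / r)].
have E : (aff b r) @^-1` [set` `]u, v]] = [set` J].
  apply/seteqP; split=> x /=; rewrite /aff !in_itv /= ltr_pdivrMr// ler_pdivlMr// mulrC; lra.
transitivity (r%:E * (leb1 [set` J]))%E; last by congr (_ * leb1 _)%E; exact/esym/E.
rewrite (lebesgue_measure_itv J) (lebesgue_measure_itv `]u, v]) /= !lte_fin ltr_pM2r ?invr_gt0// ltrD2r.
case: ifP => _; last by rewrite mule0.
by rewrite -!EFinB -EFinM; congr EFin; field; rewrite gt_eqF.
Qed.

Lemma leb2_scale (b1 b2 r : R) (A : set plane) : 0 < r -> measurable A ->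
  leb2 A = ((r ^+ 2)%:E * leb2 ((fun p : plane => (aff b1 r p.1, aff b2 r p.2)) @^-1` A))%E.
Proof.
move=> r0 mA.
pose f (p : plane) : plane := (aff b1 r p.1, aff b2 r p.2).
have mf : measurable_fun [set: plane] f.
  apply: measurable_fun_pair.
    exact: (measurableT_comp (measurable_aff b1 r) measurable_fst).
  exact: (measurableT_comp (measurable_aff b2 r) measurable_snd).
have [m mE] := scaled_pushforward leb2 (sqr_ge0 r) mf.
rewrite -mE; apply: product_measure_unique; last exact: mA.
move=> X Y mX mY.
rewrite mE.
have mp (b : R) (Z : set R) : measurable (Z : set (measurableTypeR R)) ->
    measurable ((aff b r) @^-1` Z : set (measurableTypeR R)).
  move=> mZ; rewrite -[X in measurable X]setTI.
  exact: measurable_aff.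
transitivity ((r ^+ 2)%:E * (leb1 (aff b1 r @^-1` X) * leb1 (aff b2 r @^-1` Y)))%E.
  have P := @product_measure1E _ _ _ _ _ leb1 leb1 _ _ (mp b1 X mX) (mp b2 Y mY).
  exact: (congr1 (fun t => ((r ^+ 2)%:E * t)%E) P).
transitivity ((r%:E * leb1 (aff b1 r @^-1` X)) * (r%:E * leb1 (aff b2 r @^-1` Y)))%E.
  by rewrite muleACA -EFinM expr2.
by congr (_ * _)%E; apply/esym/lebesgue_scale.
Qed.

Lemma area_ge0 (A : set C) : (0 <= area A)%E.
Proof. exact: mu_ext_ge0. Qed.

Lemma area_le (A B : set C) : A `<=` B -> (area A <= area B)%E.
Proof. by move=> AB; apply: le_mu_ext => p; exact: AB. Qed.

Lemma area_measurable (A : set C) : measurable (@to_plane R @^-1` A : set plane) ->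
  area A = leb2 (@to_plane R @^-1` A).
Proof. by move=> mA; rewrite /area measurable_mu_extE. Qed.

Lemma area_open (A : set C) : open A -> area A = leb2 (@to_plane R @^-1` A).
Proof. by move=> /measurable_open_plane; exact: area_measurable. Qed.

Lemma area_bigcup (A : nat -> set C) :
  (area (\bigcup_k A k) <= \sum_(k <oo) area (A k))%E.
Proof.
rewrite /area preimage_bigcup.
exact: mu_ext_sigma_subadditive.
Qed.

Lemma areaU (A B : set C) : (area (A `|` B) <= area A + area B)%E.
Proof.
rewrite /area preimage_setU.
exact: (outer_measureU2 (mu_ext leb2)).
Qed.

Lemma area0 : area (@set0 C) = 0%E.
Proof. by rewrite /area preimage_set0 mu_ext0. Qed.

(** The number pi. The proof works with its positivity and finiteness, both obtained by comparison
    with rectangles. *)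
Definition unit_area : \bar R := area (disk (0 : C) 1).

Lemma area_disk b r : 0 < r -> area (disk b r) = ((r ^+ 2)%:E * unit_area)%E.
Proof.
move=> r0; rewrite /unit_area !area_open; [|exact: open_disk|exact: open_disk].
have mD : measurable (@to_plane R @^-1` disk b r : set plane).
  by apply: measurable_open_plane; exact: open_disk.
apply: etrans (leb2_scale (complex.Re b) (complex.Im b) r0 mD) _.
congr (_ * leb2 _)%E; apply/seteqP.
have E (p : plane) : to_plane (aff (complex.Re b) r p.1, aff (complex.Im b) r p.2) - b =
    ((r%:C)%C : C) * (to_plane p - 0).
  case: (b) p => b1 b2 [x y]; apply/eqP; rewrite eq_complex /= /aff; apply/andP; split; apply/eqP; ring.
have H (p : plane) : (normc (to_plane (aff (complex.Re b) r p.1, aff (complex.Im b) r p.2) - b) < r)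
    = (normc (to_plane p - 0) < 1).
  by rewrite E normcM normc_real gtr0_norm// -[X in _ < X]mulr1 ltr_pM2l.
by split=> p hp; rewrite /disk /preimage /mkset; move: hp; rewrite /disk /preimage /mkset ?H.
Qed.

Definition rect (x1 x2 y1 y2 : R) : set C :=
  [set z | x1 <= complex.Re z <= x2 /\ y1 <= complex.Im z <= y2].

Lemma area_rect (x1 x2 y1 y2 : R) : x1 <= x2 -> y1 <= y2 ->
  area (rect x1 x2 y1 y2) = ((x2 - x1) * (y2 - y1))%:E.
Proof.
move=> x12 y12.
pose J1 : interval R := `[x1, x2]; pose J2 : interval R := `[y1, y2].
have E : @to_plane R @^-1` rect x1 x2 y1 y2 = [set` J1] `*` [set` J2].
  by apply/seteqP; split=> -[x y] /=; rewrite /rect /= !in_itv.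
have m1 : measurable ([set` J1] : set (measurableTypeR R)) by exact: measurable_itv.
have m2 : measurable ([set` J2] : set (measurableTypeR R)) by exact: measurable_itv.
have mE : measurable (@to_plane R @^-1` rect x1 x2 y1 y2 : set plane).
  by rewrite E; exact: measurableX.
rewrite area_measurable//.
transitivity (leb2 ([set` J1] `*` [set` J2])); first by congr (leb2 _).
apply: etrans (@product_measure1E _ _ _ _ _ leb1 leb1 _ _ m1 m2) _.
have itvE (u v : R) : u <= v -> leb1 [set` Interval (BLeft u) (BRight v)] = (v - u)%:E.
  move=> uv; rewrite lebesgue_measure_itv /= lte_fin; case: ltgtP uv => // -> _.
  by rewrite subrr.
by rewrite EFinM; congr (_ * _)%E; exact: itvE.
Qed.

Lemma unit_area_lty : (unit_area < +oo)%E.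
Proof.
have : (unit_area <= area (rect (-1) 1 (-1) 1))%E.
  apply: area_le => z; rewrite /disk /rect /= subr0 -!ler_norml => h.
  by have := Re_le_normc z; have := Im_le_normc z; split; lra.
by move=> /le_lt_trans; apply; rewrite area_rect ?ltry//; lra.
Qed.

Lemma unit_area_gt0 : (0 < unit_area)%E.
Proof.
have : (area (rect 0 (1 / 2) 0 (1 / 4)) <= unit_area)%E.
  apply: area_le => z; rewrite /rect /disk /= subr0 => -[hx hy].
  have := normc_le_ReIm z; rewrite !ger0_norm; lra.
by move=> /(lt_le_trans _); apply; rewrite area_rect ?lte_fin; lra.
Qed.

Lemma unit_area_fin : unit_area \is a fin_num.
Proof. by rewrite ge0_fin_numE ?unit_area_lty// ltW// unit_area_gt0. Qed.

End PlaneArea.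

(** * An outer measure from countable covers by disks *)

Section DiskContent.
Variable R : realType.
Local Notation C := (R[i]^o).
Implicit Types (z w a b c : C) (r s e : R) (A B : set C).
Local Open Scope ereal_scope.

(* Every set is measurable here: only the generic construction of an outer
   measure from a set function is used. *)
Definition discrete_plane := g_sigma_algebraType [set: set C].

Lemma measurable_discrete (A : set discrete_plane) : measurable A.
Proof. exact: sub_sigma_algebra. Qed.

Definition disk_cover A : set (C * R) :=
  [set p | (0 <= p.2)%R /\ A `<=` disk p.1 p.2].

Definition gauge (A : set discrete_plane) : \bar R :=
  ereal_inf [set (p.2 ^+ 2)%:E | p in disk_cover A].

(* Infimum of the sums of squared radii of countable covers by disks.  It serves
   instead of [area] because its behavior under affine and Lipschitz maps needs
   no regularity of the measure. *)
Definition content (A : set C) : \bar R := mu_ext gauge A.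

Lemma gauge_ge0 A : 0 <= gauge A.
Proof. by apply: le_ereal_inf_tmp => _ [p _ <-]; rewrite lee_fin sqr_ge0. Qed.

Lemma gauge_disk b r : (0 <= r)%R -> gauge (disk b r) <= (r ^+ 2)%:E.
Proof. by move=> r0; apply: ereal_inf_lbound; exists (b, r) => //; split. Qed.

Lemma gauge0 : gauge set0 = 0.
Proof.
apply/eqP; rewrite eq_le gauge_ge0 andbT.
by apply: ereal_inf_lbound; exists (0%R, 0%R) => //=; [split|rewrite expr0n].
Qed.

Lemma content_ge0 A : 0 <= content A.
Proof. exact: (@mu_ext_ge0 _ _ R gauge gauge_ge0 A). Qed.

Lemma content_le A B : A `<=` B -> content A <= content B.
Proof. by move=> AB; apply: le_mu_ext. Qed.

Lemma content_bigcup (A : nat -> set C) :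
  content (\bigcup_k A k) <= \sum_(k <oo) content (A k).
Proof. exact: (@mu_ext_sigma_subadditive _ _ R gauge gauge_ge0 A). Qed.

Lemma content_le_series A (F : nat -> set C) : A `<=` \bigcup_k F k ->
  content A <= \sum_(k <oo) gauge (F k).
Proof.
move=> AF; apply: ereal_inf_lbound; exists F => //; split=> //.
by move=> k; exact: measurable_discrete.
Qed.

Lemma contentU A B : content (A `|` B) <= content A + content B.
Proof.
have -> : A `|` B = \bigcup_k (bigcup2 A B k) by rewrite bigcup2E.
apply: le_trans (content_bigcup _) _.
have -> : \sum_(k <oo) content (bigcup2 A B k) = content A + content B.
  rewrite nneseries_recl//; last by move=> *; exact: content_ge0.
  rewrite -(nneseries_addn (f := fun k => content (bigcup2 A B k)) 1); last by move=> *; exact: content_ge0.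
  rewrite nneseries_recl//; last by move=> *; exact: content_ge0.
  rewrite /= [X in _ + (_ + X)](_ : _ = 0) ?adde0//.
  apply: eseries0 => -[|k] //= _ _.
  by rewrite addn1 /= /content (@mu_ext0 _ _ R gauge gauge0 gauge_ge0).
by [].
Qed.

Lemma content0 : content set0 = 0.
Proof. exact: (@mu_ext0 _ _ R gauge gauge0 gauge_ge0). Qed.

Lemma content_null_bigcup (A : nat -> set C) : (forall k, content (A k) = 0) ->
  content (\bigcup_k A k) = 0.
Proof.
move=> A0; apply/eqP; rewrite eq_le content_ge0 andbT.
apply: le_trans (content_bigcup _) _.
by rewrite eseries0.
Qed.

Lemma content_null_sub A B : A `<=` B -> content B = 0 -> content A = 0.
Proof.
by move=> AB B0; apply/eqP; rewrite eq_le content_ge0 andbT -B0 content_le.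
Qed.

Lemma content_nullU A B : content A = 0 -> content B = 0 -> content (A `|` B) = 0.
Proof.
move=> A0 B0; apply/eqP; rewrite eq_le content_ge0 andbT.
by apply: le_trans (contentU _ _) _; rewrite A0 B0 adde0.
Qed.

Lemma content_disks A (b : nat -> C) (r : nat -> R) : (forall k, 0 <= r k)%R ->
  A `<=` \bigcup_k disk (b k) (r k) -> content A <= \sum_(k <oo) (r k ^+ 2)%:E.
Proof.
move=> r0 AD; apply: le_trans (content_le_series AD) _.
by apply: lee_nneseries => k _ *; [exact: gauge_ge0|exact: gauge_disk].
Qed.

Lemma content_disk b r : (0 <= r)%R -> content (disk b r) <= (r ^+ 2)%:E.
Proof.
move=> r0; apply: le_trans (content_le_series (F := bigcup2 (disk b r) set0) _) _.
  by rewrite bigcup2E setU0.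
rewrite nneseries_recl//; last by move=> *; exact: gauge_ge0.
rewrite [X in _ + X](_ : _ = 0) ?adde0//; first exact: gauge_disk.
by apply: eseries0 => -[//|[|k]] _ _ /=; rewrite gauge0.
Qed.

Lemma content_image (f : C -> C) A (K : R) : (0 < K)%R ->
  (forall b r, (0 <= r)%R -> exists b' r', [/\ (0 <= r')%R,
     f @` (A `&` disk b r) `<=` disk b' r' & (r' ^+ 2 <= K * r ^+ 2)%R]) ->
  content (f @` A) <= K%:E * content A.
Proof.
move=> K0 H; rewrite -lee_pdivrMl//.
apply: le_ereal_inf_tmp => _ [F [_ AF] <-].
rewrite lee_pdivrMl// -nneseriesZl; last by move=> *; exact: gauge_ge0.
apply: le_trans (content_le_series (F := fun k => f @` (A `&` F k)) _) _.
  move=> _ [x Ax <-]; have [k _ Fkx] := AF _ Ax.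
  by exists k => //; exists x.
apply: lee_nneseries => k _ *; first exact: gauge_ge0.
rewrite -lee_pdivrMl//; apply: le_ereal_inf_tmp => _ [[b r] /= [r0 FD] <-].
rewrite lee_pdivrMl// -EFinM.
have [b' [r' [r'0 fD rr]]] := H b r r0.
apply: le_trans (_ : (r' ^+ 2)%:E <= _); last by rewrite lee_fin.
apply: ereal_inf_lbound; exists (b', r') => //; split => //=.
by apply: subset_trans fD => _ [x [Ax Fx] <-]; exists x => //; split=> //; exact: FD.
Qed.

Lemma content_affine (f : C -> C) (r : R) A : (0 < r)%R ->
  (forall z w, normc (f z - f w) = r * normc (z - w))%R ->
  content (f @` A) <= (r ^+ 2)%:E * content A.
Proof.
move=> r0 H; apply: content_image => [|b s s0]; first by rewrite exprn_gt0.
exists (f b), (r * s)%R; split=> //.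
- by rewrite mulr_ge0// ltW.
- by move=> _ [x [_ xs] <-]; rewrite /disk /= H ltr_pM2l.
- by rewrite exprMn.
Qed.

Lemma content_null_lipschitz (f : C -> C) (L : R) A : (0 < L)%R ->
  (forall z w, A z -> A w -> normc (f z - f w) <= L * normc (z - w))%R ->
  content A = 0 -> content (f @` A) = 0.
Proof.
move=> L0 H A0; apply/eqP; rewrite eq_le content_ge0 andbT.
(* The centre of a covering disk may lie outside [A]. The image disk is therefore centred at [f x]
   for some [x] of [A] in the disk; other such points are within [2 * s] of [x], and 3 leaves
   room. *)
apply: le_trans (_ : ((3 * L) ^+ 2)%:E * content A <= _); last by rewrite A0 mule0.
apply: content_image => [|b s s0]; first by rewrite exprn_gt0// mulr_gt0.
have [[x [Ax xs]]|ne] := pselect (A `&` disk b s !=set0); last first.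
  exists 0%R, 0%R; split=> //; last by rewrite expr0n mulr_ge0// sqr_ge0.
  by move=> y [x hx _]; case: ne; exists x.
exists (f x), (3 * L * s)%R; split=> //.
- by rewrite !mulr_ge0// ltW.
- move=> _ [y [Ay ys] <-]; rewrite /disk /=.
  apply: le_lt_trans (H _ _ Ay Ax) _.
  rewrite -mulrA mulrCA ltr_pM2l//.
  have := normc_triangle b y x; rewrite (normcB b x).
  move: xs ys; rewrite /disk /=; have := normc_ge0 (x - b)%R; lra.
- by rewrite exprMn.
Qed.

(** Countable subadditivity of area, applied to an arbitrary disk cover: each disk has area
    [unit_area R] times its squared radius. *)
Lemma area_content A : area A <= unit_area R * content A.
Proof.
rewrite -(fineK (unit_area_fin R)).
have a0 : (0 < fine (unit_area R))%R by rewrite fine_gt0// unit_area_gt0 unit_area_lty.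
rewrite -lee_pdivrMl//; apply: le_ereal_inf_tmp => _ [F [_ AF] <-].
rewrite lee_pdivrMl// -nneseriesZl; last by move=> *; exact: gauge_ge0.
apply: le_trans (area_le AF) _; apply: le_trans (area_bigcup _) _.
apply: lee_nneseries => k _ *; first exact: area_ge0.
rewrite -lee_pdivrMl//; apply: le_ereal_inf_tmp => _ [[b r] /= [r0 FD] <-].
rewrite lee_pdivrMl// fineK ?unit_area_fin//.
apply: le_trans (area_le FD) _.
move: r0; rewrite le_eqVlt => /predU1P[<-|r0]; last by rewrite area_disk//= muleC.
suff -> : disk b 0 = set0; first by rewrite area0 mule_ge0 ?lee_fin ?sqr_ge0// ltW// unit_area_gt0.
by rewrite -subset0 => z; rewrite /disk /= ltNge normc_ge0.
Qed.

Lemma area_content_null A : content A = 0 -> area A = 0.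
Proof.
by move=> A0; apply/eqP; rewrite eq_le area_ge0 andbT -(mule0 (unit_area R)) -A0 area_content.
Qed.

End DiskContent.

(** * Disk packings *)

Lemma open_setD (T : topologicalType) (A B : set T) : open A -> closed B -> open (A `\` B).
Proof. by move=> oA cB; rewrite setDE; apply: openI => //; exact: closed_openC. Qed.

Section Packing.
Variable R : realType.
Local Notation C := (R[i]^o).
Local Notation plane := (measurableTypeR R * measurableTypeR R)%type.
Local Notation leb2 := (@lebesgue_measure R \x @lebesgue_measure R)%E.
Implicit Types (z w a b c : C) (r s e : R) (A B S O : set C).

(** Additivity holds on the open, hence Borel, disks; monotonicity of the outer measure then allows
    an arbitrary [A]. *)
Lemma disks_area_sum A (b : nat -> C) (r : nat -> R) :
  (forall k, 0 < r k) ->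
  (forall j k z, disk (b j) (r j) z -> disk (b k) (r k) z -> j = k) ->
  (forall k, disk (b k) (r k) `<=` A) ->
  (unit_area R * (\sum_(k <oo) (r k ^+ 2)%:E) <= area A)%E.
Proof.
move=> r0 dj DA.
apply: le_trans (_ : (area (\bigcup_k disk (b k) (r k)) <= _)%E); last first.
  by apply: area_le => z [k _]; exact: DA.
have mD k : measurable (@to_plane R @^-1` disk (b k) (r k) : set plane).
  by apply: measurable_open_plane; exact: open_disk.
rewrite area_open; last by apply: bigcup_open => k _; exact: open_disk.
rewrite preimage_bigcup measure_semi_bigcup//; last 2 first.
- by move=> j k _ _ [p [pj pk]]; exact: dj pj pk.
- exact: bigcupT_measurable.
rewrite -(fineK (unit_area_fin R)) -nneseriesZl; last by move=> *; rewrite lee_fin sqr_ge0.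
apply: lee_nneseries => k *.
  by rewrite mule_ge0 ?lee_fin ?sqr_ge0// fine_ge0// ltW// unit_area_gt0.
by rewrite fineK ?unit_area_fin// muleC -(area_disk (b k))// area_measurable.
Qed.

(* The factor 8 leaves room for an annulus of definite modulus around the disk. *)
Definition fits S (p : C * R) := 0 < p.2 /\ cdisk p.1 (8 * p.2) `<=` S.

Definition nearly_largest S (p : C * R) :=
  fits S p /\ forall q, fits S q -> q.2 <= 2 * p.2.

Lemma fits_exists S z : open S -> S z -> exists t, fits S (z, t).
Proof.
rewrite openE => oS Sz; have /nbhs_normc[e e0 eS] := oS _ Sz.
exists (e / 16); split=> /=; first by rewrite divr_gt0.
by move=> w; rewrite /cdisk /= => h; apply: eS; lra.
Qed.

Lemma fits_bound S M p : (forall z, S z -> normc z <= M) -> fits S p -> p.2 <= M.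
Proof.
move=> SM [p0 pS].
have t0 : 0 <= 8 * p.2 by rewrite mulr_ge0// ltW.
(* The centre and a boundary point of the enlarged disk are at distance [8 * p.2], and both have
   norm at most [M]. *)
have h1 := SM _ (pS (p.1 + ((8 * p.2)%:C)%C) _).
have h2 := SM _ (pS p.1 _).
have /h1 k1 : cdisk p.1 (8 * p.2) (p.1 + ((8 * p.2)%:C)%C).
  by rewrite /cdisk /= addrAC subrr add0r normc_real ger0_norm.
have /h2 k2 : cdisk p.1 (8 * p.2) p.1 by rewrite /cdisk /= subrr normc0.
have := le_normcD (p.1 + ((8 * p.2)%:C)%C) (- p.1).
rewrite addrAC subrr add0r normc_real ger0_norm// normcN; lra.
Qed.

(** A largest admissible radius need not be attained, so a radius above half of the supremum is
    taken; this is the origin of the factor 2 in [nearly_largest]. *)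
Lemma nearly_largest_exists S M : open S -> S !=set0 -> (forall z, S z -> normc z <= M) ->
  exists p, nearly_largest S p.
Proof.
move=> oS [x Sx] SM.
pose E : set R := [set r | exists b, fits S (b, r)].
have [t xt] := fits_exists oS Sx.
have hE : has_sup E.
  split; first by exists t, x.
  by exists M => r [b br]; exact: (fits_bound SM br).
have t0 : 0 < t by case: xt.
have sE : t <= sup E by apply: sup_upper_bound => //; exists x.
have [r [b br] rE] : exists2 r, E r & sup E - sup E / 2 < r.
  by apply: sup_adherent => //; lra.
exists (b, r); split => // -[b' r'] h /=.
have : r' <= sup E by apply: sup_upper_bound => //; exists b'.
lra.
Qed.

(** The last clause is the Vitali covering property in quantitative form: whatever the first [n]
    closed disks miss is covered by enlargements of the later ones. Together with the convergence of
    the squared radii it makes the residue null. *)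
Definition packing O (b : nat -> C) (r : nat -> R) :=
  [/\ forall k, 0 < r k,
      forall k, cdisk (b k) (8 * r k) `<=` O,
      forall j k z, cdisk (b j) (r j) z -> cdisk (b k) (r k) z -> j = k &
      forall n, O `\` \bigcup_(k in [set k | (k < n)%N]) cdisk (b k) (r k) `<=`
        \bigcup_k disk (b (k + n)%N) (18 * r (k + n)%N)].

(* Greedy choice: at each step a disk at least half as large as any other
   admissible one.  Every disk [D(x, 8 * t)] must eventually meet a chosen disk
   [D(b, r)], and for the first one [t <= 2 * r], hence [x] is in [D(b, 18 * r)]. *)
Lemma packing_exists O M : open O -> O !=set0 -> (forall z, O z -> normc z <= M) ->
  exists (b : nat -> C) (r : nat -> R), packing O b r.
Proof.
move=> oO O0 OM.
pose good S := [/\ open S, S !=set0 & forall z, S z -> normc z <= M].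
have [f fP] : {f : set C -> C * R & forall S, good S -> nearly_largest S (f S)}.
  apply: (@choice _ _ (fun S p => good S -> nearly_largest S p)) => S.
  have [[oS S0 SM]|nS] := pselect (good S).
    by have [p pS] := nearly_largest_exists oS S0 SM; exists p.
  by exists (0, 0) => /nS.
pose D S := cdisk (f S).1 (f S).2.
pose Q n := iter n (fun S => S `\` D S) O.
have QS n : Q n.+1 = Q n `\` D (Q n) by [].
have Qgood n : good (Q n).
  elim: n => [|n [oQ Q0 QM]]; first by [].
  have [[r0 rQ] _] := fP (Q n) (And3 oQ Q0 QM).
  split.
  - by rewrite QS; apply: open_setD => //; exact: closed_cdisk.
  (* A point at four radii from the centre lies in the eightfold disk but outside the removed one,
     so the construction never stops. *)
  - exists ((f (Q n)).1 + ((4 * (f (Q n)).2)%:C)%C).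
    have E : normc ((f (Q n)).1 + ((4 * (f (Q n)).2)%:C)%C - (f (Q n)).1) = 4 * (f (Q n)).2.
      by rewrite addrAC subrr add0r normc_real ger0_norm// mulr_ge0// ltW.
    split; first by apply: rQ; rewrite /cdisk /= E; lra.
    by rewrite /D /cdisk /= E; lra.
  - by move=> z [Qz _]; exact: QM.
have Qle m n : (m <= n)%N -> Q n `<=` Q m.
  move=> /subnK <-; elim: (n - m)%N => [//|k ih]; rewrite addSn QS.
  by apply: subset_trans ih => z [].
pose b n := (f (Q n)).1; pose r n := (f (Q n)).2.
have r0 n : 0 < r n by have [[]] := fP _ (Qgood n).
have rQ n : cdisk (b n) (8 * r n) `<=` Q n by have [[]] := fP _ (Qgood n).
have rbest n q : fits (Q n) q -> q.2 <= 2 * r n.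
  by have [_] := fP _ (Qgood n); exact.
have sub8 n : cdisk (b n) (r n) `<=` cdisk (b n) (8 * r n).
  by move=> z; rewrite /cdisk /=; have := r0 n; lra.
have disjlt j k z : (j < k)%N -> cdisk (b j) (r j) z -> ~ cdisk (b k) (r k) z.
  move=> jk zj /sub8/rQ/(Qle _ _ jk); rewrite QS => -[_]; exact.
have disj j k z : cdisk (b j) (r j) z -> cdisk (b k) (r k) z -> j = k.
  by move=> zj zk; case: (ltngtP j k) => // [/disjlt /(_ zj)|/disjlt /(_ zk)].
exists b, r; split=> //.
  by move=> k; apply: subset_trans (rQ k) _; exact: (Qle 0%N).
have QE n : O `\` \bigcup_(k in [set k | (k < n)%N]) cdisk (b k) (r k) `<=` Q n.
  elim: n => [z [//]|n ih z [Oz nz]]; rewrite QS; split.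
    by apply: ih; split=> // -[k /= kn kz]; apply: nz; exists k => //=; exact: ltnW.
  by move=> h; apply: nz; exists n => /=.
move=> n; apply: subset_trans (QE n) _ => x Qx.
have [oQ _ _] := Qgood n.
have [t xt] := fits_exists oQ Qx.
have t0 : 0 < t by case: xt.
(* If [(x, t)] fitted at every stage, all later radii would be at least [t / 2], and finitely many
   of these disjoint disks would already exceed the area of the disk of radius [M + 1]. *)
have [k kP] : exists k, ~ fits (Q (k + n)%N) (x, t).
  apply: contrapT => /forallNP H.
  have rt k : t / 2 <= r (k + n)%N.
    have /contrapT/rbest /= := H k; lra.
  have M0 : 0 <= M by case: O0 => y /OM; apply: le_trans (normc_ge0 y).
  have S1 : (unit_area R * (\sum_(k <oo) (r (k + n)%N ^+ 2)%:E) <= unit_area R * ((M + 1) ^+ 2)%:E)%E.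
    rewrite [leRHS]muleC -(area_disk 0); last by rewrite ltr_wpDl.
    apply: (@disks_area_sum _ (fun k => b (k + n)%N)) => // [i j z zi zj|i z zi].
      by apply: (@addIn n); apply: disj; apply: disk_sub_cdisk; [exact: zi|exact: zj].
    have /disk_sub_cdisk/sub8/rQ/(Qle 0%N _ (leq0n _))/OM := zi.
    by rewrite /disk /= subr0; lra.
  have {}S1 : (\sum_(k <oo) (r (k + n)%N ^+ 2)%:E <= ((M + 1) ^+ 2)%:E)%E.
    by move: S1; rewrite lee_pmul2l// ?unit_area_fin// unit_area_gt0.
  pose N := (Num.truncn ((M + 1) ^+ 2 / (t / 2) ^+ 2)).+1.
  have S2 : (\sum_(0 <= k < N) ((t / 2) ^+ 2)%:E <= ((M + 1) ^+ 2)%:E)%E.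
    apply: le_trans S1; apply: le_trans (nneseries_lim_ge N _); last by move=> *; rewrite lee_fin sqr_ge0.
    apply: lee_sum => k _; rewrite lee_fin ler_pXn2r ?nnegrE//.
      by rewrite divr_ge0// ltW.
    exact/ltW.
  move: S2; rewrite sumEFin lee_fin sumr_const_nat subn0 -mulr_natr.
  have t2 : 0 < (t / 2) ^+ 2 by rewrite exprn_gt0// divr_gt0.
  have : (M + 1) ^+ 2 / (t / 2) ^+ 2 < N%:R by exact: truncnS_gt.
  by rewrite ltr_pdivrMr// mulrC; lra.
have [m [mP mmin]] : exists m, ~ fits (Q (m + n)%N) (x, t) /\
    forall j, (j < m)%N -> fits (Q (j + n)%N) (x, t).
  have ex : exists k, `[< ~ fits (Q (k + n)%N) (x, t) >] by exists k; exact/asboolP.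
  exists (ex_minn ex); case: ex_minnP => m /asboolP mP mmin; split=> // j jm.
  apply: contrapT => /asboolP /mmin; by rewrite leqNgt jm.
case: m mP mmin => [//|m mP mmin].
have fm : fits (Q (m + n)%N) (x, t) by exact: mmin.
have tr := rbest _ _ fm; rewrite /= in tr.
have [y [yx yD]] : exists y, cdisk x (8 * t) y /\ cdisk (b (m + n)%N) (r (m + n)%N) y.
  apply: contrapT => /forallNP H; apply: mP; split=> // y yx.
  rewrite addSn QS; split; first by apply: fm.2.
  by move=> yD; apply: (H y).
exists m => //; rewrite /disk /=.
(* The distance is at most [8 * t + r <= 17 * r], where [r] is the chosen radius; 18 makes the
   inequality strict, as the open disk requires. *)
have := normc_triangle y x (b (m + n)%N); rewrite (normcB x y).
move: yx yD; rewrite /cdisk /=; have := r0 (m + n)%N; lra.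
Qed.

Section PackingContent.
Variables (O : set C) (M : R) (b : nat -> C) (r : nat -> R).
Hypotheses (OM : forall z, O z -> normc z <= M) (Pbr : packing O b r).

Lemma packing_disk_sub k : disk (b k) (r k) `<=` O.
Proof.
case: Pbr => r0 rO _ _ z zk; apply: (rO k); move: zk.
by rewrite /disk /cdisk /=; have := r0 k; lra.
Qed.

Lemma packing_area : (unit_area R * (\sum_(k <oo) (r k ^+ 2)%:E) <= area O)%E.
Proof.
case: Pbr => r0 _ dj _; apply: (@disks_area_sum O b r r0) => [i j z zi zj|].
  by apply: dj; apply: disk_sub_cdisk; [exact: zi|exact: zj].
exact: packing_disk_sub.
Qed.

Lemma packing_content_le : (content O <= (18 ^+ 2)%:E * \sum_(k <oo) (r k ^+ 2)%:E)%E.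
Proof.
case: Pbr => r0 _ _ cov; rewrite -nneseriesZl; last by move=> *; rewrite lee_fin sqr_ge0.
apply: le_trans (@content_disks _ _ (fun k => b (k + 0)%N) (fun k => 18 * r (k + 0)%N) _ _) _.
- by move=> k; rewrite mulr_ge0// ltW.
- apply: subset_trans (cov 0%N); rewrite (_ : [set k | (k < 0)%N] = set0).
    by rewrite bigcup_set0 setD0.
  by rewrite -subset0.
- apply: lee_nneseries => k *; first by rewrite lee_fin sqr_ge0.
  rewrite addn0 -EFinM lee_fin.
  by rewrite exprMn.
Qed.

Lemma packing_sum_fin : (\sum_(k <oo) (r k ^+ 2)%:E < +oo)%E.
Proof.
have M1 : 0 < `|M| + 1 by rewrite ltr_wpDl.
have h : (unit_area R * (\sum_(k <oo) (r k ^+ 2)%:E) <= unit_area R * ((`|M| + 1) ^+ 2)%:E)%E.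
  apply: le_trans packing_area _; rewrite muleC -(area_disk 0)//.
  apply: area_le => z /OM; rewrite /disk /= subr0; have := ler_norm M; lra.
move: h; rewrite lee_pmul2l ?unit_area_fin ?unit_area_gt0// => /le_lt_trans; apply.
exact: ltry.
Qed.

(** For every [n] the residue is covered by the enlarged disks of index at least [n], so its content
    is at most 18 ^ 2 times a tail of a convergent series. *)
Lemma packing_content_rest : content (O `\` \bigcup_k cdisk (b k) (r k)) = 0%E.
Proof.
case: Pbr => r0 _ _ cov.
have [K K0 KE] : exists2 K : R, 0 < K & forall x : R, (18 * x) ^+ 2 = K * x ^+ 2.
  by exists (18 ^+ 2) => [|x]; [rewrite exprn_gt0|rewrite exprMn].
have f0 k : (0 <= K%:E * (r k ^+ 2)%:E)%E by rewrite -EFinM lee_fin mulr_ge0 ?sqr_ge0// ltW.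
have T : (\sum_(N <= k <oo) (K%:E * (r k ^+ 2)%:E) @[N --> \oo] --> 0)%E.
  apply: nneseries_tail_cvg => //.
  rewrite nneseriesZl; last by move=> *; rewrite lee_fin sqr_ge0.
  have := packing_sum_fin; have : (0 <= \sum_(k <oo) (r k ^+ 2)%:E)%E.
    by apply: nneseries_ge0 => *; rewrite lee_fin sqr_ge0.
  by case: (\sum_(k <oo) _)%E => // x _ _; rewrite -EFinM ltry.
apply/eqP; rewrite eq_le content_ge0 andbT; apply: (cvge_to_ge T); apply: nearW => n.
apply: le_trans (content_le (B := O `\` \bigcup_(k in [set k | (k < n)%N]) cdisk (b k) (r k)) _) _.
  by move=> z [Oz nz]; split=> // -[k _ kz]; apply: nz; exists k.
apply: le_trans (@content_disks _ _ (fun k => b (k + n)%N) (fun k => 18 * r (k + n)%N) _ (cov n)) _.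
  by move=> k; rewrite mulr_ge0// ltW.
rewrite -(nneseries_addn (f := fun k => (K%:E * (r k ^+ 2)%:E)%E))//.
apply: lee_nneseries => k *; first by rewrite lee_fin sqr_ge0.
by rewrite -EFinM lee_fin KE.
Qed.

End PackingContent.

(** Converse of [area_content] up to a constant: the disks of a packing are disjoint, which bounds
    their squared radii by area, while their enlargements cover the open set. *)
Lemma content_open_le O M : open O -> (forall z, O z -> normc z <= M) ->
  (unit_area R * content O <= (18 ^+ 2)%:E * area O)%E.
Proof.
move=> oO OM; have [nO|nO] := pselect (O !=set0); last first.
  suff -> : O = set0 by rewrite content0 area0 !mule0.
  by rewrite -subset0 => z Oz; apply: nO; exists z.
have [b [r P]] := packing_exists oO nO OM.
apply: le_trans (_ : (unit_area R * ((18 ^+ 2)%:E * \sum_(k <oo) (r k ^+ 2)%:E) <= _)%E).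
  by rewrite lee_pmul2l ?unit_area_fin ?unit_area_gt0//; exact: packing_content_le P.
rewrite muleCA lee_pmul2l//; exact: packing_area P.
Qed.

Lemma content_null_small_open A M : (forall z, A z -> normc z <= M) ->
  (forall e, 0 < e -> exists O, [/\ open O, A `<=` O & (area O <= e%:E * unit_area R)%E]) ->
  content A = 0%E.
Proof.
move=> AM H; apply/eqP; rewrite eq_le content_ge0 andbT.
apply/lee_addgt0Pr => e e0; rewrite add0e.
have k0 : 0 < 18 ^+ 2 :> R by rewrite exprn_gt0.
have [ O [oO AO aO]] := H (e / 18 ^+ 2) (divr_gt0 e0 k0).
(* The comparison of content with area requires a bounded open set. *)
pose O' := O `&` disk 0 (`|M| + 1).
have oO' : open O' by apply: openI => //; exact: open_disk.
have h : (unit_area R * content O' <= (18 ^+ 2)%:E * area O')%E.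
  apply: (@content_open_le _ (`|M| + 1)) => // z [_]; rewrite /disk /= subr0; exact: ltW.
apply: le_trans (content_le (B := O') _) _.
  by move=> z Az; split; [exact: AO|have := AM _ Az; rewrite /disk /= subr0; have := ler_norm M; lra].
suff : (unit_area R * content O' <= unit_area R * e%:E)%E by rewrite lee_pmul2l ?unit_area_fin ?unit_area_gt0.
apply: le_trans h _; apply: le_trans (_ : ((18 ^+ 2)%:E * ((e / 18 ^+ 2)%:E * unit_area R) <= _)%E).
  by rewrite lee_pmul2l//; apply: le_trans (area_le _) aO => z [].
by rewrite muleA -EFinM mulrC divfK ?gt_eqF// muleC.
Qed.

Lemma content_circle b r : 0 < r -> content [set z | normc (z - b) = r] = 0%E.
Proof.
move=> r0; apply: (@content_null_small_open _ (r + normc b)) => [z /= zr|e e0].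
  by have := le_normcD (z - b) b; rewrite subrK zr.
(* The annulus of radii [r - d] and [r + d] has area [4 * r * d] in units of [unit_area R], at most
   [e / 2]; the other bound keeps the inner radius positive. *)
pose d := Num.min (r / 2) (e / (8 * r)).
have d0 : 0 < d by rewrite lt_min !divr_gt0// mulr_gt0.
have dr : d <= r / 2 by rewrite ge_min lexx.
have de : d * r <= e / 8.
  have : d <= e / (8 * r) by rewrite ge_min lexx orbT.
  by rewrite ler_pdivlMr ?mulr_gt0//; lra.
exists (disk b (r + d) `\` cdisk b (r - d)); split.
- by apply: open_setD; [exact: open_disk|exact: closed_cdisk].
- move=> z /= zr; rewrite /disk /cdisk /= zr; split; lra.
have rd0 : 0 < r - d by lra.
have cD : disk b (r - d) `<=` cdisk b (r - d) by exact: disk_sub_cdisk.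
have h : (area (disk b (r + d) `\` cdisk b (r - d)) + area (disk b (r - d)) <= area (disk b (r + d)))%E.
  have o1 : open (disk b (r + d) `\` cdisk b (r - d)).
    by apply: open_setD; [exact: open_disk|exact: closed_cdisk].
  have m1 := measurable_open_plane o1.
  have m2 := measurable_open_plane (@open_disk R b (r - d)).
  have m3 := measurable_open_plane (@open_disk R b (r + d)).
  rewrite !area_measurable// -measureU//; last first.
    by rewrite -subset0 => p [[_ np] /cD].
  apply: le_measure; rewrite ?inE//; first exact: measurableU.
  by move=> p [[]//|]; rewrite /disk /=; lra.
move: h; rewrite !area_disk; [|lra|lra].
rewrite -(fineK (unit_area_fin R)) -EFinM -leeBrDr// -EFinM => /le_trans; apply.
rewrite -EFinB lee_fin -mulrBl ler_wpM2r//; first by rewrite fine_ge0// ltW// unit_area_gt0.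
by nra.
Qed.

Lemma content_segment (M : R) : content [set z : C | complex.Re z = 0 /\ normc z <= M] = 0%E.
Proof.
apply: (@content_null_small_open _ M) => [z []//|e e0].
have a0 : 0 < fine (unit_area R) by rewrite fine_gt0// unit_area_gt0 unit_area_lty.
pose B := `|M| + 1.
have B0 : 0 < B by rewrite ltr_wpDl.
(* Chosen so that the rectangle of sides [2 * d] and [2 * B] has area exactly [e * unit_area R]. *)
pose d := e * fine (unit_area R) / (4 * B).
have d0 : 0 < d by rewrite divr_gt0 ?mulr_gt0.
exists ((fun z : C => complex.Re z) @^-1` [set x | x < d] `&` (fun z : C => complex.Re z) @^-1` [set x | - d < x]
  `&` disk 0 B); split.
- apply: openI; last exact: open_disk.
  by apply: openI; apply: open_comp => [z _|]; [exact: Re_continuous|exact: open_lt|exact: Re_continuous|exact: open_gt].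
- move=> z [z0 zM] /=; rewrite /disk /= subr0 z0; split; first by split; lra.
  by rewrite /B; have := ler_norm M; lra.
apply: le_trans (area_le (B := rect (- d) d (- B) B) _) _.
  move=> z [[/= z1 z2]]; rewrite /disk /rect /= subr0 => zB.
  by have := Im_le_normc z; rewrite ler_norml; split; lra.
rewrite area_rect; [|lra|lra].
rewrite -[X in (_ <= _ * X)%E](fineK (unit_area_fin R)) -EFinM lee_fin.
rewrite le_eqVlt; apply/orP; left; apply/eqP; rewrite /d; field; lra.
Qed.

End Packing.

(** * A lower bound for moduli *)

Section ArcLength.
Variable R : realType.
Local Notation C := (R[i]^o).
Local Notation leb1 := (@lebesgue_measure R).

(** Retraction of the line onto the unit interval. Composition with it turns a path continuous
    within the interval into one continuous everywhere. *)
Definition clamp (t : R) : R := Num.max 0 (Num.min t 1).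

Lemma clamp_itv t : 0 <= clamp t <= 1.
Proof. by rewrite /clamp le_max lexx /= ge_max ler01 /= ge_min lexx orbT. Qed.

Lemma clamp_id t : 0 <= t <= 1 -> clamp t = t.
Proof. by move=> /andP[t0 t1]; rewrite /clamp (min_idPl t1) (max_idPr t0). Qed.

Lemma clamp_continuous : continuous clamp.
Proof.
move=> t.
have h : {for t, continuous ((cst 0 : R -> R^o) \max ((id : R -> R^o) \min cst 1))}.
  by apply: continuous_max; [exact: cst_continuous|apply: continuous_min; [exact: cvg_id|exact: cst_continuous]].
exact: h.
Qed.

Lemma within_clamp_continuous (T : topologicalType) (g : R -> T) :
  {within `[0, 1], continuous g} -> continuous (g \o clamp).
Proof.
move=> /subspace_continuousP cg t B hB.
have ct : clamp t \in `[0 : R, 1] by rewrite in_itv /= clamp_itv.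
have h : nbhs (clamp t) [set x | x \in `[0, 1] -> B (g x)] := cg _ ct _ hB.
have H := @clamp_continuous t _ h.
apply: (@filterS _ (nbhs t) _ _ _ _ H) => x /=; apply.
by rewrite in_itv /= clamp_itv.
Qed.

(** [t2] is the first time at which [h] reaches [7 / 4 * s], and [t1] an earlier time of value
    [5 / 4 * s]. Both levels lie strictly between [s] and [2 * s]: this keeps the two times inside
    the open interval, where the arcs are differentiable, and the values below [2 * s]. *)
Lemma crossing_times (h : R -> R) (s : R) : continuous h -> 0 < s -> h 0 <= s -> 2 * s <= h 1 ->
  exists t1 t2, [/\ 0 < t1, t1 < t2, t2 < 1, `|h t2 - h t1| = s / 2 &
    forall t, t1 <= t <= t2 -> h t < 2 * s].
Proof.
move=> ch s0 h0 h1.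
pose E : set R := `[0, 1] `&` h @^-1` [set x | 7 / 4 * s <= x].
have cE : compact E.
  apply: (subclosed_compact _ (@segment_compact R 0 1)) => [|t []//].
  by apply: closedI; [exact: interval_closed|apply: preimage_closed => [t _|]; [exact: ch|exact: closed_ge]].
have E1 : E 1 by split => /=; [rewrite in_itv /= ler01 lexx|lra].
have [t2 /set_mem[/= t2I ht2] t2min] := @compact_EVT_min _ _ id E (ex_intro _ _ E1) cE
  (continuous_subspaceT (fun x => cvg_id)).
have min2 t : 0 <= t <= 1 -> 7 / 4 * s <= h t -> t2 <= t.
  by move=> t01 ht; apply: t2min; apply/mem_set; split => //=; rewrite in_itv.
move: t2I; rewrite in_itv /= => /andP[t20 t21].
have ch' : {within `[0, t2], continuous h} by exact: continuous_subspaceT.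
have m0 : Num.min (h 0) (h t2) = h 0 by apply/min_idPl; lra.
have m1 : Num.max (h 0) (h t2) = h t2 by apply/max_idPr; lra.
have [c cI hc] : exists2 c, c \in `[0, t2] & h c = 7 / 4 * s.
  by apply: IVT => //; rewrite m0 m1; lra.
have [t1 t1I ht1] : exists2 c, c \in `[0, t2] & h c = 5 / 4 * s.
  by apply: IVT => //; rewrite m0 m1; lra.
move: cI t1I; rewrite !in_itv /= => cI t1I.
have c2 : c = t2.
  by apply/eqP; rewrite eq_le min2 ?andbT; lra.
have t1n0 : t1 != 0 by apply/eqP => E0; move: ht1; rewrite E0; lra.
have t1n2 : t1 != t2 by apply/eqP => E0; move: ht1; rewrite E0 -c2 hc; lra.
have t2n1 : t2 != 1 by apply/eqP => E0; move: hc; rewrite c2 E0; lra.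
exists t1, t2; split.
- by rewrite lt_neqAle eq_sym t1n0; lra.
- by rewrite lt_neqAle t1n2; lra.
- by rewrite lt_neqAle t2n1.
- by rewrite -c2 hc ht1 ger0_norm; lra.
- move=> t ht; rewrite ltNge; apply/negP => h2.
  have : t = t2 by apply/eqP; rewrite eq_le min2 ?andbT; lra.
  by move=> E0; move: h2; rewrite E0 -c2 hc; lra.
Qed.

Lemma crossing_times_sym (h : R -> R) (s : R) : continuous h -> 0 < s ->
  (h 0 <= s /\ 2 * s <= h 1) \/ (h 1 <= s /\ 2 * s <= h 0) ->
  exists t1 t2, [/\ 0 < t1, t1 < t2, t2 < 1, `|h t2 - h t1| = s / 2 &
    forall t, t1 <= t <= t2 -> h t < 2 * s].
Proof.
move=> ch s0 [[h0 h1]|[h1 h0]]; first exact: crossing_times.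
have ch' : continuous (fun t : R => h (1 - t)).
  move=> t; apply: (@continuous_comp _ _ _ (fun t : R => 1 - t) h); last exact: ch.
  by apply: cvgB; [exact: cvg_cst|exact: cvg_id].
have [||t1 [t2 [t10 t12 t21 d H]]] := @crossing_times (fun t : R => h (1 - t)) s ch' s0.
- by rewrite subr0.
- by rewrite subrr.
exists (1 - t2), (1 - t1); split; [lra|lra|lra|by rewrite distrC|].
by move=> t ht; have := H (1 - t); rewrite subKr; apply; lra.
Qed.

(** The velocity is projected on the unit vector [(p, q)] of the chord. The projection integrates to
    the chord length by the fundamental theorem of calculus, and it is at most the speed by
    Cauchy-Schwarz. *)
Lemma arc_length_ge (x y : R -> R) (t1 t2 : R) : t1 < t2 ->
  (forall t, t1 <= t <= t2 -> derivable x t 1 /\ derivable y t 1) ->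
  {within `[t1, t2], continuous derive1 x} -> {within `[t1, t2], continuous derive1 y} ->
  ((Num.sqrt ((x t2 - x t1) ^+ 2 + (y t2 - y t1) ^+ 2))%:E <=
   \int[leb1]_(t in `[t1, t2]) (Num.sqrt (derive1 x t ^+ 2 + derive1 y t ^+ 2))%:E)%E.
Proof.
move=> t12 dxy cx cy; set X := x t2 - x t1; set Y := y t2 - y t1; set d := Num.sqrt _.
have sp0 t : 0 <= Num.sqrt (derive1 x t ^+ 2 + derive1 y t ^+ 2) by exact: sqrtr_ge0.
have [d0|dn0] := eqVneq d 0; first by rewrite d0; apply: integral_ge0 => t _; rewrite lee_fin.
have d0 : 0 < d by rewrite lt_neqAle eq_sym dn0 sqrtr_ge0.
have dE : d ^+ 2 = X ^+ 2 + Y ^+ 2 by rewrite sqr_sqrtr// addr_ge0 ?sqr_ge0.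
pose p := X / d; pose q := Y / d.
have pq : p ^+ 2 + q ^+ 2 = 1 by rewrite /p /q !expr_div_n -mulrDl -dE divff// expf_neq0.
pose f t := p * derive1 x t + q * derive1 y t.
pose F t := p * x t + q * y t.
have cf : {within `[t1, t2], continuous f}.
  by move=> t; apply: cvgD; apply: cvgM; [exact: cvg_cst|exact: cx|exact: cvg_cst|exact: cy].
have csq (u : R -> R) : {within `[t1, t2], continuous u} -> {within `[t1, t2], continuous (fun t => u t ^+ 2)}.
  move=> cu t; apply: (@continuous_comp _ _ _ (u : subspace _ -> R) (fun x : R => x ^+ 2)); first exact: cu.
  exact: exprn_continuous.
have cs : {within `[t1, t2], continuous (fun t => Num.sqrt (derive1 x t ^+ 2 + derive1 y t ^+ 2))}.
  move=> t; apply: (@continuous_comp _ _ _ (fun t : subspace `[t1, t2] => derive1 x t ^+ 2 + derive1 y t ^+ 2) Num.sqrt).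
    by apply: cvgD; [exact: (csq _ cx)|exact: (csq _ cy)].
  exact: sqrt_continuous.
have dF t : t1 <= t <= t2 -> is_derive t 1 F (f t).
  move=> /dxy[dx dy].
  have hx : is_derive t 1 x (derive1 x t) by rewrite derive1E; exact: derivableP.
  have hy : is_derive t 1 y (derive1 y t) by rewrite derive1E; exact: derivableP.
  rewrite /F /f.
  have := @is_deriveD _ _ _ (p *: x) (q *: y) t 1 _ _ (is_deriveZ _ hx) (is_deriveZ _ hy).
  by [].
have cF t : t1 <= t <= t2 -> {for t, continuous F}.
  move=> /dF[h _]; apply: differentiable_continuous; exact/derivable1_diffP.
have FTC : (\int[leb1]_(t in `[t1, t2]) (f t)%:E = (F t2)%:E - (F t1)%:E)%E.
  apply: continuous_FTC2 => //.
    split.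
    - by move=> t; rewrite in_itv /= => ht; have [] := dF t ltac:(lra).
    - by apply: cvg_at_right_filter; apply: cF; lra.
    - by apply: cvg_at_left_filter; apply: cF; lra.
  by move=> t; rewrite in_itv /= => ht; rewrite derive1E; apply: derive_val; exact: (dF t ltac:(lra)).
have -> : (d%:E = (F t2)%:E - (F t1)%:E)%E.
  rewrite -EFinB; congr EFin.
  have -> : F t2 - F t1 = p * X + q * Y by rewrite /F /X /Y; ring.
  by rewrite /p /q mulrAC [X in _ + X]mulrAC -mulrDl -!expr2 -dE expr2 mulfK.
rewrite -FTC; apply: le_integral.
- exact: measurable_itv.
- by apply: continuous_compact_integrable => //; exact: segment_compact.
- by apply: continuous_compact_integrable => //; exact: segment_compact.
move=> t _; rewrite lee_fin; apply: le_trans (ler_norm _) _.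
rewrite -(ler_pXn2r (n:=2)) ?nnegrE// sqr_sqrtr ?addr_ge0 ?sqr_ge0// real_normK ?num_real//.
rewrite /f; set u := derive1 x t; set v := derive1 y t.
have -> : u ^+ 2 + v ^+ 2 = (p * u + q * v) ^+ 2 + (p * v - q * u) ^+ 2.
  by rewrite -[LHS]mul1r -pq; ring.
by rewrite lerDl sqr_ge0.
Qed.

End ArcLength.

Section DiskComplement.
Variable R : realType.
Local Notation C := (R[i]^o).
Implicit Types (z w a : C) (r s p q : R).

(** The half-plane at distance [r] from [a] with unit normal [(p, q)] is convex and, by
    Cauchy-Schwarz, misses the open disk, so the segment between the two points stays in the
    complement. *)
Lemma component_half_plane a r p q z w : p ^+ 2 + q ^+ 2 = 1 ->
  r <= p * complex.Re (z - a) + q * complex.Im (z - a) ->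
  r <= p * complex.Re (w - a) + q * complex.Im (w - a) ->
  connected_component (~` disk a r) z w.
Proof.
move=> pq hz hw; apply: component_seg => t /andP[t0 t1].
rewrite /disk /= => h.
have : p * complex.Re (seg z w t - a) + q * complex.Im (seg z w t - a) <= normc (seg z w t - a).
  apply: le_trans (ler_norm _) _.
  rewrite -(ler_pXn2r (n:=2)) ?nnegrE ?normc_ge0// sqr_normcE real_normK ?num_real//.
  set x := complex.Re _; set y := complex.Im _.
  have -> : x ^+ 2 + y ^+ 2 = (p * x + q * y) ^+ 2 + (p * y - q * x) ^+ 2.
    by rewrite -[LHS]mul1r -pq; ring.
  by rewrite lerDl sqr_ge0.
have -> : p * complex.Re (seg z w t - a) + q * complex.Im (seg z w t - a) =
   (1 - t) * (p * complex.Re (z - a) + q * complex.Im (z - a)) +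
   t * (p * complex.Re (w - a) + q * complex.Im (w - a)).
  by rewrite /seg; case: z {hz h} => z1 z2; case: w {hw} => w1 w2; case: a => a1 a2 /=; ring.
have : (1 - t) * r <= (1 - t) * (p * complex.Re (z - a) + q * complex.Im (z - a)).
  by rewrite ler_wpM2l// subr_ge0.
have : t * r <= t * (p * complex.Re (w - a) + q * complex.Im (w - a)).
  by rewrite ler_wpM2l.
lra.
Qed.

(** Every outside point is joined to [a + r] through at most three half-planes tangent to the disk:
    the one whose normal points towards it, then, according to the quadrant of that normal,
    axis-parallel ones. *)
Lemma connected_disk_compl a r : 0 < r -> connected (~` disk a r).
Proof.
move=> r0; pose pt x y : C := a + Complex x y.
have ptE x y : pt x y - a = Complex x y by rewrite /pt addrAC subrr add0r.
apply: (@connected_from_component _ _ (pt r 0)) => z nz.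
apply: connected_component_sym.
have {}nz : r <= normc (z - a) by move/negP: nz; rewrite -leNgt.
pose n := normc (z - a).
have n0 : 0 < n by exact: lt_le_trans nz.
pose p := complex.Re (z - a) / n; pose q := complex.Im (z - a) / n.
have nE : n ^+ 2 = complex.Re (z - a) ^+ 2 + complex.Im (z - a) ^+ 2 by exact: sqr_normcE.
have pq : p ^+ 2 + q ^+ 2 = 1.
  by rewrite /p /q !expr_div_n -mulrDl -nE divff// expf_neq0// gt_eqF.
have hz : r <= p * complex.Re (z - a) + q * complex.Im (z - a).
  have -> : p * complex.Re (z - a) + q * complex.Im (z - a) = n ^+ 2 / n by rewrite nE /p /q; field; rewrite gt_eqF.
  by rewrite expr2 mulfK// gt_eqF.
have S x y u v p' q' : p' ^+ 2 + q' ^+ 2 = 1 -> r <= p' * x + q' * y -> r <= p' * u + q' * v ->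
    connected_component (~` disk a r) (pt x y) (pt u v).
  by move=> h1 h2 h3; apply: (component_half_plane h1); rewrite ptE.
have T x y : r <= p * x + q * y -> connected_component (~` disk a r) z (pt x y).
  by move=> h; apply: (component_half_plane pq) => //; rewrite ptE.
have E10 : (1 : R) ^+ 2 + 0 ^+ 2 = 1 by rewrite expr1n expr0n addr0.
have E01 : (0 : R) ^+ 2 + 1 ^+ 2 = 1 by rewrite expr1n expr0n add0r.
have E0N : (0 : R) ^+ 2 + (-1) ^+ 2 = 1 by rewrite sqrrN expr1n expr0n add0r.
have [p0|p0] := lerP 0 p.
  apply: (connected_component_trans (T (r * (p + 1)) (r * q) _)); first by nra.
  by apply: (S _ _ _ _ 1 0 E10); nra.
have [q0|q0] := lerP 0 q.
  apply: (connected_component_trans (T (r * p) (r * (q + 1)) _)); first by nra.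
  apply: (connected_component_trans (S _ _ r r 0 1 E01 _ _)); [nra|nra|].
  by apply: (S _ _ _ _ 1 0 E10); nra.
apply: (connected_component_trans (T (r * p) (r * (q - 1)) _)); first by nra.
apply: (connected_component_trans (S _ _ r (- r) 0 (-1) E0N _ _)); [nra|nra|].
by apply: (S _ _ _ _ 1 0 E10); nra.
Qed.

End DiskComplement.

(** * The length-area estimate *)

Section ModulusBound.
Variable R : realType.
Local Notation C := (R[i]^o).
Local Notation plane := (measurableTypeR R * measurableTypeR R)%type.
Local Notation leb1 := (@lebesgue_measure R).
Local Notation leb2 := (@lebesgue_measure R \x @lebesgue_measure R)%E.
Implicit Types (z w a b c : C) (r s e k : R).

Definition disk_metric a s k (z : C) : \bar R := (k * \1_(disk a (2 * s)) z)%:E.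

(** Between its two crossing times the arc stays in the disk where the density is [k], and its
    distance to [a] changes by [s / 2]. *)
Lemma metric_length_ge (A : set C) (g : R -> C) a s k : crosses A g -> 0 < s -> 0 <= k ->
  (normc (g 0 - a) <= s /\ 2 * s <= normc (g 1 - a)) \/
  (normc (g 1 - a) <= s /\ 2 * s <= normc (g 0 - a)) ->
  ((k * (s / 2))%:E <= metric_length (disk_metric a s k) g)%E.
Proof.
move=> [cg dg c1 c2 _] s0 k0 hg.
pose u t := normc (g t - a).
have cu : continuous (u \o clamp (R:=R)).
  have cg' := within_clamp_continuous cg.
  move=> t; apply: (@continuous_comp _ _ _ (fun t => g (clamp t) - a) (fun z : C => normc z)); last exact: normc_continuous.
  by apply: (@cvgC_D R R (nbhs t) _ (fun t => g (clamp t)) (fun=> - a)); [exact: cg'|exact: cst_continuous].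
have c00 : clamp (0 : R) = 0 by rewrite clamp_id// lexx ler01.
have c11 : clamp (1 : R) = 1 by rewrite clamp_id// lexx ler01.
have hg' : ((u \o clamp (R:=R)) 0 <= s /\ 2 * s <= (u \o clamp (R:=R)) 1) \/
   ((u \o clamp (R:=R)) 1 <= s /\ 2 * s <= (u \o clamp (R:=R)) 0).
  by rewrite /= c00 c11.
have [t1 [t2 [t10 t12 t21 d H]]] := crossing_times_sym cu s0 hg'.
have E t : t1 <= t <= t2 -> clamp t = t by move=> ht; apply: clamp_id; lra.
have {}H t : t1 <= t <= t2 -> u t < 2 * s by move=> ht; have := H t ht; rewrite /= E.
have {}d : `|u t2 - u t1| = s / 2 by move: d; rewrite /= !E//; lra.
have hd : s / 2 <= normc (g t2 - g t1).
  rewrite -d /u ler_norml.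
  have := normc_triangle (g t1) (g t2) a; have := normc_triangle (g t2) (g t1) a.
  by rewrite (normcB (g t1) (g t2)); lra.
pose x := re_path g; pose y := im_path g.
pose I12 : interval R := `[t1, t2]; pose I01 : interval R := `]0, 1[.
have sub : [set` I12] `<=` [set` I01].
  by move=> t /=; rewrite !in_itv /=; lra.
have AL : ((normc (g t2 - g t1))%:E <= \int[leb1]_(t in `[t1, t2]) (speed g t)%:E)%E.
  have -> : normc (g t2 - g t1) = Num.sqrt ((x t2 - x t1) ^+ 2 + (y t2 - y t1) ^+ 2).
    by rewrite /x /y /re_path /im_path; case: (g t2) => ? ?; case: (g t1).
  apply: arc_length_ge => //.
  - move=> t ht; have t01 : t \in `]0, 1[ by rewrite in_itv /=; lra.
    by case: (dg t t01).
  - exact: continuous_subspaceW sub c1.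
  - exact: continuous_subspaceW sub c2.
have msp : measurable_fun ([set` I01] : set (measurableTypeR R)) (speed g : _ -> measurableTypeR R).
  have mq (v : R -> R) : {within [set` I01], continuous v} ->
      measurable_fun ([set` I01] : set (measurableTypeR R)) (fun t => v t ^+ 2 : measurableTypeR R).
    move=> cv; apply: measurable_funX.
    by apply: subspace_continuous_measurable_fun => //; exact: measurable_itv.
  have mS : measurable_fun [set: measurableTypeR R] (Num.sqrt : measurableTypeR R -> measurableTypeR R).
    by apply: continuous_measurable_fun; exact: sqrt_continuous.
  by apply: (measurableT_comp mS); apply: measurable_funD; exact: mq.
have mu : measurable_fun ([set` I01] : set (measurableTypeR R)) (u : _ -> measurableTypeR R).
  have mT : measurable_fun [set: measurableTypeR R] (u \o clamp (R:=R) : _ -> measurableTypeR R).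
    exact: continuous_measurable_fun.
  apply: (@eq_measurable_fun _ _ _ _ _ (u \o clamp (R:=R))); last exact: measurable_funTS mT.
  by move=> t /set_mem /=; rewrite in_itv /= => ht; rewrite clamp_id; lra.
have mint : measurable_fun ([set` I01] : set (measurableTypeR R))
    (fun t => (disk_metric a s k (g t) * (speed g t)%:E)%E).
  rewrite /disk_metric; apply/measurable_EFinP => /=.
  apply: measurable_funM => //; apply: measurable_funM; first exact: measurable_cst.
  pose J : set (measurableTypeR R) := [set x | x < 2 * s].
  have mJ : measurable J.
    pose J0 : interval R := `]-oo, (2 * s)[.
    have -> : J = [set` J0] by apply/seteqP; split => v /=; rewrite in_itv.
    exact: measurable_itv.
  rewrite (_ : (fun t => \1_(disk a (2 * s)) (g t)) = (\1_J : _ -> R) \o u).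
    by apply: measurableT_comp => //; exact: measurable_indic.
  apply/funext => t; rewrite /= !indicE /J /disk /u.
  by congr (nat_of_bool _)%:R; apply/idP/idP => /set_mem h; apply/mem_set.
rewrite /metric_length.
have mJ : measurable ([set` I01] : set (measurableTypeR R)) by exact: measurable_itv.
have mI : measurable ([set` I12] : set (measurableTypeR R)) by exact: measurable_itv.
apply: le_trans (_ : (\int[leb1]_(t in `[t1, t2]) (disk_metric a s k (g t) * (speed g t)%:E) <= _)%E); last first.
  apply: (@ge0_subset_integral _ _ _ leb1 _ _ mI mJ _ mint _ sub).
  by move=> t _; rewrite /disk_metric -EFinM lee_fin !mulr_ge0// ?sqrtr_ge0// indicE.
have -> : (\int[leb1]_(t in `[t1, t2]) (disk_metric a s k (g t) * (speed g t)%:E) =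
  \int[leb1]_(t in `[t1, t2]) (k%:E * (speed g t)%:E))%E.
  apply: eq_integral => t /set_mem /=; rewrite in_itv /= => ht.
  rewrite /disk_metric indicE mem_set ?mulr1//; exact: H.
have msp' : measurable_fun ([set` I12] : set (measurableTypeR R)) (fun t => (speed g t)%:E).
  by apply/measurable_EFinP; exact: (measurable_funS mJ sub msp).
have sp0 t : (0 <= (speed g t)%:E)%E by rewrite lee_fin sqrtr_ge0.
have kE0 : (0 <= k%:E)%E by rewrite lee_fin.
rewrite (@ge0_integralZl _ _ _ leb1 _ mI _ msp' k%:E (fun t _ => sp0 t) kE0).
rewrite EFinM lee_wpmul2l ?lee_fin//.
by apply: le_trans AL; rewrite lee_fin.
Qed.

(** The test metric is constant on [disk a (2 * s)], with [k] chosen to give this disk area one. As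
    [closure Q] and the complement of [P] are connected, an arc joining different components of the
    complement of the annulus has one end in each, so its length is at least [k * (s / 2)], whose
    square is the stated bound. *)
Lemma modulus_ge (P Q : set C) a s : open P -> 0 < s ->
  closure Q `<=` cdisk a s -> disk a (2 * s) `<=` P ->
  connected (closure Q) -> connected (~` P) ->
  ((16 * fine (unit_area R))^-1%:E <= modulus (P `\` closure Q))%E.
Proof.
move=> oP s0 Qs sP cQ cP.
set A := P `\` closure Q.
pose al := fine (unit_area R).
have al0 : 0 < al by rewrite fine_gt0// unit_area_gt0 unit_area_lty.
pose k := (2 * s * Num.sqrt al)^-1.
have q0 : 0 < Num.sqrt al by rewrite sqrtr_gt0.
have k0 : 0 < k by rewrite invr_gt0 !mulr_gt0.
have oA : open A by apply: open_setD => //; exact: closed_closure.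
have mA := measurable_open_plane oA.
have mD := measurable_open_plane (@open_disk R a (2 * s)).
have rhoE p : disk_metric a s k (to_plane p) = (k * \1_(@to_plane R @^-1` disk a (2 * s) : set plane) p)%:E.
  by rewrite /disk_metric !indicE.
have L : ((k * (s / 2))%:E <= ereal_inf (metric_length (disk_metric a s k) @` crosses A))%E.
  apply: le_ereal_inf_tmp => _ [g gA <-]; apply: (metric_length_ge gA s0 (ltW k0)).
  case: gA => _ _ _ _ [nA0 nA1 ncomp].
  have sub1 : closure Q `<=` ~` A by move=> z Qz [].
  have sub2 : ~` P `<=` ~` A by move=> z nP [].
  have near0 z : closure Q z -> normc (z - a) <= s by exact: Qs.
  have far z : ~ P z -> 2 * s <= normc (z - a).
    by move=> nP; rewrite leNgt; apply/negP => h; apply/nP/sP.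
  have cases z : ~ A z -> closure Q z \/ ~ P z.
    move=> nA; have [?|nQ] := pselect (closure Q z); first by left.
    by right=> Pz; apply: nA.
  have [q0'|p0] := cases _ nA0; have [q1|p1] := cases _ nA1.
  - case: ncomp; apply: same_connected_component.
    exact: (connected_component_max q0' sub1 cQ).
  - by left; split; [exact: near0|exact: far].
  - by right; split; [exact: near0|exact: far].
  - case: ncomp; apply: same_connected_component.
    exact: (connected_component_max (B := ~` P) p0 sub2 cP).
apply: le_trans (_ : ((ereal_inf (metric_length (disk_metric a s k) @` crosses A)) ^+ 2 <= _)%E).
  apply: le_trans (_ : ((k * (s / 2))%:E ^+ 2 <= _)%E).
    rewrite -EFin_expe lee_fin le_eqVlt; apply/orP; left; apply/eqP.
    rewrite -/al -[in LHS](sqr_sqrtr (ltW al0)) /k; field.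
    by rewrite !gt_eqF.
  have h0 : (0 <= (k * (s / 2))%:E)%E by rewrite lee_fin mulr_ge0 ?divr_ge0// ltW.
  by rewrite lee_sqr//; exact: le_trans L.
apply: ereal_sup_ubound; exists (disk_metric a s k) => //; split.
- by move=> z; rewrite lee_fin mulr_ge0 ?indicE// ltW.
- rewrite (_ : _ \o _ = fun p => (k * \1_(@to_plane R @^-1` disk a (2 * s) : set plane) p)%:E); last first.
    by apply/funext => p /=; exact: rhoE.
  apply/measurable_EFinP; apply: measurable_funM; first exact: measurable_cst.
  exact: measurable_indic.
under eq_integral => p _.
  rewrite rhoE -EFin_expe exprMn.
  have -> : \1_(@to_plane R @^-1` disk a (2 * s) : set plane) p ^+ 2 = \1_(@to_plane R @^-1` disk a (2 * s) : set plane) p :> R.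
    by rewrite indicE; case: (_ \in _); rewrite ?expr1n ?expr0n.
  rewrite EFinM; over.
have mi : measurable_fun (@to_plane R @^-1` A : set plane)
    (fun p => (\1_(@to_plane R @^-1` disk a (2 * s) : set plane) p : R)%:E).
  by apply/measurable_EFinP; exact: measurable_indic.
have i0 (p : plane) : (@to_plane R @^-1` A) p ->
    (0 <= (\1_(@to_plane R @^-1` disk a (2 * s) : set plane) p : R)%:E)%E.
  by move=> _; rewrite lee_fin indicE.
have kE0 : (0 <= (k ^+ 2)%:E)%E by rewrite lee_fin sqr_ge0.
rewrite (ge0_integralZl leb2 mA mi i0 kE0) integral_indic//.
apply: le_trans (_ : ((k ^+ 2)%:E * area (disk a (2 * s)) <= _)%E).
  rewrite lee_wpmul2l ?lee_fin ?sqr_ge0// area_measurable//.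
  by apply: le_measure; rewrite ?inE//; exact: measurableI.
rewrite area_disk ?mulr_gt0// -(fineK (unit_area_fin R)) -!EFinM lee_fin -/al.
rewrite le_eqVlt; apply/orP; left; apply/eqP.
rewrite -[in LHS](sqr_sqrtr (ltW al0)) /k; field.
by rewrite !gt_eqF.
Qed.

End ModulusBound.

(** * The box mapping *)

Section BoxGeometry.
Variable R : realType.
Local Notation C := (R[i]^o).

Definition cT : C := ((3 : R)%:C)%C.

(** Squaring is injective where the real part is positive, so disks packed here become disjoint
    pieces; the opposite disks have the same squares and account for the other half of the
    annulus. *)
Definition half_annulus : set C :=
  [set w | [/\ 0 < complex.Re w, 1 / 2 < normc w & normc w < 1]].

Lemma open_half_annulus : open half_annulus.
Proof.
rewrite (_ : half_annulus = ((fun z : C => complex.Re z) @^-1` [set x | 0 < x] `&`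
  (fun z : C => normc z) @^-1` [set x | 1 / 2 < x]) `&` (fun z : C => normc z) @^-1` [set x | x < 1]).
  apply: openI; [apply: openI|]; apply: open_comp => [z _|].
  - exact: Re_continuous.
  - exact: open_gt.
  - exact: normc_continuous.
  - exact: open_gt.
  - exact: normc_continuous.
  - exact: open_lt.
by apply/seteqP; split=> z /=; [case=> *|case=> [[]]].
Qed.

Lemma half_annulus_nonempty : half_annulus !=set0.
Proof. by exists (((3 / 4 : R)%:C)%C); split; rewrite ?normc_real ?ger0_norm //=; lra. Qed.

Lemma half_annulus_bounded (z : C) : half_annulus z -> normc z <= 1.
Proof. by case=> _ _ /ltW. Qed.

Variables (b : nat -> C) (r : nat -> R).
Hypothesis Pbr : packing half_annulus b r.

(** Index 0 is the central piece, the set of all [3 + w ^ 2] with [normc w < 1 / 2], hence the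
    radius 1/4; index [k.+1] is the tile of the [k]-th packed disk. *)
Definition box_piece (j : nat) : set C :=
  if j is k.+1 then sqT cT @` disk (b k) (r k) else disk cT (1 / 4).

Definition base_disk : set C := disk 0 1.
Definition target_disk : set C := disk cT 1.

Local Notation V0 := base_disk.
Local Notation V1 := target_disk.
Local Notation piece := box_piece.

Definition boxU : set C := V0 `|` \bigcup_j piece j.
Definition boxV : set C := V0 `|` V1.

(** The index is obtained by choice, and is unique because the packed disks are disjoint. The value
    0 is a default outside the tiles. *)
Definition tile_map (z : C) : C :=
  if pselect (exists k, disk (b k) (r k) (rtT cT z)) is left h
  then (((r (sval (cid h)))^-1)%:C)%C * (rtT cT z - b (sval (cid h))) else 0.

Definition boxF (z : C) : C :=
  if normc z < 1 then sqT cT z else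
  if normc (z - cT) < 1 / 4 then cT + 4 * (z - cT) else tile_map z.

Lemma r_gt0 k : 0 < r k.
Proof. by case: Pbr. Qed.

Lemma cdisk8 k : cdisk (b k) (8 * r k) `<=` half_annulus.
Proof. by case: Pbr. Qed.

Lemma cdisk_half_annulus k : cdisk (b k) (r k) `<=` half_annulus.
Proof.
move=> z zk; apply: (@cdisk8 k); move: zk; rewrite /cdisk /=.
by have := r_gt0 k; lra.
Qed.

Lemma disk_half_annulus k : disk (b k) (r k) `<=` half_annulus.
Proof. by move=> z /disk_sub_cdisk; exact: cdisk_half_annulus. Qed.

Lemma cdisk_Re k w : cdisk (b k) (r k) w -> 0 < complex.Re w.
Proof. by move=> /cdisk_half_annulus[]. Qed.

Lemma cdisk_disj j k w : cdisk (b j) (r j) w -> cdisk (b k) (r k) w -> j = k.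
Proof. by case: Pbr => _ _ H _; exact: H. Qed.

Lemma cT_norm : normc cT = 3.
Proof. by rewrite normc_real ger0_norm. Qed.

Lemma V0V1_closure z : closure V0 z -> closure V1 z -> False.
Proof.
rewrite !closure_disk// /cdisk /= subr0 => h1 h2.
by have := normc_triangle z cT 0; rewrite (normcB cT z) !subr0 cT_norm; lra.
Qed.

Lemma V0V1 z : V0 z -> V1 z -> False.
Proof. by move=> h1 h2; apply: (V0V1_closure (z := z)); exact: subset_closure. Qed.

Lemma sqT_sub_cT w : sqT cT w - cT = w ^+ 2.
Proof. by rewrite /sqT addrAC subrr add0r. Qed.

Lemma closure_piece0 : closure (piece 0) = cdisk cT (1 / 4).
Proof. by rewrite closure_disk. Qed.

Lemma closure_pieceS k : closure (piece k.+1) = sqT cT @` cdisk (b k) (r k).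
Proof. by apply: closure_sqT_disk; exact: r_gt0. Qed.

Lemma open_piece j : open (piece j).
Proof.
by case: j => [|k]; [exact: open_disk|apply: open_sqT_disk; exact: cdisk_Re].
Qed.

Lemma connected_piece j : connected (piece j).
Proof. by case: j => [|k]; [exact: connected_disk|exact: connected_sqT_disk]. Qed.

Lemma jordan_piece j : jordan_disk (piece j).
Proof.
case: j => [|k]; first by apply: jordan_disk_disk; lra.
by apply: jordan_disk_sqT; [exact: r_gt0|exact: cdisk_Re].
Qed.

(** In the parameter the closed central piece has norm at most 1/2, whereas the closed packed disks
    have norm above 1/2. Two closed tiles are separated by the injectivity of squaring on the right
    half-plane. *)
Lemma closure_piece_disj i j z : closure (piece i) z -> closure (piece j) z -> i = j.
Proof.
have H k : closure (piece 0) z -> closure (piece k.+1) z -> False.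
  rewrite closure_piece0 closure_pieceS => h [w wk wz]; move: h.
  rewrite -wz /cdisk /= sqT_sub_cT normc_sqr.
  by have [_ w1 _] := cdisk_half_annulus wk; have := normc_ge0 w; nra.
case: i => [|i]; case: j => [|j] //; [by move=> h /(H _ h)|by move=> h /H/(_ h)|].
rewrite !closure_pieceS => -[w wi <-] [v vj].
move=> /(congr1 (rtT cT)); rewrite !rtTK; [|exact: cdisk_Re wi|exact: cdisk_Re vj].
by move=> E; rewrite -E in wi; rewrite (cdisk_disj wi vj).
Qed.

Lemma piece_disj i j z : piece i z -> piece j z -> i = j.
Proof. by move=> h1 h2; apply: (@closure_piece_disj _ _ z); exact: subset_closure. Qed.

Lemma closure_piece_V1 j : closure (piece j) `<=` V1.
Proof.
case: j => [|k] z; first by rewrite closure_piece0 /cdisk /target_disk /disk /=; lra.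
rewrite closure_pieceS => -[w wk <-]; rewrite /target_disk /disk /= sqT_sub_cT normc_sqr.
by have [_ w2 w1] := cdisk_half_annulus wk; nra.
Qed.

Lemma piece_V1 j : piece j `<=` V1.
Proof. by apply: subset_trans (@closure_piece_V1 j); exact: subset_closure. Qed.

Lemma piece_nonempty j : piece j !=set0.
Proof.
case: j => [|k]; first by exists cT; apply: disk_center; lra.
by exists (sqT cT (b k)), (b k) => //; apply: disk_center; exact: r_gt0.
Qed.

Definition Upiece (o : option nat) : set C := if o is Some j then piece j else V0.
Definition Vpiece (o : bool) : set C := if o then V1 else V0.

Lemma boxUE : boxU = \bigcup_o Upiece o.
Proof.
apply/seteqP; split=> z.
  by case=> [z0|[j _ zj]]; [exists None|exists (Some j)].
by case=> -[j|] _ /= zj; [right; exists j|left].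
Qed.

Lemma boxVE : boxV = \bigcup_o Vpiece o.
Proof.
apply/seteqP; split=> z.
  by case=> z0; [exists false|exists true].
by case=> -[] _ /= zj; [right|left].
Qed.

Lemma component_U o z : Upiece o z -> connected_component boxU z = Upiece o.
Proof.
rewrite boxUE; apply: component_bigcup => {o z}.
- by case=> [j|] /=; [exact: open_piece|exact: open_disk].
- by case=> [j|] /=; [exact: connected_piece|exact: connected_disk].
- move=> [i|] [j|] z //= hi hj.
  + by rewrite (piece_disj hi hj).
  + by case: (V0V1 hj (piece_V1 hi)).
  + by case: (V0V1 hi (piece_V1 hj)).
Qed.

Lemma component_V o z : Vpiece o z -> connected_component boxV z = Vpiece o.
Proof.
rewrite boxVE; apply: component_bigcup => {o z}.
- by case=> /=; exact: open_disk.
- by case=> /=; exact: connected_disk.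
- move=> [] [] z //= hi hj.
  + by case: (V0V1 hj hi).
  + by case: (V0V1 hi hj).
Qed.

Lemma UV1 : boxU `&` V1 = \bigcup_j piece j.
Proof.
apply/seteqP; split=> z; first by case=> -[z0 /(V0V1 z0)|].
by move=> [j _ zj]; split; [right; exists j|exact: piece_V1 zj].
Qed.

Lemma UV0 : boxU `&` V0 = V0.
Proof. by apply/seteqP; split=> z; [case|move=> z0; split => //; left]. Qed.

Lemma component_UV1 j z : piece j z -> connected_component (boxU `&` V1) z = piece j.
Proof.
rewrite UV1; apply: component_bigcup; [exact: open_piece|exact: connected_piece|exact: piece_disj].
Qed.

Lemma is_component_U W : is_component boxU W <-> exists o, W = Upiece o.
Proof.
split=> [[z Uz ->]|[i ->]].
  by move: Uz; rewrite {1}boxUE => -[i _ zi]; exists i; rewrite (component_U zi).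
have [z zi] : Upiece i !=set0.
  by case: i => [j|] /=; [exact: piece_nonempty|exists 0; exact: disk_center].
exists z; last by rewrite (component_U zi).
by rewrite boxUE; exists i.
Qed.

Lemma is_component_V W : is_component boxV W <-> W = V0 \/ W = V1.
Proof.
split=> [[z Vz ->]|h].
  by move: Vz; rewrite {1}boxVE => -[[] _ zo]; rewrite (component_V zo); [right|left].
have [i [-> [z zi]]] : exists i, W = Vpiece i /\ Vpiece i !=set0.
  case: h => ->; [exists false|exists true]; split=> //; last by exists cT; exact: disk_center.
  by exists 0; exact: disk_center.
exists z; last by rewrite (component_V zi).
by rewrite boxVE; exists i.
Qed.

Lemma is_component_UV1 W : is_component (boxU `&` V1) W <-> exists j, W = piece j.
Proof.
split=> [[z Uz ->]|[j ->]].
  by move: Uz; rewrite {1}UV1 => -[j _ zj]; exists j; rewrite (component_UV1 zj).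
have [z zj] := piece_nonempty j.
exists z; last by rewrite (component_UV1 zj).
by rewrite UV1; exists j.
Qed.

Lemma boxF_V0 z : V0 z -> boxF z = sqT cT z.
Proof. by rewrite /base_disk /disk /= subr0 /boxF => ->. Qed.

Lemma boxF_piece0 z : piece 0 z -> boxF z = cT + 4 * (z - cT).
Proof.
move=> z0; rewrite /boxF ifF; last first.
  by apply/negP => h; apply: (V0V1 (z := z)) (piece_V1 z0); rewrite /base_disk /disk /= subr0.
by rewrite ifT.
Qed.

Lemma boxF_pieceS k z : piece k.+1 z -> boxF z = (((r k)^-1)%:C)%C * (rtT cT z - b k).
Proof.
move=> zk; rewrite /boxF ifF; last first.
  by apply/negP => h; apply: (V0V1 (z := z)) (piece_V1 zk); rewrite /base_disk /disk /= subr0.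
rewrite ifF; last first.
  by apply/negP => h; have := piece_disj (h : piece 0 z) zk.
case: zk => w wk wz.
have wE : rtT cT z = w by rewrite -wz rtTK//; exact/cdisk_Re/disk_sub_cdisk/wk.
rewrite /tile_map wE; case: pselect => [h|]; last by case; exists k.
by case: (cid h) => j /= wj; rewrite (@cdisk_disj j k w)//; exact: disk_sub_cdisk.
Qed.

Lemma boxF_tile k w : disk (b k) (r k) w ->
  boxF (sqT cT w) = (((r k)^-1)%:C)%C * (w - b k).
Proof.
move=> wk; rewrite (@boxF_pieceS k); last by exists w.
by rewrite rtTK//; exact/cdisk_Re/disk_sub_cdisk/wk.
Qed.

(** Multiplication by 4 about the fixed point doubles the parameter, as
    [(2 * w) ^+ 2 = 4 * w ^+ 2]. *)
Lemma boxF_core w : disk 0 (1 / 2) w -> boxF (sqT cT w) = sqT cT (2 * w).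
Proof.
rewrite /disk /= subr0 => w0; rewrite boxF_piece0.
  by rewrite sqT_sub_cT /sqT; ring.
by rewrite /piece /disk /= sqT_sub_cT normc_sqr; have := normc_ge0 w; nra.
Qed.

Lemma boxF_V0_image : boxF @` V0 = V1.
Proof.
rewrite /target_disk -(sqT_unit_disk cT); apply: eq_imagel => z z0; exact: boxF_V0.
Qed.

Lemma boxF_piece0_image : boxF @` piece 0 = V1.
Proof.
apply/seteqP; split=> [_ [z z0 <-]|z z1].
  rewrite boxF_piece0//; move: z0; rewrite /piece /target_disk /disk /= addrAC subrr add0r => z0.
  rewrite normcM (_ : normc 4 = 4); first lra.
  by rewrite -[4 : C](rmorph_nat (real_complex R)) normc_real ger0_norm.
pose v := cT + (((1/4 : R)%:C)%C : C) * (z - cT).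
have v0 : piece 0 v.
  move: z1; rewrite /piece /target_disk /disk /= addrAC subrr add0r normcM normc_real ger0_norm; lra.
exists v => //; rewrite boxF_piece0// /v addrAC subrr add0r mulrA.
rewrite -[4 : C](rmorph_nat (real_complex R)) -rmorphM mul1r mulfV ?pnatr_eq0// rmorph1 mul1r.
by rewrite addrC subrK.
Qed.

Lemma boxF_pieceS_image k : boxF @` piece k.+1 = V0.
Proof.
have rk := r_gt0 k.
apply/seteqP; split=> [_ [_ [w wk <-] <-]|z z0].
  rewrite (boxF_tile wk) /base_disk /disk /= subr0 normcM normc_real gtr0_norm ?invr_gt0//.
  by rewrite mulrC ltr_pdivrMr// mul1r.
pose w := b k + (((r k)%:C)%C : C) * z.
have wk : disk (b k) (r k) w.
  move: z0; rewrite /base_disk /disk /= subr0 addrAC subrr add0r normcM normc_real gtr0_norm// => z0.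
  by rewrite -[ltRHS]mulr1 ltr_pM2l.
exists (sqT cT w); first by exists w.
rewrite (boxF_tile wk) /w addrAC subrr add0r mulrA -rmorphM mulVf ?gt_eqF//.
by rewrite rmorph1 mul1r.
Qed.

End BoxGeometry.

(** * Box mapping axioms, non-renormalizability and no permutation *)

Section BoxMapping.
Variable R : realType.
Local Notation C := (R[i]^o).
Variables (b : nat -> C) (r : nat -> R).
Hypothesis Pbr : packing (@half_annulus R) b r.
Local Notation F := (boxF b r).
Local Notation U := (boxU b r).
Local Notation V := (@boxV R).
Local Notation T := (cT R).
Local Notation V0 := (@base_disk R).
Local Notation V1 := (@target_disk R).
Local Notation piece := (box_piece b r).

Lemma near_open (A : set C) (f g : C -> C) z : open A -> A z ->
  (forall w, A w -> f w = g w) -> \forall w \near z, f w = g w.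
Proof.
move=> oA Az fg; have nA : nbhs z A by exact: open_nbhs_nbhs.
by apply: (@filterS _ (nbhs z) _ _ _ _ nA) => w; exact: fg.
Qed.

Lemma boxF_derive_V0 z : V0 z -> derivable F z 1 /\ derive1 F z = 2 * z.
Proof.
move=> z0; apply: (@is_derive_sqT R T).
by apply: near_open z0 _; [exact: open_disk|exact: boxF_V0].
Qed.

Lemma boxF_derive_piece0 z : piece 0 z -> derivable F z 1 /\ derive1 F z = 4.
Proof.
move=> z0; apply: (@is_derive_affine R T 4 T).
by apply: near_open z0 _; [exact: open_disk|exact: boxF_piece0].
Qed.

Lemma rtT_pieceS k z : piece k.+1 z -> disk (b k) (r k) (rtT T z).
Proof.
by move=> [w wk <-]; rewrite rtTK//; apply: (cdisk_Re Pbr); exact: disk_sub_cdisk wk.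
Qed.

Lemma boxF_derive_pieceS k z : piece k.+1 z ->
  derivable F z 1 /\ derive1 F z = (((r k)^-1)%:C)%C / (2 * rtT T z).
Proof.
move=> zk; apply: (@is_derive_rt R T _ (b k)).
  by apply: (cdisk_Re Pbr); apply: disk_sub_cdisk; exact: rtT_pieceS zk.
by apply: near_open zk _; [exact: open_piece|move=> w; exact: boxF_pieceS].
Qed.

Lemma boxU_cases z : U z -> [\/ V0 z, piece 0 z | exists k, piece k.+1 z].
Proof.
by case=> [?|[[|k] _ ?]]; [constructor 1|constructor 2|constructor 3; exists k].
Qed.

Lemma crit_boxF : crit F U = [set 0].
Proof.
apply/seteqP; split=> z; last first.
  move=> ->; have z0 : V0 0 by exact: disk_center.
  by split; [left|rewrite (boxF_derive_V0 z0).2 mulr0].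
move=> [/boxU_cases[z0|z0|[k zk]]] /eqP.
- by rewrite (boxF_derive_V0 z0).2 mulf_eq0 pnatr_eq0 /= => /eqP.
- by rewrite (boxF_derive_piece0 z0).2 pnatr_eq0.
- rewrite (boxF_derive_pieceS zk).2 => /eqP h; exfalso.
  have := cdisk_Re Pbr (disk_sub_cdisk (rtT_pieceS zk)).
  have rk : (((r k)^-1)%:C)%C != 0 :> C by rewrite -normc_gt0 normc_real normr_gt0 invr_eq0 gt_eqF// (r_gt0 Pbr).
  move/eqP : h; rewrite mulf_eq0 (negbTE rk) /= invr_eq0 mulf_eq0 pnatr_eq0 /= => /eqP ->.
  by rewrite /= ltxx.
Qed.

(** The preimage of a compact set is its image under the continuous inverse. *)
Lemma proper_from_inverse (A B : set C) (f g : C -> C) :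
  f @` A `<=` B -> g @` B `<=` A -> (forall z, A z -> g (f z) = z) ->
  (forall z, B z -> f (g z) = z) -> continuous g -> proper_map A B f.
Proof.
move=> fA gB gf fg cg; split=> // L LB cL.
suff -> : A `&` f @^-1` L = g @` L by apply: continuous_compact => //; exact: continuous_subspaceT.
apply/seteqP; split=> [z [Az Lz]|_ [z Lz <-]].
  by exists (f z) => //; exact: gf.
by split; [apply: gB; exists z => //; exact: LB|rewrite /= fg//; exact: LB].
Qed.

(** Here the map is two-to-one, so no inverse is available; instead the preimage of a compact set
    equals its preimage under the globally continuous [sqT T], which is closed, and it is
    bounded. *)
Lemma proper_boxF_V0 : proper_map V0 V1 F.
Proof.
split; first by rewrite boxF_V0_image.
move=> L LV cL.
have E : V0 `&` F @^-1` L = sqT T @^-1` L.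
  apply/seteqP; split=> [z [z0 /=]|z Lz].
    by rewrite boxF_V0.
  suff z0 : V0 z by split => //=; rewrite boxF_V0.
  have := LV _ Lz; rewrite /target_disk /base_disk /disk /= sqT_sub_cT normc_sqr subr0.
  by rewrite expr_lt1 ?normc_ge0.
rewrite E; apply: (@bounded_closed_compact_plane _ _ 1).
  apply: preimage_closed => [z _|]; first exact: sqT_continuous.
  by apply: compact_closed => //; exact: hausdorff_plane.
rewrite -E => z [+ _]; rewrite /base_disk /disk /= subr0; exact: ltW.
Qed.

Lemma affine_continuous (c a : C) : continuous (fun z : C => c + a * z).
Proof.
move=> z; apply: (@cvgC_D R C (nbhs z) _ (fun=> c) (fun w => a * w)); first exact: cvg_cst.
by apply: (@cvgC_M R C (nbhs z) _ (fun=> a) id); [exact: cvg_cst|exact: cvg_id].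
Qed.

Lemma proper_boxF_piece0 : proper_map (piece 0) V1 F.
Proof.
have n4 : (4 : C) != 0 by rewrite pnatr_eq0.
pose g (z : C) := (T - 4^-1 * T) + 4^-1 * z.
have gE z : g z = T + 4^-1 * (z - T) by rewrite /g; ring.
have fg z : T + 4 * (g z - T) = z by rewrite gE; field.
have gf z : g (T + 4 * (z - T)) = z by rewrite gE; field.
have gV : g @` V1 `<=` piece 0.
  move=> _ [z z1 <-]; rewrite -(boxF_piece0_image Pbr) in z1.
  by case: z1 => w w0 <-; rewrite boxF_piece0// gf.
apply: (proper_from_inverse (g := g)) => //; first by rewrite (boxF_piece0_image Pbr).
- by move=> z z0; rewrite boxF_piece0// gf.
- by move=> z z1; rewrite boxF_piece0 ?fg//; apply: gV; exists z.
- exact: affine_continuous.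
Qed.

Lemma proper_boxF_pieceS k : proper_map (piece k.+1) V0 F.
Proof.
have rk0 := r_gt0 Pbr k.
have rk : ((r k)%:C)%C != 0 :> C by rewrite -normc_gt0 normc_real normr_gt0 gt_eqF.
pose h (z : C) : C := b k + (((r k)%:C)%C : C) * z.
have hV z : V0 z -> disk (b k) (r k) (h z).
  rewrite /base_disk /disk /= subr0 addrAC subrr add0r normcM normc_real gtr0_norm// => z0.
  by rewrite -[ltRHS]mulr1 ltr_pM2l.
have hinv w : h ((((r k)^-1)%:C)%C * (w - b k)) = w.
  by rewrite /h fmorphV mulrA divff// mul1r addrC subrK.
apply: (proper_from_inverse (g := fun z => sqT T (h z))).
- by rewrite (boxF_pieceS_image Pbr).
- by move=> _ [z /hV zk <-]; exists (h z).
- by move=> _ [w wk <-]; rewrite (boxF_tile Pbr wk) hinv.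
- move=> z /hV zk; rewrite (boxF_tile Pbr zk) /h addrAC subrr add0r fmorphV mulrA mulVf// mul1r//.
- by move=> z; apply: continuous_comp; [exact: affine_continuous|exact: sqT_continuous].
Qed.

Lemma box_mapping : complex_box_mapping F U V.
Proof.
split.
- apply: openU; first exact: open_disk.
  by apply: bigcup_open => j _; exact: open_piece.
- by apply: openU; exact: open_disk.
- by move=> z [z0|[j _ zj]]; [left|right; exact: piece_V1 zj].
- move=> _ [z /boxU_cases[z0|z0|[k zk]] <-].
  + by right; rewrite -(boxF_V0_image b r); exists z.
  + by right; rewrite -(boxF_piece0_image Pbr); exists z.
  + by left; rewrite -(boxF_pieceS_image Pbr k); exists z.
- move=> z /boxU_cases[z0|z0|[k zk]].
  + exact: (boxF_derive_V0 z0).1.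
  + exact: (boxF_derive_piece0 z0).1.
  + exact: (boxF_derive_pieceS zk).1.
- rewrite -/(crit F U) crit_boxF; exact: finite_set1.
- exists [set V0; V1]; split.
  + exact: finite_set2.
  + by move=> W [->|->]; exact: jordan_disk_disk.
  + move=> W W' [->|->] [->|->] [z [h1 h2]] //; [by case: (V0V1_closure h1 h2)|by case: (V0V1_closure h2 h1)].
  + by rewrite bigcup_setU !bigcup_set1.
- move=> W /is_component_V[->|->].
    by left; apply/(is_component_U Pbr); exists None.
  right; exists (range piece); split.
  + by move=> _ [j _ <-]; exact: jordan_piece.
  + by move=> _ _ [i _ <-] [j _ <-] [z [h1 h2]]; rewrite (closure_piece_disj Pbr h1 h2).
  + by move=> _ [j _ <-]; exact: closure_piece_V1.
  + by rewrite setIC (UV1 Pbr) bigcup_image.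
- move=> W /(is_component_U Pbr)[[[|k]|]] ->; split.
  + by apply/is_component_V; right; exact: boxF_piece0_image.
  + by rewrite /= (boxF_piece0_image Pbr); exact: proper_boxF_piece0.
  + by apply/is_component_V; left; exact: boxF_pieceS_image.
  + by rewrite /= (boxF_pieceS_image Pbr); exact: proper_boxF_pieceS.
  + by apply/is_component_V; right; exact: boxF_V0_image.
  + by rewrite /= boxF_V0_image; exact: proper_boxF_V0.
Qed.

Lemma boxF0 : F 0 = T.
Proof. by rewrite boxF_V0 ?/sqT ?expr0n ?addr0//; exact: disk_center. Qed.

Lemma boxF_T : F T = T.
Proof.
rewrite (boxF_piece0 Pbr); first by rewrite subrr mulr0 addr0.
by apply: disk_center; lra.
Qed.

Lemma iter_boxF0 n : iter n.+1 F 0 = T.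
Proof. by elim: n => [|n ih]; [exact: boxF0|rewrite iterS ih boxF_T]. Qed.

Lemma connected_boxV_sub (B : set C) : B `<=` V -> connected B -> B 0 -> B T -> False.
Proof.
move=> BV cB B0 BT.
have v0 : @Vpiece R false 0 by exact: disk_center.
have : connected_component V 0 T by exact: (connected_component_max B0 BV cB BT).
rewrite (component_V v0) => h; apply: (V0V1 h); exact: disk_center.
Qed.

(* The domain and the range of a renormalization at the critical point 0 would
   both meet the orbit of 0, hence the range would join 0 to the fixed point. *)
Lemma non_renormalizable : ~ renormalizable F U V.
Proof.
move=> [s [c [A [B [s1 cc Ac BU [_ [_ [_ [_ cB _]] AB [d _ [_ AE _ _]]] _]]]]]].
move: cc; rewrite crit_boxF => /= c0; rewrite {}c0 in Ac.
apply: (@connected_boxV_sub B _ cB).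
- by move=> z /BU; exact: (box_sub box_mapping).
- exact/AB/subset_closure.
- by rewrite -AE; exists 0 => //; case: (s) s1 => // n _; exact: iter_boxF0.
Qed.

(** A frontier point of the central piece; the other pieces miss it because closures of pieces are
    disjoint. It serves as the escaping value for the no permutation condition and shows that no
    piece fills [V1]. *)
Lemma boundary_notin_boxU : ~ U (T + ((1 / 4 : R)%:C)%C).
Proof.
set z := T + _; have zT : normc (z - T) = 1 / 4.
  by rewrite /z addrAC subrr add0r normc_real ger0_norm.
have c0 : closure (piece 0) z by rewrite closure_piece0; change (normc (z - T) <= 1 / 4); rewrite zT.
case=> [z0|[j _ zj]].
  by apply: (V0V1 z0); change (normc (z - T) < 1); rewrite zT; lra.
have := closure_piece_disj Pbr c0 (subset_closure zj) => j0.
by move: zj; rewrite -j0; change (normc (z - T) < 1 / 4 -> False); rewrite zT ltxx.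
Qed.

Lemma boundary_in_V1 : V1 (T + ((1 / 4 : R)%:C)%C).
Proof.
set z := T + _; have zT : normc (z - T) = 1 / 4.
  by rewrite /z addrAC subrr add0r normc_real ger0_norm.
by change (normc (z - T) < 1); rewrite zT; lra.
Qed.

(** The base disk and the central piece are mapped onto [V1] in one step, a tile in two steps by way
    of [V0]; and [V1] contains a point outside [U]. *)
Lemma box_no_permutation : no_permutation F U V.
Proof.
have H1 W : F @` W = V1 -> W `<=` U -> exists n, (iter n F @` (W `&` iter_dom F U V n)) `\` U !=set0.
  move=> FW WU; exists 1%N, (T + ((1 / 4 : R)%:C)%C); split; last exact: boundary_notin_boxU.
  have := boundary_in_V1; rewrite -FW => -[w Ww E]; exists w => //; split=> //; split; first exact: WU.
  by rewrite /= E; right; exact: boundary_in_V1.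
have V0U : V0 `<=` U by move=> z; left.
move=> W /(is_component_U Pbr)[[[|k]|]] -> /=.
- by apply: H1; [exact: boxF_piece0_image|move=> z; right; exists 0%N].
- have := boundary_in_V1; rewrite -(boxF_V0_image b r) => -[v v0 E].
  have := v0; rewrite -(boxF_pieceS_image Pbr k) => -[w wk E'].
  exists 2%N, (T + ((1 / 4 : R)%:C)%C); split; last exact: boundary_notin_boxU.
  exists w; last by rewrite /= E'.
  split=> //; split; first by right; exists k.+1.
  split; first by rewrite /= E'; exact: V0U.
  by rewrite /= E' E; right; exact: boundary_in_V1.
- by apply: H1; [exact: boxF_V0_image|].
Qed.

End BoxMapping.

(** * Uniform moduli along non-escaping orbits *)

Section WellInside.
Variable R : realType.
Local Notation C := (R[i]^o).
Variables (b : nat -> C) (r : nat -> R).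
Hypothesis Pbr : packing (@half_annulus R) b r.
Local Notation F := (boxF b r).
Local Notation U := (boxU b r).
Local Notation V := (@boxV R).
Local Notation T := (cT R).
Local Notation V0 := (@base_disk R).
Local Notation V1 := (@target_disk R).
Local Notation piece := (box_piece b r).

Lemma iter_domP n z : iter_dom F U V n z <->
  (forall k, (k < n)%N -> U (iter k F z)) /\ V (iter n F z).
Proof.
elim: n z => [|n ih] z; first by split=> [|[]].
have E k : iter k F (F z) = iter k.+1 F z by rewrite iterSr.
split=> [[Uz /ih[h1 h2]]|[h1 h2]].
  by rewrite -E; split=> // -[//|k] kn; rewrite -E; exact: h1.
split; first exact: (h1 0%N).
by apply/ih; rewrite E; split=> // k kn; rewrite E; exact: h1.
Qed.

Lemma nonescapingP z : nonescaping F U V z <-> forall n, U (iter n F z).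
Proof.
split=> [h n|h n _]; first by have /iter_domP[+ _] := h n.+1 I; exact.
by apply/iter_domP; split=> //; exact: (box_sub (box_mapping Pbr)).
Qed.

(** The enlarged disk contains [b k - 8 * r k] and the point beyond [b k] on its ray at distance
    [8 * r k]. Positive real part of the first and norm below one of the second give the two
    estimates. *)
Lemma b_bounds k : [/\ 8 * r k < normc (b k), normc (b k) + 8 * r k < 1 & 0 < r k].
Proof.
have r0 := r_gt0 Pbr k; have r8 : 0 <= 8 * r k by rewrite mulr_ge0// ltW.
have bb : cdisk (b k) (8 * r k) (b k) by rewrite /cdisk /= subrr normc0.
have [_ B2 _] := cdisk8 Pbr bb.
set B := normc (b k) in B2 *; have B0 : 0 < B by lra.
split=> //.
  have [|h _ _] := @cdisk8 _ _ _ Pbr k (b k - ((8 * r k)%:C)%C).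
    by rewrite /cdisk /= addrAC subrr add0r normcN normc_real ger0_norm.
  have := Re_le_normc (b k); rewrite ger0_norm; last by move: h; case: (b k) => x y /=; lra.
  by move: h; rewrite /B; case: (b k) => x y /=; lra.
have [|_ _ h] := @cdisk8 _ _ _ Pbr k (b k + ((8 * r k / B)%:C)%C * b k).
  by rewrite /cdisk /= addrAC subrr add0r normcM normc_real ger0_norm ?divr_ge0 ?normc_ge0// -/B divfK ?gt_eqF.
move: h; rewrite -{1}[b k]mul1r -mulrDl -(rmorph1 (real_complex R)) -rmorphD normcM normc_real.
rewrite ger0_norm ?addr_ge0 ?divr_ge0 ?normc_ge0// -/B mulrDl mul1r divfK// gt_eqF//.
Qed.

Lemma piece_well_inside j : exists a s, [/\ 0 < s, closure (piece j) `<=` cdisk a s &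
  disk a (2 * s) `<=` V1].
Proof.
case: j => [|k].
  exists T, (1 / 4); split; [lra|by rewrite closure_piece0|].
  by move=> z; rewrite /target_disk /disk /=; lra.
have [h1 h2 r0] := b_bounds k; set B := normc (b k) in h1 h2.
have B0 : 0 < B by apply: lt_trans h1; rewrite mulr_gt0.
(* From [w ^+ 2 - b ^+ 2 = (w - b) * (w + b)] and [r < B / 8], the piece has radius at most
   [r * (2 * B + r) <= 17 / 8 * (r * B)]. The doubled disk lies in [V1] because [B ^+ 2 + 17 / 4 *
   (r * B) < B * (B + 8 * r) < 1]. *)
exists (sqT T (b k)), (17 / 8 * (r k * B)); split.
- by rewrite !mulr_gt0//.
- rewrite (closure_pieceS Pbr) => _ [w wk <-]; rewrite /cdisk /= /sqT opprD addrACA subrr add0r subr_sqr.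
  rewrite normcM; move: wk; rewrite /cdisk /= => wk.
  have : normc (w + b k) <= 2 * B + r k.
    have -> : w + b k = (w - b k) + 2 * b k by ring.
    apply: le_trans (le_normcD _ _) _; rewrite normcM.
    have -> : normc 2 = 2 :> R by rewrite -[2 : C](rmorph_nat (real_complex R)) normc_real ger0_norm.
    by rewrite -/B; lra.
  have := normc_ge0 (w - b k); have := normc_ge0 (w + b k); nra.
- move=> z; rewrite /target_disk /disk /= => hz.
  have := normc_triangle (sqT T (b k)) z T; rewrite sqT_sub_cT normc_sqr -/B.
  nra.
Qed.

Definition mod_bound : R := (16 * fine (unit_area R))^-1.

Lemma mod_bound_gt0 : 0 < mod_bound.
Proof. by rewrite invr_gt0 mulr_gt0// fine_gt0// unit_area_gt0 unit_area_lty. Qed.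

Lemma box_modulus_ge j z : piece j z -> (mod_bound%:E <= box_modulus U V z)%E.
Proof.
move=> zj; rewrite /box_modulus.
have -> : connected_component V z = V1.
  by rewrite (@component_V R true)//; exact: piece_V1 zj.
have -> : connected_component U z = piece j by rewrite (@component_U R b r Pbr (Some j)).
case: pselect => [E|E] /=.
  case: (boundary_notin_boxU Pbr); right; exists j => //; rewrite -E; exact: boundary_in_V1.
have [a [s [s0 h1 h2]]] := piece_well_inside j.
apply: (@modulus_ge R V1 (piece j) a s _ s0 h1 h2).
- exact: open_disk.
- apply: connected_closure; exact: connected_piece.
- exact: connected_disk_compl.
Qed.

(** [V0] is mapped onto the disjoint [V1], so two consecutive points of an orbit cannot both lie in
    [V0]. *)
Lemma visits_V1 z n : nonescaping F U V z -> exists2 k, (n <= k)%N & exists j, piece j (iter k F z).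
Proof.
move=> /nonescapingP zK.
have [z0|[j _ zj]] := zK n; last by exists n => //; exists j.
have [z1|[j _ zj]] := zK n.+1; last by exists n.+1 => //; exists j.
case: (V0V1 z1); rewrite iterS -(boxF_V0_image b r); by exists (iter n F z).
Qed.

(** One bound serves all orbits: the modulus is at least [mod_bound] at infinitely many times, so
    the upper limit exceeds [mod_bound / 2]. *)
Lemma nonescaping_well_inside : nonescaping F U V = well_inside F U V.
Proof.
apply/seteqP; split=> [z zK|z [d _ []]//].
exists (mod_bound / 2); first by rewrite /= divr_gt0// mod_bound_gt0.
split=> //; apply: lt_le_trans (_ : (mod_bound%:E <= _)%E).
  by rewrite lte_fin; have := mod_bound_gt0; lra.
apply: le_ereal_inf_tmp => _ [A [N _ NA] <-].
have [k Nk [j zj]] := visits_V1 N zK.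
apply: le_trans (box_modulus_ge zj) _.
by apply: ereal_sup_ubound; exists k => //; exact: NA.
Qed.

End WellInside.

(** * Null sets *)

Section NullSets.
Variable R : realType.
Local Notation C := (R[i]^o).
Variables (b : nat -> C) (r : nat -> R).
Hypothesis Pbr : packing (@half_annulus R) b r.
Local Notation F := (boxF b r).
Local Notation U := (boxU b r).
Local Notation V := (@boxV R).
Local Notation T := (cT R).
Local Notation V0 := (@base_disk R).
Local Notation V1 := (@target_disk R).
Local Notation piece := (box_piece b r).

Definition untiled : set C := [set w | V0 w /\ ~ U (sqT T w)].

Lemma content_opp (A : set C) : (content (-%R @` A) <= content A)%E.
Proof.
have := @content_affine R -%R 1 A ltr01; rewrite expr1n mul1e; apply=> z w.
by rewrite mul1r opprK addrC normcB.
Qed.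

Lemma content_null_opp (A : set C) : content A = 0%E -> content (-%R @` A) = 0%E.
Proof. by move=> A0; apply/eqP; rewrite eq_le content_ge0 andbT -A0 content_opp. Qed.

Lemma sqT_N w : sqT T (- w) = sqT T w.
Proof. by rewrite /sqT sqrrN. Qed.

(** The untiled parameters lie on the circle of radius 1/2, on the imaginary axis, or, up to sign,
    in the residue of the packing or on the boundary circles of its disks. *)
Lemma content_untiled : content untiled = 0%E.
Proof.
pose X := (@half_annulus R `\` \bigcup_k cdisk (b k) (r k)) `|`
  \bigcup_k [set z | normc (z - b k) = r k].
have X0 : content X = 0%E.
  apply: content_nullU; first exact: (packing_content_rest (@half_annulus_bounded R) Pbr).
  by apply: content_null_bigcup => k; apply: content_circle; exact: r_gt0 Pbr k.
have HX w : half_annulus w -> ~ U (sqT T w) -> X w.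
  move=> wO nU; have [[k _ wk]|nk] := pselect ((\bigcup_k cdisk (b k) (r k)) w); last by left.
  right; exists k => //=; apply/eqP; rewrite eq_le wk /= leNgt; apply/negP => wk'.
  by apply: nU; right; exists k.+1 => //; exists w.
apply: (@content_null_sub _ _ (([set z | normc (z - 0) = 1 / 2] `|`
  [set z : C | complex.Re z = 0 /\ normc z <= 1]) `|` (X `|` -%R @` X))); last first.
  apply: content_nullU; apply: content_nullU => //.
  - by apply: content_circle; lra.
  - exact: content_segment.
  - exact: content_null_opp.
move=> w [w1 nU]; move: (w1); rewrite /base_disk /disk /= subr0 => w1'.
have w2 : 1 / 2 <= normc w.
  rewrite leNgt; apply/negP => h; apply: nU; right; exists 0%N => //.
  by rewrite /box_piece /disk /= sqT_sub_cT normc_sqr; have := normc_ge0 w; nra.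
have [E|w2'] := eqVneq (normc w) (1 / 2); first by left; left.
have {}w2' : 1 / 2 < normc w by rewrite lt_neqAle eq_sym w2'.
have [wl|wg|we] := ltgtP (complex.Re w) 0.
- right; right; exists (- w); last by rewrite opprK.
  apply: HX; last by rewrite sqT_N.
  by split; rewrite ?normcN// ReN oppr_gt0.
- by right; left; apply: HX.
- by left; right; split=> //; exact: ltW.
Qed.

Lemma content_null_sqT (A : set C) : A `<=` V0 -> content A = 0%E -> content (sqT T @` A) = 0%E.
Proof.
move=> AV; apply: (@content_null_lipschitz _ _ 2) => // z w /AV + /AV.
rewrite /base_disk /disk /= !subr0 => z1 w1.
rewrite /sqT opprD addrACA subrr add0r subr_sqr normcM.
have := le_normcD z w; have := normc_ge0 (z - w); nra.
Qed.

Lemma tiling : area (V1 `\` \bigcup_j piece j) = 0%E.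
Proof.
apply: area_content_null; apply: content_null_sub (content_null_sqT _ content_untiled).
  move=> z [z1 nz]; move: (z1); rewrite /target_disk -(sqT_unit_disk T) => -[w w0 wz].
  exists w => //; split=> //; rewrite wz => Uz; apply: nz.
  by rewrite -(UV1 Pbr); split.
by move=> w [].
Qed.

Definition branch k (y : C) : C := b k + (((r k)%:C)%C : C) * y.

Lemma content_branch k (A : set C) : (content (branch k @` A) <= (r k ^+ 2)%:E * content A)%E.
Proof.
apply: content_affine; first exact: r_gt0 Pbr k.
move=> z w; rewrite /branch opprD addrACA subrr add0r -mulrBr normcM normc_real gtr0_norm//.
exact: r_gt0 Pbr k.
Qed.

Definition halve (y : C) : C := (((1 / 2 : R)%:C)%C : C) * y.

Lemma normc_half y : normc (halve y) = 1 / 2 * normc y.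
Proof. by rewrite /halve normcM normc_real ger0_norm. Qed.

Lemma content_half (A : set C) : (content (halve @` A) <= ((1 / 2) ^+ 2)%:E * content A)%E.
Proof.
apply: content_affine => // z w.
by rewrite -mulrBr normcM normc_real ger0_norm.
Qed.

Lemma half2 (y : C) : 2 * halve y = y.
Proof.
by rewrite /halve mulrA -[2 : C](rmorph_nat (real_complex R)) -rmorphM mul1r divff// rmorph1 mul1r.
Qed.

(* In the coordinate [w] of [V1] given by [z = T + w ^ 2] the second iterate of
   the map is piecewise affine with inverse branches [halve] and [+- branch k],
   all of them onto the unit disk. *)
Lemma second_iterate x : V0 x -> U (sqT T x) ->
  (exists y, [/\ V0 y, x = halve y & F (F x) = F y]) \/
  (exists k y, [/\ V0 y, x = branch k y \/ x = - branch k y & F (F x) = y]).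
Proof.
move=> x0 Ux; have Fx := boxF_V0 b r x0; rewrite Fx.
have x1 : V1 (sqT T x) by rewrite /target_disk -sqT_unit_disk; exists x.
case: Ux => [h|[[|k] _ h]]; first by case: (V0V1 h x1).
  left; exists (2 * x).
  have nx : normc x < 1 / 2.
    move: h; rewrite /box_piece /disk /= sqT_sub_cT normc_sqr => h.
    by rewrite ltNge; apply/negP => h'; clear -h h'; nra.
  have y0 : V0 (2 * x).
    rewrite /base_disk /disk /= subr0 normcM.
    have -> : normc 2 = 2 :> R by rewrite -[2 : C](rmorph_nat (real_complex R)) normc_real ger0_norm.
    by lra.
  split=> //; first by have := half2 x; rewrite /halve mulrCA => ->.
  rewrite (boxF_V0 b r y0); apply: (boxF_core Pbr); rewrite /disk /= subr0//.
right; case: h => w wk wx; have rk := r_gt0 Pbr k.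
have rn : ((r k)%:C)%C != 0 :> C by rewrite -normc_gt0 normc_real normr_gt0 gt_eqF.
have Fw := boxF_tile Pbr wk; exists k, (F (sqT T x)); split=> //.
  by rewrite -(boxF_pieceS_image Pbr k); exists (sqT T x) => //; exists w.
rewrite -wx Fw /branch fmorphV mulrA divff// mul1r addrC subrK.
have : (x - w) * (x + w) = 0.
  by rewrite -subr_sqr; move: wx; rewrite /sqT => /addrI ->; rewrite subrr.
move/eqP; rewrite mulf_eq0 subr_eq0 addr_eq0 => /orP[] /eqP ->; [by left|by right].
Qed.

(** The fixed point [T] is excluded at the last step only; being fixed, it is thereby excluded at
    every earlier time. The line field has no direction there. *)
Fixpoint regular (n : nat) : set C :=
  if n is m.+1 then U `&` F @^-1` (regular m) else V `\ T.

Lemma regularP n z : regular n z <-> iter_dom F U V n z /\ iter n F z <> T.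
Proof.
elim: n z => [|n ih] z; first by split=> [[]|[]].
rewrite iterSr; split=> [[Uz /ih[]]|[[Uz h1] h2]]; first by split.
by split=> //; apply/ih.
Qed.

Lemma open_preimage_F (A : set C) : open A -> open (U `&` F @^-1` A).
Proof.
rewrite !openE => oA z [Uz Az].
have cF : {for z, continuous F}.
  apply: differentiable_continuous; apply/derivable1_diffP.
  exact: (box_holo (box_mapping Pbr)).
have oU := box_open_dom (box_mapping Pbr).
have n1 : nbhs z U by exact: open_nbhs_nbhs.
have n2 : nbhs z (F @^-1` A) by apply: cF; exact: oA.
exact: filterI n1 n2.
Qed.

Lemma open_regular n : open (regular n).
Proof.
elim: n => [|n ih]; last exact: open_preimage_F.
apply: open_setD; first exact: (box_open_cod (box_mapping Pbr)).
by apply: accessible_closed_set1; apply: hausdorff_accessible; exact: hausdorff_plane.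
Qed.

Lemma open_iter_dom n : open (iter_dom F U V n).
Proof.
elim: n => [|n ih]; last exact: open_preimage_F.
exact: (box_open_cod (box_mapping Pbr)).
Qed.

Definition invariant_core : set C := \bigcap_n regular n.

(** Induction by two, because self-similarity belongs to the second iterate: an exceptional point
    for [n.+2] is untiled, or half of one for [n.+1], or up to sign a [branch] image of one for [n].
    For [n = 1] the only exception is 0, which is mapped to [T]. *)
Lemma content_singular n : content (V0 `\` regular n) = 0%E.
Proof.
suff : content (V0 `\` regular n) = 0%E /\ content (V0 `\` regular n.+1) = 0%E by case.
have V0T x : V0 x -> x <> T by move=> x0 xT; apply: (V0V1 x0); rewrite xT; exact: disk_center.
elim: n => [|n [ih0 ih1]].
  split.
    apply: (content_null_sub (B := set0)); last exact: content0.
    by move=> x [x0 nx]; case: nx; split; [left|exact: V0T].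
  apply: content_null_sub (content_segment (0 : R)) => x [x0 nx].
  have [->|xn0] := eqVneq x 0; first by split; rewrite ?normc0.
  case: nx; split; first by left.
  rewrite /= (boxF_V0 b r x0); split.
    by right; rewrite /target_disk -sqT_unit_disk; exists x.
  move=> /(congr1 (fun z => z - T)); rewrite subrr sqT_sub_cT => /eqP.
  by rewrite expf_eq0 /= (negbTE xn0).
split=> //.
have nb k (A : set C) : content A = 0%E -> content (branch k @` A) = 0%E.
  move=> A0; apply/eqP; rewrite eq_le content_ge0 andbT.
  by apply: le_trans (content_branch k A) _; rewrite A0 mule0.
have nh (A : set C) : content A = 0%E -> content (halve @` A) = 0%E.
  move=> A0; apply/eqP; rewrite eq_le content_ge0 andbT.
  by apply: le_trans (content_half A) _; rewrite A0 mule0.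
pose B := \bigcup_k (branch k @` (V0 `\` regular n)).
have B0 : content B = 0%E by apply: content_null_bigcup => k; exact: nb.
apply: (@content_null_sub _ _ ((untiled `|` halve @` (V0 `\` regular n.+1)) `|` (B `|` -%R @` B))); last first.
  apply: content_nullU; apply: content_nullU => //.
  - exact: content_untiled.
  - exact: nh.
  - exact: content_null_opp.
move=> x [x0 nx].
have [Ux|nU] := pselect (U (sqT T x)); last by left; left.
have nFF : ~ regular n (F (F x)).
  move=> h; apply: nx; split; first by left.
  by rewrite /= (boxF_V0 b r x0); split => //=; rewrite -(boxF_V0 b r x0).
have [[y [y0 xy Fy]]|[k [y [y0 xy Fy]]]] := second_iterate x0 Ux.
  left; right; exists y => //; split=> //; rewrite Fy in nFF.
  by move=> [_]; exact: nFF.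
have By : B (branch k y) by exists k => //; exists y => //; split => //; rewrite -Fy.
by right; case: xy => ->; [left|right; exists (branch k y)].
Qed.

Lemma area_core_gt0 : (0 < area invariant_core)%E.
Proof.
have h : content (V0 `\` invariant_core) = 0%E.
  apply: (@content_null_sub _ _ (\bigcup_n (V0 `\` regular n))).
    move=> x [x0 nx]; apply: contrapT => nb; apply: nx => n _; apply: contrapT => nr.
    by apply: nb; exists n.
  by apply: content_null_bigcup => n; exact: content_singular.
apply: lt_le_trans (unit_area_gt0 R) _.
apply: (@le_trans _ _ (area (invariant_core `|` (V0 `\` invariant_core)))).
  by apply: area_le => x x0; have [?|?] := pselect (invariant_core x); [left|right].
apply: le_trans (areaU _ _) _; rewrite [X in (_ + X)%E](area_content_null h) adde0//.
Qed.

Lemma core_nonescaping : invariant_core `<=` nonescaping F U V.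
Proof. by move=> z h n _; have /regularP[] := h n I. Qed.

(** Starting points are confined to [V0], where the second iterate is self-similar, and the radii
    are powers of 1/2 to match the branch [halve]. Each neighbourhood of 0 contains one of these
    disks. *)
Definition avoiding (m : nat) : set C :=
  [set x | [/\ V0 x, nonescaping F U V x & forall n, ~ disk 0 ((1 / 2) ^+ m) (iter n F x)]].

(** The disk of radius 1/2, the packed half annulus and its opposite are disjoint in the unit disk,
    so [1 / 4 + 2 * S <= 1] for the sum [S] of the squared radii. *)
Lemma packing_sum_le : (\sum_(k <oo) (r k ^+ 2)%:E <= (3 / 8)%:E)%E.
Proof.
have bound_from_area (a s : R) : 0 < a -> (1 / 2) ^+ 2 * a + (a * s + a * s) <= a -> s <= 3 / 8.
  move=> a0 h; have : (s + s) * a <= 3 / 4 * a by lra.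
  by rewrite ler_pM2r//; lra.
have dis1 (w : C) : half_annulus w -> half_annulus (- w) -> False.
  by move=> [p1 _ _] [p2 _ _]; move: p1 p2; rewrite ReN; lra.
have dis2 (w : C) : disk 0 (1 / 2) w -> normc w <= 1 / 2 by rewrite /disk /= subr0; exact: ltW.
have dis3 (w : C) : half_annulus w -> normc w <= 1 / 2 -> False by move=> [_ h _]; lra.
have sub1 (w : C) : disk 0 (1 / 2) w -> disk 0 1 w by rewrite /disk /=; lra.
have sub2 (w : C) : half_annulus w -> disk 0 1 w by rewrite /disk /= subr0 => -[].
have sub3 (w : C) : half_annulus (- w) -> disk 0 1 w by rewrite /disk /= subr0 => -[_ _]; rewrite normcN.
set S := (\sum_(k <oo) _)%E.
have h1 : (unit_area R * S <= area (@half_annulus R))%E by exact: packing_area Pbr.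
pose negO : set C := -%R @` (@half_annulus R).
have negOE z : negO z <-> half_annulus (- z).
  by split=> [[w wO <-]|h]; [rewrite opprK|exists (- z); rewrite ?opprK].
have h2 : (unit_area R * S <= area negO)%E.
  apply: (@disks_area_sum R negO (fun k => - b k) r); first exact: r_gt0 Pbr.
    move=> j k z zj zk; apply: (@cdisk_disj R b r Pbr j k (- z)); apply: disk_sub_cdisk.
      by move: zj; rewrite /disk /= opprK -normcN opprD.
    by move: zk; rewrite /disk /= opprK -normcN opprD.
  move=> k z zk; apply/negOE; apply: (disk_half_annulus Pbr (k := k)).
  by move: zk; rewrite /disk /= opprK -normcN opprD.
have oO := @open_half_annulus R.
have oN : open negO.
  have -> : negO = -%R @^-1` (@half_annulus R) by apply/seteqP; split=> z /negOE.
  apply: open_comp => [z _|]; last exact: oO.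
  by apply: (@cvgC_N R C (nbhs z) _ id); exact: cvg_id.
have oD := @open_disk R 0 (1 / 2).
have mO := measurable_open_plane oO; have mN := measurable_open_plane oN.
have mD := measurable_open_plane oD.
pose D2 : set C := disk 0 (1 / 2).
have h3 : (area D2 + (area (@half_annulus R) + area negO) <= unit_area R)%E.
  have mV := measurable_open_plane (@open_disk R 0 1).
  rewrite /unit_area !area_measurable//.
  rewrite -measureU//; last first.
    by rewrite -subset0 => p [p1 /negOE p2]; exact: dis1 p1 p2.
  rewrite -measureU//; [|exact: measurableU|]; last first.
    rewrite -subset0 => p [/dis2 p0 [pO|/negOE pO]]; first exact: dis3 pO p0.
    by apply: dis3 pO _; rewrite normcN.
  apply: le_measure; rewrite ?inE//; first by apply: measurableU => //; exact: measurableU.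
  by move=> p [/sub1|[/sub2|/negOE/sub3]].
move: h3; rewrite /D2 area_disk; last by rewrite divr_gt0.
have a0 := unit_area_gt0 R; have S0 : (0 <= S)%E by apply: nneseries_ge0 => *; rewrite lee_fin sqr_ge0.
have Sf : S \is a fin_num.
  by rewrite ge0_fin_numE//; exact: packing_sum_fin (@half_annulus_bounded R) Pbr.
move=> h3.
have {h3 h1 h2} : (((1 / 2) ^+ 2)%:E * unit_area R + (unit_area R * S + unit_area R * S) <= unit_area R)%E.
  by apply: le_trans h3; rewrite leeD2l// leeD.
rewrite -(fineK (unit_area_fin R)) -(fineK Sf).
have : 0 < fine (unit_area R) by rewrite fine_gt0// a0 unit_area_lty.
set a := fine _; set s := fine _ => a00.
rewrite -!EFinM -!EFinD !lee_fin; exact: bound_from_area.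
Qed.

(** In the first case the orbit of [y] after time 0 is a tail of that of [x], and [y] itself is
    farther from 0 than [x]; in the second, [y] lies on the orbit of [x]. *)
Lemma avoiding_step m x : avoiding m x ->
  (exists2 y, avoiding m y & x = halve y) \/
  (exists k y, avoiding m y /\ (x = branch k y \/ x = - branch k y)).
Proof.
move=> [x0 /(nonescapingP Pbr) xK xav].
have Ux : U (sqT T x) by rewrite -(boxF_V0 b r x0); exact: (xK 1%N).
have [[y [y0 xy Fy]]|[k [y [y0 xy Fy]]]] := second_iterate x0 Ux.
  left; exists y => //.
  have E n : iter n.+1 F y = iter n.+2 F x by rewrite !iterSr Fy.
  split=> //.
    by apply/(nonescapingP Pbr) => -[|n]; [left|rewrite E].
  case=> [|n]; last by rewrite E; exact: xav.
  move=> h; apply: (xav 0%N); move: h; rewrite /= xy /disk /= !subr0 normc_half.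
  by have := normc_ge0 y; lra.
right; exists k, y; split=> //.
have E n : iter n F y = iter n.+2 F x by rewrite !iterSr Fy.
by split=> // [|n]; [apply/(nonescapingP Pbr) => n|]; rewrite E.
Qed.

(** The set is cut into the shells between consecutive disks [D k]. A shell consists of [branch]
    images halved [k] times, of content at most [3 / 4 * ((1 / 2) ^+ k) ^+ 2] times the whole; only
    the m shells before [D m] are nonempty. *)
Lemma content_avoiding m : content (avoiding m) = 0%E.
Proof.
pose N := avoiding m; pose D k : set C := disk 0 ((1 / 2) ^+ k).
pose B := \bigcup_k (branch k @` N); pose B' := B `|` -%R @` B.
have hp k : 0 <= (1 / 2 : R) ^+ k by rewrite exprn_ge0.
have fin k : content (N `&` D k) \is a fin_num.
  rewrite ge0_fin_numE ?content_ge0//.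
  apply: le_lt_trans (_ : ((((1 / 2) ^+ k) ^+ 2)%:E < +oo)%E); last exact: ltry.
  by apply: le_trans (content_disk 0 (hp k)); apply: content_le => x [].
have ND : N `&` D 0%N = N by apply/seteqP; split=> x; [case|move=> h; split=> //; case: h].
have Nfin : content N \is a fin_num by rewrite -ND.
have hB : (content B' <= (3 / 4)%:E * content N)%E.
  have hB1 : (content B <= (3 / 8)%:E * content N)%E.
    apply: le_trans (content_bigcup _) _.
    apply: (@le_trans _ _ (\sum_(k <oo) (content N * (r k ^+ 2)%:E))%E).
      by apply: lee_nneseries => k *; [exact: content_ge0|rewrite muleC; exact: content_branch].
    rewrite -(fineK Nfin) nneseriesZl; last by move=> *; rewrite lee_fin sqr_ge0.
    by rewrite muleC lee_wpmul2r ?packing_sum_le// lee_fin fine_ge0 ?content_ge0.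
  apply: le_trans (contentU _ _) _.
  apply: le_trans (leeD hB1 (le_trans (content_opp _) hB1)) _.
  by rewrite -(fineK Nfin) -!EFinM -EFinD lee_fin; lra.
have scale k : (content (iter k (fun A => halve @` A) B') <= (((1 / 2) ^+ k) ^+ 2 * (3 / 4))%:E * content N)%E.
  elim: k => [|k ih]; first by rewrite /= expr0 expr1n mul1r.
  apply: le_trans (content_half _) _.
  apply: le_trans (lee_wpmul2l _ ih) _; first by rewrite lee_fin sqr_ge0.
  have -> : ((1 / 2) ^+ k.+1) ^+ 2 * (3 / 4) = (1 / 2) ^+ 2 * (((1 / 2) ^+ k) ^+ 2 * (3 / 4)) :> R.
    by rewrite (exprS _ k); move: (1 / 2) => h; ring.
  by rewrite EFinM muleA.
have step k : N `&` D k `<=` iter k (fun A => halve @` A) B' `|` (N `&` D k.+1).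
  elim: k => [|k ih] x [xN xD].
    have [[y yN xy]|[k [y [yN xy]]]] := avoiding_step xN.
      right; split=> //; rewrite /D /disk /= subr0 xy normc_half expr1.
      by case: yN => y0 _ _; move: y0; rewrite /base_disk /disk /= subr0; lra.
    have By : B (branch k y) by exists k => //; exists y.
    by left; case: xy => ->; [left|right; exists (branch k y)].
  have [[y yN xy]|[j [y [yN xy]]]] := avoiding_step xN.
    have yD : D k y.
      move: xD; rewrite /D /disk /= !subr0 xy normc_half exprS.
      by rewrite ltr_pM2l//; lra.
    have [h|[_ h]] := ih y (conj yN yD); first by left; exists y.
    right; split=> //; move: h; rewrite /D /disk /= !subr0 xy normc_half [in X in _ -> X]exprS.
    by rewrite ltr_pM2l//; lra.
  (* Points of a packed disk or of its opposite lie outside the disk of radius 1/2, hence outside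
     [D k.+1]. *)
  have x2 : 1 / 2 < normc x.
    have y0 : V0 y by case: yN.
    have bk : disk (b j) (r j) (branch j y).
      move: y0; rewrite /base_disk /disk /= subr0 addrAC subrr add0r normcM normc_real gtr0_norm ?(r_gt0 Pbr)// => y0.
      by rewrite -[ltRHS]mulr1 ltr_pM2l// (r_gt0 Pbr).
    by have [_ h _] := disk_half_annulus Pbr bk; case: xy => ->; rewrite ?normcN.
  exfalso; move: xD; rewrite /D /disk /= subr0 exprS.
  have : (1 / 2 : R) ^+ k <= 1 by rewrite exprn_ile1//; lra.
  lra.
pose f k := fine (content (N `&` D k)).
have f0 : f 0%N = fine (content N) by rewrite /f ND.
have fstep k : f k <= ((1 / 2) ^+ k) ^+ 2 * (3 / 4) * f 0%N + f k.+1.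
  rewrite -lee_fin EFinD EFinM f0 !fineK//.
  apply: le_trans (content_le (step k)) _; apply: le_trans (contentU _ _) _.
  by rewrite leeD2r.
(* The shell bounds form a geometric series of ratio 1/4 with first term 3/4. *)
have sum k : f 0%N <= (1 - ((1 / 2) ^+ k) ^+ 2) * f 0%N + f k.
  elim: k => [|k ih]; first by rewrite expr0 expr1n subrr mul0r add0r.
  apply: le_trans ih _; have := fstep k; rewrite (exprS _ k); lra.
have fm : f m = 0.
  rewrite /f (_ : N `&` D m = set0) ?content0//.
  by rewrite -subset0 => x [[_ _ h] /(h 0%N)].
have f00 : 0 <= f 0%N by rewrite fine_ge0// content_ge0.
have := sum m; rewrite fm addr0 => h.
have p0 : 0 < ((1 / 2 : R) ^+ m) ^+ 2 by rewrite !exprn_gt0.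
have : ((1 / 2) ^+ m) ^+ 2 * f 0%N <= 0 by lra.
rewrite pmulr_rle0// => h'.
have {}h' : f 0%N = 0 by apply/eqP; rewrite eq_le h'.
by rewrite -/N -(fineK Nfin) -f0 h'.
Qed.

Lemma open_puzzle_neighborhood (A W : set C) : puzzle_neighborhood F U V A W -> open W.
Proof.
move=> [[P [_ PP ->]] _ _]; apply: bigcup_open => B /PP[n [z _ ->]].
apply: open_component; exact: open_iter_dom.
Qed.

Lemma disk_in_nbhs0 (W : set C) : open W -> W 0 ->
  exists m, disk 0 ((1 / 2) ^+ m) `<=` W.
Proof.
rewrite openE => oW W0; have /nbhs_normc[e e0 eW] := oW _ W0.
have [m me] : exists m : nat, (1 / 2 : R) ^+ m < e.
  have h : (fun n => (1 / 2 : R) ^+ n) @ \oo --> 0.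
    by apply: cvg_expr; rewrite ger0_norm; lra.
  have /cvgrPdist_lt/(_ e e0)[m _ hm] := h.
  by exists m; have := hm m (leqnn m); rewrite sub0r normrN ger0_norm// exprn_ge0.
by exists m => w; rewrite /disk /= => h; apply: eW; exact: lt_trans h me.
Qed.

(** A point of [V0] is in some [avoiding m]. A point of [V1] is [sqT T w], and the orbit of [w]
    avoids a disk about 0 small enough to exclude [w] too, unless [w = 0]; squaring is Lipschitz on
    the unit disk and keeps null sets null. *)
Lemma off_crit_null : area (off_crit F U V) = 0%E.
Proof.
pose N := \bigcup_m avoiding m.
have N0 : content N = 0%E by apply: content_null_bigcup => m; exact: content_avoiding.
have O0 : content [set 0 : C] = 0%E.
  by apply: content_null_sub (content_segment (0 : R)) => _ ->; split; rewrite ?normc0.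
apply: area_content_null.
apply: (@content_null_sub _ _ (N `|` sqT T @` (N `|` [set 0]))); last first.
  apply: content_nullU => //; apply: content_null_sqT; last exact: content_nullU.
  by move=> w [[m _ []]|->] //; exact: disk_center.
move=> x [/(nonescapingP Pbr) xK [W Wn Wav]].
have oW := open_puzzle_neighborhood Wn.
have W0 : W 0 by case: Wn => _ + _; apply; rewrite (crit_boxF Pbr).
have [m mW] := disk_in_nbhs0 oW W0.
have [x0|[j _ xj]] := xK 0%N.
  by left; exists m => //; split=> // [|n /mW]; [apply/(nonescapingP Pbr)|exact: Wav].
right; have /= x1 : V1 x by exact: piece_V1 xj.
move: (x1); rewrite /target_disk -(sqT_unit_disk T) => -[w w0 wx].
exists w => //; have [->|wn0] := eqVneq w 0; first by right.
left; have od : open (W `&` disk 0 (normc w)) by apply: openI => //; exact: open_disk.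
have [m' mW'] : exists m, disk 0 ((1 / 2) ^+ m) `<=` W `&` disk 0 (normc w).
  apply: disk_in_nbhs0 => //; split=> //; apply: disk_center; by rewrite normc_gt0.
have E n : iter n.+1 F w = iter n F x by rewrite iterSr (boxF_V0 b r w0) wx.
exists m' => //; split=> //.
  by apply/(nonescapingP Pbr) => -[|n]; [left|rewrite E].
case=> [/mW'[_]|n]; first by rewrite /disk /= subr0 ltxx.
by rewrite E => /mW'[h _]; exact: Wav h.
Qed.

End NullSets.

(** * The invariant line field *)

Section LineField.
Variable R : realType.
Local Notation C := (R[i]^o).
Local Notation plane := (measurableTypeR R * measurableTypeR R)%type.
Variables (b : nat -> C) (r : nat -> R).
Hypothesis Pbr : packing (@half_annulus R) b r.
Local Notation F := (boxF b r).
Local Notation U := (boxU b r).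
Local Notation V := (@boxV R).
Local Notation T := (cT R).
Local Notation V0 := (@base_disk R).
Local Notation V1 := (@target_disk R).
Local Notation piece := (box_piece b r).
Local Notation E := (invariant_core b r).

(* The slope of the line through [w], as a function of [w ^ 2]. *)
Definition sqrt_slope (z : C) : R := complex.Im z / (normc z + complex.Re z).

(** [sqT T] has derivative [2 * w], so it sends the horizontal direction at [w] to the line through
    [w], which is the same for [w] and [- w]. *)
Definition slope (z : C) : \bar R :=
  if normc z < 1 then 0%:E else (sqrt_slope (z - T))%:E.

(** The half-angle formula tan (t / 2) = sin t / (1 + cos t), with numerator and denominator scaled
    by the modulus. *)
Lemma sqrt_slope_sqr (w : C) : complex.Re w != 0 ->
  sqrt_slope (w ^+ 2) = complex.Im w / complex.Re w.
Proof.
move=> w0; rewrite /sqrt_slope normc_sqr sqr_normcE.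
case: w w0 => x y /= x0.
have -> : x * y + y * x = (2 * x) * y by ring.
have -> : x ^+ 2 + y ^+ 2 + (x * x - y * y) = (2 * x) * x by ring.
by field.
Qed.

Lemma real_line_span (w : C) : complex.Re w != 0 ->
  real_line (complex.Im w / complex.Re w)%:E = [set (t%:C)%C * w | t in [set: R]].
Proof.
move=> w0; apply/seteqP; split=> z.
  case: w w0 => x y /= x0; case: z => u v /= vE; exists (u / x) => //.
  by apply/eqP; rewrite eq_complex /= !mul0r subr0 addr0 divfK ?eqxx//= vE; apply/eqP; field.
move=> [t _ <-]; case: w w0 => x y /= x0; rewrite !mul0r subr0 addr0; field => //.
Qed.

Lemma real_line_mul (c w w' : C) (l : R) : complex.Re w != 0 -> complex.Re w' != 0 -> l != 0 ->
  c * w = (l%:C)%C * w' ->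
  [set c * v | v in real_line (complex.Im w / complex.Re w)%:E] =
  real_line (complex.Im w' / complex.Re w')%:E.
Proof.
move=> w0 w0' l0 cw; rewrite !real_line_span//.
apply/seteqP; split=> [_ [_ [t _ <-] <-]|_ [t _ <-]].
  by exists (t * l) => //; rewrite mulrCA cw mulrA -rmorphM.
exists (((t / l)%:C)%C * w); first by exists (t / l).
by rewrite mulrCA cw mulrA -rmorphM divfK.
Qed.

Lemma slope_V0 z : V0 z -> slope z = (complex.Im (1 : C) / complex.Re (1 : C))%:E.
Proof. by rewrite /base_disk /disk /= subr0 /slope => ->; rewrite mul0r. Qed.

Lemma slope_sqT (w : C) : V0 w -> complex.Re w != 0 ->
  slope (sqT T w) = (complex.Im w / complex.Re w)%:E.
Proof.
move=> w1 w0; rewrite /slope ifF; last first.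
  apply/negP => h; apply: (V0V1 (z := sqT T w)); first by rewrite /base_disk /disk /= subr0.
  by rewrite /target_disk -sqT_unit_disk; exists w.
by rewrite sqT_sub_cT sqrt_slope_sqr.
Qed.

Lemma core_iter z : E z -> E (F z).
Proof. by move=> h n _; have [] := h n.+1 I. Qed.

Lemma core_U z : E z -> U z.
Proof. by move=> h; have [] := h 1%N I. Qed.

Lemma core_neqT z : E z -> z <> T.
Proof. by move=> h; have [] := h 0%N I. Qed.

(** At depth zero a preimage of the core cannot be [T], since its image would be [T] again; all
    deeper conditions are those of the image. *)
Lemma core_preimage : U `&` F @^-1` E = E.
Proof.
apply/seteqP; split=> z; last by move=> h; split; [exact: core_U|exact: core_iter].
move=> [Uz Fz] [|n] _; last by split=> //; exact: Fz.
split; first exact: (box_sub (box_mapping Pbr)).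
by move=> zT; apply: (core_neqT Fz); rewrite zT (boxF_T Pbr).
Qed.

(* The points of [V1] above the imaginary axis leave the domain: the central
   piece doubles [w], and no other piece meets the axis. *)
Lemma core_Re (w : C) : V0 w -> E (sqT T w) -> complex.Re w != 0.
Proof.
move=> w1 Ew; apply/eqP => w0.
have wn0 : w != 0 by apply/eqP => wE; apply: (core_neqT Ew); rewrite wE /sqT expr0n addr0.
(* The hypotheses on [v] pass to [2 * v], so the bound for [n] at [2 * v] is the bound for [n.+1] at
   [v]; no nonzero [w] satisfies all of them. *)
suff H n : forall v : C, V0 v -> E (sqT T v) -> complex.Re v = 0 -> normc v < (1 / 2) ^+ n.
  have nw : 0 < normc w by rewrite normc_gt0.
  have [m hm] := disk_in_nbhs0 (@open_disk R 0 (normc w)) (disk_center 0 nw).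
  have h : disk 0 ((1 / 2) ^+ m) w by rewrite /disk /= subr0; exact: H.
  by have := hm _ h; rewrite /disk /= subr0 ltxx.
elim: n => [|n ih] v v1 Ev v0; first by move: v1; rewrite /base_disk /disk /= subr0 expr0.
have vV : V1 (sqT T v) by rewrite /target_disk -sqT_unit_disk; exists v.
have [z0|[[|k] _ h]] := core_U Ev; first by case: (V0V1 z0 vV).
  have nv : normc v < 1 / 2.
    move: h; rewrite /box_piece /disk /= sqT_sub_cT normc_sqr => h.
    by rewrite ltNge; apply/negP => h'; clear -h h'; nra.
  have n2 : normc (2 * v) = 2 * normc v.
    by rewrite normcM -[2 : C](rmorph_nat (real_complex R)) normc_real ger0_norm.
  have : normc (2 * v) < (1 / 2) ^+ n.
    apply: ih.
    - by rewrite /base_disk /disk /= subr0 n2; lra.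
    - rewrite -(boxF_core Pbr); first exact: core_iter.
      by rewrite /disk /= subr0.
    - by rewrite -[2 : C](rmorph_nat (real_complex R)); move: v0; case: (v) => x y /= ->; rewrite mulr0 mul0r subr0.
  by rewrite n2 exprS; lra.
have := cdisk_Re Pbr (disk_sub_cdisk (rtT_pieceS Pbr h)).
by rewrite /rtT sqT_sub_cT; case: (rt_or v) => ->; rewrite ?ReN v0 ?oppr0 ltxx.
Qed.

(** With lines spanned by 1 on [V0] and by [w] on [V1], the derivative multiplies the spanning
    vector by a real factor: [2 * z * 1 = 2 * z] on [V0], [4 * w = 2 * (2 * w)] on the central
    piece, and [r^-1 / (2 * w) * w = r^-1 / 2] on a tile. *)
Lemma slope_invariant z : E z ->
  [set derive1 F z * v | v in real_line (slope z)] = real_line (slope (F z)).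
Proof.
move=> Ez; have re1 : complex.Re (1 : C) != 0 by rewrite /= oner_neq0.
have [z0|z0|[k zk]] := boxU_cases (core_U Ez).
- have Fz := boxF_V0 b r z0; rewrite (boxF_derive_V0 b r z0).2 Fz (slope_V0 z0).
  have re : complex.Re z != 0 by apply: core_Re => //; rewrite -Fz; exact: core_iter.
  rewrite slope_sqT//; apply: (@real_line_mul _ _ _ 2) => //.
  by rewrite mulr1 (rmorph_nat (real_complex R)).
- have z1 := piece_V1 Pbr z0; move: (z1); rewrite /target_disk -(sqT_unit_disk T) => -[w w0 wz].
  have rew : complex.Re w != 0 by apply: core_Re => //; rewrite wz.
  have w2 : disk 0 (1 / 2) w.
    move: z0; rewrite -wz /box_piece /disk /= sqT_sub_cT normc_sqr subr0 => h.
    by rewrite ltNge; apply/negP => h'; clear -h h'; nra.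
  have v0 : V0 (2 * w).
    rewrite /base_disk /disk /= subr0 normcM -[2 : C](rmorph_nat (real_complex R)) normc_real ger0_norm//.
    by move: w2; rewrite /disk /= subr0; lra.
  have E2 : E (sqT T (2 * w)) by rewrite -(boxF_core Pbr w2) wz; exact: core_iter.
  rewrite (boxF_derive_piece0 Pbr z0).2 -wz (boxF_core Pbr w2) !slope_sqT//; last exact: core_Re.
  apply: (@real_line_mul _ _ _ 2) => //; first exact: core_Re.
  by rewrite (rmorph_nat (real_complex R)) mulrA -natrM.
- have wk := rtT_pieceS Pbr zk; set w := rtT T z in wk.
  have wz : sqT T w = z by exact: sqT_rtT.
  have w0 : V0 w.
    rewrite /base_disk /disk /= subr0; have [_ _] := disk_half_annulus Pbr wk; exact.
  have rew : complex.Re w != 0 by apply: core_Re => //; rewrite wz.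
  rewrite (boxF_derive_pieceS Pbr zk).2 -/w.
  have F0 : V0 (F z) by rewrite -(boxF_pieceS_image Pbr k); exists z.
  have sz : slope z = (complex.Im w / complex.Re w)%:E by rewrite -{1}wz slope_sqT.
  rewrite (slope_V0 F0) sz.
  have r0 := r_gt0 Pbr k.
  apply: (@real_line_mul _ _ _ ((r k)^-1 / 2)) => //.
    by rewrite mulf_neq0 ?invr_eq0 ?gt_eqF.
  have wn : w != 0 by apply/eqP => wE; move: rew; rewrite wE eqxx.
  rewrite mulr1 rmorphM (fmorphV (real_complex R) 2) (rmorph_nat (real_complex R)).
  by rewrite invfM mulrA divfK.
Qed.

Lemma measurable_core : measurable (@to_plane R @^-1` E : set plane).
Proof.
rewrite /invariant_core preimage_bigcap; apply: bigcapT_measurable => n.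
by apply: measurable_open_plane; exact: open_regular.
Qed.

Lemma measurable_slope : measurable_fun [set: plane] (slope \o @to_plane R).
Proof.
pose n (a : R) (p : plane) : measurableTypeR R := Num.sqrt ((p.1 - a) ^+ 2 + p.2 ^+ 2).
have mS : measurable_fun [set: measurableTypeR R] (Num.sqrt : measurableTypeR R -> measurableTypeR R).
  by apply: continuous_measurable_fun; exact: sqrt_continuous.
have m1 (a : R) : measurable_fun [set: plane] (fun p : plane => p.1 - a : measurableTypeR R).
  by apply: measurable_funB; [exact: measurable_fst|exact: measurable_cst].
have mn a : measurable_fun [set: plane] (n a).
  apply: (measurableT_comp mS); apply: measurable_funD; apply: measurable_funX.
    exact: m1.
  exact: measurable_snd.
have sE : slope \o @to_plane R = fun p =>
    if n 0 p < 1 then (0 : \bar R)%E else (p.2 / (n 3 p + (p.1 - 3)))%:E.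
  apply/funext => -[x y]; rewrite /slope /sqrt_slope /n /= !subr0.
  by [].
rewrite sE; apply: measurable_fun_ifT.
- by apply: measurable_fun_ltr; [exact: mn|exact: measurable_cst].
- exact: measurable_cst.
- apply/measurable_EFinP; apply: measurable_funM; first exact: measurable_snd.
  (* The denominator is nonnegative, so its inverse is the real power of exponent -1, a measurable
     function. *)
  apply: (eq_measurable_fun (fun p : plane => (n 3 p + (p.1 - 3)) `^ (-1) : measurableTypeR R)).
    move=> p _; rewrite powR_inv1//; have := ler_norm (- (p.1 - 3)); rewrite normrN.
    have : `|p.1 - 3| <= n 3 p by rewrite /n -sqrtr_sqr ler_sqrt ?lerDl ?addr_ge0 ?sqr_ge0.
    lra.
  apply: (measurableT_comp (measurable_powR (-1))).
  by apply: measurable_funD; [exact: mn|exact: m1].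
Qed.

Lemma core_line_field : measurable_line_field (nonescaping F U V) E slope /\
  invariant_line_field F U E slope.
Proof.
split; last by split; [exact: core_preimage|exact: slope_invariant].
split.
- exact: core_nonescaping.
- by apply: caratheodory_measurable_mu_ext; exact: measurable_core.
- exact: area_core_gt0.
- by move=> z _; rewrite /slope; case: ifP.
- move=> Y mY; apply: caratheodory_measurable_mu_ext.
  rewrite preimage_setI; apply: measurableI; first exact: measurable_core.
  by have := measurable_slope measurableT mY; rewrite setTI.
Qed.

Lemma box_line_field : line_field_box_mapping F U V.
Proof.
split.
- exact: box_mapping.
- exact: non_renormalizable.
- split; [exact: box_no_permutation|exact: off_crit_null|exact: nonescaping_well_inside].
- by apply: lt_le_trans (area_core_gt0 Pbr) _; apply: area_le; exact: core_nonescaping.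
- by exists E, slope; exact: core_line_field.
Qed.

Lemma boxF0_neq0 : F 0 <> 0.
Proof.
rewrite boxF0 => T0; apply: (@V0V1 R 0); first exact: disk_center.
by have : V1 T := disk_center _ ltr01; rewrite T0.
Qed.

Lemma is_component_UV1_eq : is_component (U `&` V1) = range piece.
Proof.
apply/seteqP; split=> W; first by move=> /(is_component_UV1 Pbr)[j ->]; exists j.
by move=> [j _ <-]; apply/(is_component_UV1 Pbr); exists j.
Qed.

Lemma infinite_pieces : infinite_set (range piece).
Proof.
apply/infiniteP; apply/pcard_leP/injfunPex => /=.
exists piece => [j _|i j _ _ E']; first by exists j.
have [z zi] := piece_nonempty Pbr i; apply: (piece_disj Pbr zi); by rewrite -E'.
Qed.

End LineField.

Theorem proposition13p1 (R : realType) :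
  (exists (F : R[i]^o -> R[i]^o) (U V : set R[i]^o),
     line_field_box_mapping F U V) /\
  (exists (F : R[i]^o -> R[i]^o) (U V : set R[i]^o),
     line_field_box_mapping F U V /\
     exists (c : R[i]^o) (V0 V1 U1 : set R[i]^o),
       [/\ (* (1) *)
           [/\ crit F U = [set c], F (F c) = F c & F c <> c],
           (* (2) *)
           [/\ is_component V = [set V0; V1], V0 <> V1,
               U `&` V0 = V0, V0 c
             & is_component (U `&` V1) U1 /\ U1 (F c)],
           (* (3) *)
           infinite_set (is_component (U `&` V1)) /\
           area (V1 `\` \bigcup_(W in is_component (U `&` V1)) W) = 0%E
         & (* (4) *)
           F @` U1 = V1 /\
           forall W, is_component (U `&` V1) W -> W <> U1 -> F @` W = V0]).
Proof.
have [b [r Pbr]] := packing_exists (@open_half_annulus R) (half_annulus_nonempty R)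
  (@half_annulus_bounded R).
have L := box_line_field Pbr.
split; first by exists (boxF b r), (boxU b r), (@boxV R).
exists (boxF b r), (boxU b r), (@boxV R); split=> //.
exists 0, (@base_disk R), (@target_disk R), (box_piece b r 0); split.
- split; [exact: crit_boxF|by rewrite boxF0 (boxF_T Pbr)|exact: boxF0_neq0].
- split.
  + by apply/seteqP; split=> W /is_component_V.
  + move=> E; apply: (@V0V1 R 0); first exact: disk_center.
    by rewrite -E; exact: disk_center.
  + exact: UV0.
  + exact: disk_center.
  + split; first by apply/(is_component_UV1 Pbr); exists 0%N.
    by rewrite boxF0; apply: disk_center; lra.
- rewrite (is_component_UV1_eq Pbr) bigcup_image; split; [exact: infinite_pieces|exact: tiling].
- split; first exact: boxF_piece0_image.
  by move=> W /(is_component_UV1 Pbr)[[|k] ->] // _; exact: boxF_pieceS_image.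
Qed.
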